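(* Let $T\ge 1$ be an integer, let $\mathcal{X}_1,\dots,\mathcal{X}_T$ be Polish spaces, and let $d$ be any metric on $\mathcal{X}=\prod_{t=1}^T\mathcal{X}_t$ that metrizes the product topology. Let $\mu\in\mathcal{P}_1(\mathcal{X})$ and $C>0$. Each of the following statements implies the next one: (a) $\mu$ satisfies the adapted $T_1(C)$ inequality, i.e. $\mathcal{AW}_1(\mu,\nu)\le C\sqrt{2H(\nu\,|\,\mu)}$ for all $\nu\in\mathcal{P}(\mathcal{X})$. (b) $\mu$ satisfies the $T_1(C)$ inequality, i.e. $\mathcal{W}_1(\mu,\nu)\le C\sqrt{2H(\nu\,|\,\mu)}$ for all $\nu\in\mathcal{P}(\mathcal{X})$. (c) For any $x_0\in\mathcal{X}$ and $\alpha\in\left(0,\frac{1}{2C^2}\right)$, $\mu$ satisfies the adapted $T_1(C')$ inequality, i.e. $\mathcal{AW}_1(\mu,\nu)\le C'\sqrt{2H(\nu\,|\,\mu)}$ for all $\nu\in\mathcal{P}(\mathcal{X})$, where $$C'=\frac{2\sqrt{T}+1}{\sqrt{\alpha}}\left(1+\log\int_{\mathcal{X}}e^{\alpha d(x,x_0)^2}\,\mu(dx)\right)^{1/2}.$$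
   Context: $\mathcal{P}(\mathcal{X})$ is the set of Borel probability measures on $\mathcal{X}$, and $\mathcal{P}_1(\mathcal{X})$ is the set of $\rho\in\mathcal{P}(\mathcal{X})$ with $\int_{\mathcal{X}}d(x,x_0)\,\rho(dx)<\infty$ for some (equivalently any) $x_0\in\mathcal{X}$. Relative entropy: $H(\nu\,|\,\mu)=\int_{\mathcal{X}}\log\left(\frac{d\nu}{d\mu}\right)d\nu$ if $\nu\ll\mu$, and $H(\nu\,|\,\mu)=+\infty$ otherwise. $\mathrm{Cpl}(\mu,\nu)$ is the set of couplings of $\mu$ and $\nu$, i.e. Borel probability measures on $\mathcal{X}\times\mathcal{X}$ with marginals $\mu$ and $\nu$. A coupling $\pi\in\mathrm{Cpl}(\mu,\nu)$ is bicausal if for $(X,Y)\sim\pi$ (with $X=(X_1,\dots,X_T)$, $Y=(Y_1,\dots,Y_T)$) and every $t\in\{1,\dots,T-1\}$: under $\pi$, $(Y_1,\dots,Y_t)$ is conditionally independent of $X$ given $(X_1,\dots,X_t)$, and $(X_1,\dots,X_t)$ is conditionally independent of $Y$ given $(Y_1,\dots,Y_t)$. The set of bicausal couplings is denoted $\mathrm{Cpl}_{bc}(\mu,\nu)$. The $1$-Wasserstein and $1$-adapted Wasserstein distances are $$\mathcal{W}_1(\mu,\nu)=\inf_{\pi\in\mathrm{Cpl}(\mu,\nu)}\int_{\mathcal{X}\times\mathcal{X}}d(x,y)\,\pi(dx,dy),\qquad \mathcal{AW}_1(\mu,\nu)=\inf_{\pi\in\mathrm{Cpl}_{bc}(\mu,\nu)}\int_{\mathcal{X}\times\mathcal{X}}d(x,y)\,\pi(dx,dy).$$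 *)

(* Defs.v *)
From HB Require Import structures.
From mathcomp Require Import all_boot all_order all_algebra.
From mathcomp Require Import all_classical all_reals all_analysis.

Set Implicit Arguments.
Unset Strict Implicit.
Unset Printing Implicit Defensive.

Import Order.TTheory GRing.Theory Num.Theory.
Import numFieldNormedType.Exports.

Local Open Scope classical_set_scope.
Local Open Scope ring_scope.
Local Open Scope charge_scope.

Section metrics.
Variables (R : realType) (S : topologicalType).
Implicit Type d : S -> S -> R.

(* Nonnegativity follows from these axioms. *)
Definition is_metric d : Prop :=
  [/\ forall x y, d x y = 0 <-> x = y,
      forall x y, d x y = d y x &
      forall x y z, d x z <= d x y + d y z].

Definition metrizes d : Prop :=
  forall (x : S) (A : set S),
    nbhs x A <-> exists2 e : R, 0 < e & [set y | d x y < e] `<=` A.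

Definition complete_metric d : Prop :=
  forall u : nat -> S,
    (forall e : R, 0 < e -> exists N : nat, forall m n : nat,
       (N <= m)%N -> (N <= n)%N -> d (u m) (u n) < e) ->
    exists l : S, forall e : R, 0 < e -> exists N : nat, forall n : nat,
       (N <= n)%N -> d (u n) l < e.

Definition polish : Prop :=
  (exists d, [/\ is_metric d, metrizes d & complete_metric d]) /\
  (exists2 D : set S, countable D & dense D).

End metrics.
Arguments polish : clear implicits.

Notation borel S := (g_sigma_algebraType (@open S)).

Section conditional_independence.
Context {disp : measure_display} {Om : measurableType disp} {R : realType}.
Variable P : probability Om R.
Implicit Types (F G H : set (set Om)) (f g : Om -> R).

(* [g] is a version of the conditional expectation of [f] given the
   sub-sigma-algebra [H]. *)
Definition is_cond_exp H f g : Prop :=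
  [/\ forall B : set R, measurable B -> H (g @^-1` B),
      P.-integrable setT (EFin \o g) &
      forall A, H A ->
        (\int[P]_(w in A) (g w)%:E = \int[P]_(w in A) (f w)%:E)%E].

(* P(A `&` B | H) = P(A | H) P(B | H) almost surely. Conditional probabilities
   exist and are unique up to null sets, so asking for some versions [f], [g]
   is the same as asking for all of them. *)
Definition cond_indep F G H : Prop :=
  forall A B, F A -> G B ->
    exists f g, [/\ is_cond_exp H \1_A f, is_cond_exp H \1_B g &
                    is_cond_exp H \1_(A `&` B) (f \* g)].

End conditional_independence.

Definition path_space (T : nat) (X : 'I_T -> ptopologicalType) : Type :=
  prod_topology (fun t => X t).

HB.instance Definition _ (T : nat) (X : 'I_T -> ptopologicalType) :=
  Topological.copy (path_space X) (prod_topology (fun t => X t)).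
HB.instance Definition _ (T : nat) (X : 'I_T -> ptopologicalType) :=
  isPointed.Build (path_space X) (fun t => point).

(* The sigma-algebra generated by the coordinates Z_i, i in J, of a
   path-valued map Z. *)
Definition coord_sigma (T : nat) (X : 'I_T -> ptopologicalType) (Om : Type)
    (Z : Om -> path_space X) (J : set 'I_T) : set (set Om) :=
  <<s \bigcup_(i in J) preimage_set_system setT (fun w => (Z w i : borel (X i)))
                         measurable >>.

Section transport.
Context {R : realType} {S : ptopologicalType}.
Implicit Types (d : S -> S -> R) (mu nu : probability (borel S) R).

(* Couplings live on the Borel sigma-algebra of the topological product. *)
Definition coupling mu nu : set (probability (borel (S * S)%type) R) :=
  [set pi | forall A : set (borel S), measurable A ->
     pushforward pi (fst : borel (S * S)%type -> borel S) A = mu A /\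
     pushforward pi (snd : borel (S * S)%type -> borel S) A = nu A].

Definition transport_cost d (pi : probability (borel (S * S)%type) R) : \bar R :=
  (\int[pi]_z (d z.1 z.2)%:E)%E.

Definition W1 d mu nu : \bar R :=
  ereal_inf [set transport_cost d pi | pi in coupling mu nu].

Definition finite_first_moment d mu : Prop :=
  exists x0 : S, (\int[mu]_x (d x x0)%:E < +oo)%E.

End transport.

Definition rel_entropy {disp : measure_display} {Om : measurableType disp}
    {R : realType} (nu mu : probability Om R) : \bar R :=
  if `[< nu `<< mu >] then
    (\int[nu]_x lne (('d (charge_of_finite_measure nu) '/d mu) x))%E
  else +oo%E.

Section adapted_transport.
Context {R : realType} {T : nat} {X : 'I_T -> ptopologicalType}.
Notation S := (path_space X).
Implicit Types (d : S -> S -> R) (mu nu : probability (borel S) R).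

(* Coordinates are numbered from 0, so the first t ones are those of index
   less than t. *)
Definition bicausal mu nu : set (probability (borel (S * S)%type) R) :=
  [set pi | coupling mu nu pi /\
    forall t : nat, (1 <= t < T)%N ->
      let past := [set i : 'I_T | (i < t)%N] in
      cond_indep pi (coord_sigma snd past) (coord_sigma fst setT)
                    (coord_sigma fst past) /\
      cond_indep pi (coord_sigma fst past) (coord_sigma snd setT)
                    (coord_sigma snd past)].

Definition AW1 d mu nu : \bar R :=
  ereal_inf [set transport_cost d pi | pi in bicausal mu nu].

Definition T1_inequality d mu (C : R) : Prop :=
  forall nu, (W1 d mu nu <= C%:E * sqrte (2%:E * rel_entropy nu mu))%E.

Definition adapted_T1_inequality d mu (C : R) : Prop :=
  forall nu, (AW1 d mu nu <= C%:E * sqrte (2%:E * rel_entropy nu mu))%E.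

End adapted_transport.

(* Main.v *)
From HB Require Import structures.
Require Import Defs.
From mathcomp Require Import all_boot all_order all_algebra.
From mathcomp Require Import all_classical all_reals all_analysis.
From mathcomp Require Import measurable_realfun ring lra zify.
Import Order.TTheory GRing.Theory Num.Theory.
Import numFieldNormedType.Exports.
Local Open Scope classical_set_scope.
Local Open Scope ring_scope.

(** A bicausal coupling is a coupling, so AW_1 dominates W_1 and the adapted
    inequality implies T_1. The converse has two independent halves.

    Exponential integrability follows from Marton's argument. Conditioning [mu]
    on the event that the distance to [x0] is at least [s] gives a law of
    relative entropy [- ln p], where [p] is the probability of the event, at
    transport distance at least [s - m] from [mu], where [m] is the mean
    distance to [x0]. The inequality T_1(C) then bounds [p] by
    [exp (- (s - m) ^ 2 / (2 C ^ 2))] ([gaussian_tail]), which makes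
    [exp (alpha * d x x0 ^ 2)] integrable ([exp_moment_of_tail]).

    For the transport bound, let [r] be the density of [nu] with respect to
    [mu], [H] the relative entropy, [phi] the distance to [x0], and [L] the
    logarithm of the exponential moment. Couple two paths, of laws [mu] and
    [nu], step by step: as long as they agree, the next coordinates are made to
    agree with the largest conditional probability; from the first disagreement
    on, they continue independently given the common past. With
    [g s] the density of the first [s] coordinates and [M s] the product over
    [i < s] of [min (1, g (i + 1) / g i)], the paths agree up to time [T] with
    density [M T]. Whether and how they separate at a step is decided with the
    coordinates seen up to this step, so the coupling is bicausal
    ([total_integral_causal], [splitting_coupling_bicausal]).

    A pair of paths that separate costs at most [phi x + phi y]. The separated
    mass has density [1 - M T] for the first marginal and [r - M T] for the
    second, so the cost is at most the integral of
    [phi * |r - 1| + 2 * phi * (1 - M T)] ([splitting_cost_bound]). The first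
    term is bounded by a weighted Pinsker inequality ([weighted_pinsker]). For
    the second one, the integral of [phi ^ 2] is at most [L / alpha], and
    [1 - M T] is a sum over the steps of losses whose squares are controlled by
    the conditional relative entropies of the steps; these add up to at most
    [H] by the chain rule, so that the integral of [(1 - M T) ^ 2] is at most
    [2 * T * H] ([separation_sqr], [entropy_sum], [separated_mass]).

    The conditional laws needed for this construction are made explicit. A
    Polish path space is a Borel retract of the real line
    ([path_space_retract]), so that conditional quantiles turn one uniform
    variable into a sample of the future given the past
    ([conditional_sampler]). Conditional expectations become integrals over
    that variable ([cexp]), which are defined at every point. *)

Set Implicit Arguments.
Unset Strict Implicit.
Unset Printing Implicit Defensive.

(** * Countable bases and Borel measurability *)

Definition countable_base (Z : topologicalType) (C : nat -> set Z) : Prop :=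
  (forall n, open (C n)) /\
  forall (U : set Z) x, nbhs x U -> exists n, C n x /\ C n `<=` U.

Section borel_maps.

Lemma measurable_preimage d d' (Om : measurableType d) (Om' : measurableType d')
    (f : Om -> Om') (A : set Om') :
  measurable_fun setT f -> measurable A -> measurable (f @^-1` A).
Proof. by move=> mf mA; rewrite -[X in measurable X]setTI; exact: mf. Qed.

Lemma countable_base_open (Z : topologicalType) (C : nat -> set Z) :
  countable_base C -> forall U : set Z, open U ->
  U = \bigcup_(n in [set n | C n `<=` U]) C n.
Proof.
move=> [_ bC] U oU; apply/seteqP; split => [x Ux|x [n /= CU Cx]]; last exact: CU.
by have [n [Cx CU]] := bC U x (open_nbhs_nbhs (conj oU Ux)); exists n.
Qed.

Lemma measurable_fun_generated (Z : pointedType) (G : set (set Z)) d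
    (Om : measurableType d) (f : Om -> g_sigma_algebraType G) :
  (forall U : set Z, G U -> measurable (f @^-1` U)) ->
  measurable_fun [set: Om] f.
Proof.
move=> mf.
apply: (@measurability _ _ Om (g_sigma_algebraType G) setT f G erefl).
by move=> _ [U GU <-]; rewrite setTI; exact: mf.
Qed.

Lemma measurable_fun_borel (Z : ptopologicalType) (C : nat -> set Z) d
    (Om : measurableType d) (f : Om -> borel Z) :
  countable_base C -> (forall n, measurable (f @^-1` (C n))) ->
  measurable_fun [set: Om] f.
Proof.
move=> bC mf; apply: measurable_fun_generated => U oU.
rewrite (countable_base_open bC oU) preimage_bigcup.
exact: bigcup_measurable.
Qed.

Lemma borel_open (Z : ptopologicalType) (U : set Z) :
  open U -> measurable (U : set (borel Z)).
Proof. by move=> oU; apply: sub_sigma_algebra. Qed.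

Lemma continuous_borel (Y Z : ptopologicalType) (f : Y -> Z) :
  continuous f -> measurable_fun [set: borel Y] (f : borel Y -> borel Z).
Proof.
move=> cf; apply: measurable_fun_generated => U oU.
by apply: borel_open; move/continuousP: cf; apply.
Qed.

Lemma measurable_fun_to_real (R : realType) (Y : pointedType) (G : set (set Y))
    (f : Y -> R) : (forall U : set R, open U -> G (f @^-1` U)) ->
  measurable_fun setT (f : g_sigma_algebraType G -> R).
Proof.
move=> Gf; apply: (@measurability _ _ (g_sigma_algebraType G) (measurableTypeR R)
  setT f (@RGenOpens.G R) (@RGenOpens.measurableE R)).
move=> _ [_ [x [y ->]] <-]; rewrite setTI; apply: sub_sigma_algebra.
by apply: Gf; exact: interval_open.
Qed.

End borel_maps.

Section metric_base.
Context {R : realType} {S : ptopologicalType} (d : S -> S -> R).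
Hypotheses (dm : is_metric d) (dz : metrizes d).

Lemma metric_ge0 x y : 0 <= d x y.
Proof.
case: dm => d0 dC dT; have := dT x y x; rewrite (dC y x) (proj2 (d0 x x) erefl).
by rewrite -mulr2n -mulr_natl pmulr_rge0.
Qed.

Lemma metric_xx x : d x x = 0. Proof. by case: dm => d0 _ _; apply/d0. Qed.

Lemma open_metric_ball x e : open [set y | d x y < e].
Proof.
case: dm => _ _ dT; rewrite openE => y /= xye; apply/dz.
exists (e - d x y); first by rewrite subr_gt0.
move=> z /= yz; apply: le_lt_trans (dT _ y _) _.
by rewrite -ltrBrDl.
Qed.

Lemma separable_countable_base (D : set S) :
  countable D -> dense D -> exists C : nat -> set S, countable_base C.
Proof.
move=> /countable_injP[f] inj dD.
pose C (n : nat) : set S := if unpickle n is Some km then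
  [set y | exists x, [/\ D x, f x = km.1 & d x y < km.2.+1%:R^-1]] else set0.
exists C; split => [n|U x /dz[e e0 sU]].
  rewrite /C; case: unpickle => [[k m]|]; last exact: open0.
  suff -> : [set y | exists x, [/\ D x, f x = k & d x y < m.+1%:R^-1]] =
     \bigcup_(x in [set x | D x /\ f x = k]) [set y | d x y < m.+1%:R^-1].
    by apply: bigcup_open => x _; exact: open_metric_ball.
  by apply/seteqP; split => [y [z [Dz fz h]]|y [z [Dz fz] h]]; exists z.
have [m hm] : exists m, m.+1%:R^-1 < e / 2 :> R.
  have [m _ hm] : \forall m \near \oo, m.+1%:R^-1 < e / 2 :> R.
    exact: (near_infty_natSinv_lt (PosNum (divr_gt0 e0 (ltr0n _ 2)))).
  by exists m; apply: hm => /=.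
have [z [xz Dz]] : [set y | d x y < m.+1%:R^-1] `&` D !=set0.
  by apply: dD; [exists x; rewrite /= metric_xx invr_gt0|exact: open_metric_ball].
case: dm => _ dC dT.
exists (pickle (f z, m)); rewrite /C pickleK /=; split.
  by exists z; split => //; rewrite dC.
move=> y [z' [Dz' fz' z'y]]; apply: sU => /=.
have zz' : z' = z by apply: inj => //; rewrite inE.
subst z'; apply: le_lt_trans (dT _ z _) _; rewrite (splitr e).
by apply: ltrD; [apply: lt_trans xz _|apply: lt_trans z'y _].
Qed.

End metric_base.

Lemma polish_countable_base (R : realType) (Z : ptopologicalType) :
  polish R Z -> exists C : nat -> set Z, countable_base C.
Proof.
move=> [[d [dm dz _]] [D cD dD]]; exact: (separable_countable_base dm dz cD dD).
Qed.

Lemma polish_bases (R : realType) (I : Type) (X : I -> ptopologicalType) :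
  (forall i, polish R (X i)) ->
  exists C : forall i, nat -> set (X i), forall i, countable_base (C i).
Proof.
move=> Xpol; have h i := polish_countable_base (Xpol i).
by exists (fun i => sval (cid (h i))) => i; exact: svalP (cid (h i)).
Qed.

Section product_bases.

Lemma countable_base_prod (Y Z : ptopologicalType) (B : nat -> set Y)
    (C : nat -> set Z) : countable_base B -> countable_base C ->
  exists D : nat -> set (Y * Z), countable_base D /\
    forall n, exists i j, D n = B i `*` C j.
Proof.
move=> [oB bB] [oC bC].
pose D n : set (Y * Z) := if unpickle n is Some (i, j) then B i `*` C j
  else B 0%N `*` C 0%N.
have DE n : exists i j, D n = B i `*` C j.
  by rewrite /D; case: unpickle => [[i j]|]; [exists i, j|exists 0%N, 0%N].
exists D; split => //.
split => [n|U [x y] [[V W] /= [Vx Wy] VW]].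
  have [i [j ->]] := DE n; rewrite openE => -[x y] [/= Bx Cy].
  exists (B i, C j); last by [].
  by split => /=; apply: open_nbhs_nbhs; split.
have [i [Bx BV]] := bB V x Vx; have [j [Cy CW]] := bC W y Wy.
exists (pickle (i, j)); rewrite /D pickleK; split => // -[a b] [/= /BV Va /CW Wb].
by apply: VW.
Qed.

Context {T : nat} {X : 'I_T -> ptopologicalType}.
Local Notation S := (path_space X).

Lemma continuous_coord (i : 'I_T) : continuous (fun x : S => x i).
Proof.
move=> x; have /cvg_sup/(_ i) h : nbhs x --> x by apply: cvg_id.
by move=> A nA; apply: h; exact: initial_continuous.
Qed.

(** Finitely many coordinates make the boxes a base of the product topology. *)
Lemma box_nbhs (x : S) (U : set S) : nbhs x U ->
  exists V : forall i, set (X i), (forall i, nbhs (x i) (V i)) /\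
    (forall y, (forall i, V i (y i)) -> U y).
Proof.
pose F := filter_from [set V : forall i, set (X i) | forall i, nbhs (x i) (V i)]
  (fun V => [set y : S | forall i, V i (y i)]).
have FF : Filter F.
  apply: filter_from_filter.
    by exists (fun i => setT) => i; exact: filterT.
  move=> V W nV nW; exists (fun i => V i `&` W i).
    by move=> i; apply: filterI; [exact: nV|exact: nW].
  by move=> y h; split => i; have [] := h i.
have Fx : F --> x.
  apply/cvg_sup => i A [B [[V oV <-] Vx] VA].
  pose W j : set (X j) := [set z | forall e : i = j, V (ecast k (X k) (esym e) z)].
  exists W => [j|y Wy]; last by apply: VA; exact: (Wy i erefl).
  have [ij|ij] := pselect (i = j).
    subst j; apply: (@filterS _ _ _ V); last exact: open_nbhs_nbhs.
    by move=> z Vz e; rewrite eq_axiomK.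
  by apply: (@filterS _ _ _ setT); [move=> z _ e; case: ij|exact: filterT].
by move=> /Fx [V nV VU]; exists V; split => // y Vy; exact: VU.
Qed.

Lemma countable_base_path (B : forall i, nat -> set (X i)) :
  (forall i, countable_base (B i)) ->
  exists C : nat -> set S, countable_base C /\
    forall n, exists h : 'I_T -> nat, C n = [set x | forall i, B i (h i) (x i)].
Proof.
move=> bB.
pose box (h : 'I_T -> nat) : set S := [set x | forall i, B i (h i) (x i)].
pose C n := if unpickle n is Some h then box (h : {ffun 'I_T -> nat})
  else box (fun=> 0%N).
have CE n : exists h, C n = box h.
  by rewrite /C; case: unpickle => [h|]; [exists h|exists (fun=> 0%N)].
exists C; split => //; split => [n|U x /box_nbhs[V [nV VU]]].
  have [h ->] := CE n.
  rewrite openE => x hx.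
  apply: (filter_forall (f := fun i => [set y : S | B i (h i) (y i)])
    (F := nbhs x)) => i.
  have /continuousP oi := @continuous_coord i.
  by apply: open_nbhs_nbhs; split => //; apply: oi; have [] := bB i.
have hb i : exists n, B i n (x i) /\ B i n `<=` V i by have [_ hi] := bB i; exact: hi (nV i).
have [h hP] := choice hb.
exists (pickle [ffun i => h i]); rewrite /C pickleK /box; split.
  by move=> i; rewrite ffunE; have [] := hP i.
by move=> y hy; apply: VU => i; have [_] := hP i; apply; have := hy i; rewrite ffunE.
Qed.

Lemma measurable_coord (i : 'I_T) :
  measurable_fun [set: borel S] (fun x : borel S => x i : borel (X i)).
Proof. by apply: continuous_borel; exact: continuous_coord. Qed.

Lemma measurable_fun_path (B : forall i, nat -> set (X i)) d
    (Om : measurableType d) (f : Om -> borel S) :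
  (forall i, countable_base (B i)) ->
  (forall i, measurable_fun setT (fun w => f w i : borel (X i))) ->
  measurable_fun setT f.
Proof.
move=> bB mf; have [C [bC CE]] := countable_base_path bB.
apply: (measurable_fun_borel bC) => n; have [h ->] := CE n.
suff -> : f @^-1` [set x | forall i, B i (h i) (x i)] =
    \bigcap_i ((fun w => f w i) @^-1` B i (h i)).
  apply: fin_bigcap_measurable; first exact: finite_finset.
  move=> i _; rewrite -[X in measurable X]setTI.
  by apply: mf => //; apply: borel_open; have [] := bB i.
by apply/seteqP; split => [x h1 i _|x h1 i]; exact: h1.
Qed.

(** Countable bases make every open set of the product a countable union of
    measurable rectangles. *)
Lemma measurable_fun_borel_pair (Y Z : ptopologicalType) (B : nat -> set Y)
    (C : nat -> set Z) d (Om : measurableType d) (f : Om -> borel Y)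
    (g : Om -> borel Z) : countable_base B -> countable_base C ->
  measurable_fun setT f -> measurable_fun setT g ->
  measurable_fun setT (fun w => (f w, g w) : borel (Y * Z)%type).
Proof.
move=> bB bC mf mg; have [D [bD DE]] := countable_base_prod bB bC.
apply: measurable_fun_generated => U oU.
rewrite (countable_base_open bD oU) preimage_bigcup.
apply: bigcup_measurable => n _.
have [i [j ->]] := DE n.
have -> : (fun w => (f w, g w)) @^-1` (B i `*` C j) =
  (f @^-1` B i) `&` (g @^-1` C j) by [].
apply: measurableI; rewrite -[X in measurable X]setTI.
  by apply: mf => //; apply: borel_open; case: bB.
by apply: mg => //; apply: borel_open; case: bC.
Qed.

Lemma measurable_borel_fst (Y Z : ptopologicalType) :
  measurable_fun setT (fst : borel (Y * Z)%type -> borel Y).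
Proof.
apply: measurable_fun_generated => U oU; apply: sub_sigma_algebra.
have /continuousP cfst : continuous (fst : Y * Z -> _) by move=> x; exact: cvg_fst.
exact: cfst.
Qed.

Lemma measurable_borel_snd (Y Z : ptopologicalType) :
  measurable_fun setT (snd : borel (Y * Z)%type -> borel Z).
Proof.
apply: measurable_fun_generated => U oU; apply: sub_sigma_algebra.
have /continuousP csnd : continuous (snd : Y * Z -> _) by move=> x; exact: cvg_snd.
exact: csnd.
Qed.

End product_bases.

(** * Polish path spaces are Borel retracts of the real line *)

Section ternary_code.
Context {R : realType} d (Om : measurableType d) (A : nat -> set Om).
Hypothesis mA : forall n, measurable (A n).

Let c (n : nat) : R := 2 / 3 ^+ n.+1.
Let s (n : nat) (x : Om) : R := \sum_(k < n) c k * \1_(A k) x.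
Let r (n : nat) : R := (3 ^+ n)^-1.

Let c_ge0 n : 0 <= c n. Proof. by rewrite divr_ge0// exprn_ge0. Qed.

Let s_S n x : s n.+1 x = s n x + c n * \1_(A n) x.
Proof. by rewrite /s big_ord_recr. Qed.

Let rE n : r n = c n + r n.+1.
Proof.
by rewrite /r /c exprS invfM; move: (_ ^+ n)^-1 => w; field.
Qed.

Let s_nd x : nondecreasing_seq (s ^~ x).
Proof. by apply/nondecreasing_seqP => n; rewrite s_S lerDl mulr_ge0. Qed.

Let sr_ni x : nonincreasing_seq (fun n => s n x + r n).
Proof.
apply/nonincreasing_seqP => n; rewrite s_S (rE n) -!addrA lerD2l lerD2r.
by rewrite ler_piMr// indicE; case: (_ \in _).
Qed.

Let s_le x m n : s m x <= s n x + r n.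
Proof.
have r0 k : 0 <= r k by rewrite invr_ge0 exprn_ge0.
have [mn|/ltnW nm] := leqP m n.
  by apply: le_trans (s_nd x mn) _; rewrite lerDl.
by apply: le_trans _ (sr_ni x nm); rewrite lerDl.
Qed.

Let e (x : Om) : R := sup (range (s ^~ x)).

Let s_e n x : s n x <= e x.
Proof.
apply: ub_le_sup; last by exists n.
by exists (s 0%N x + r 0%N) => _ [m _ <-]; exact: s_le.
Qed.

Let e_s n x : e x <= s n x + r n.
Proof. by apply: ge_sup; [exists (s 0%N x), 0%N|move=> _ [m _ <-]; exact: s_le]. Qed.

Let e_digit n x : A n x <-> s n x + c n <= e x.
Proof.
split => [Ax|sce].
  by apply: le_trans (s_e n.+1 x); rewrite s_S indicE mem_set// mulr1.
apply: contrapT => nAx; have := e_s n.+1 x.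
rewrite s_S indicE memNset// mulr0 addr0; apply/negP; rewrite -ltNge.
apply: lt_le_trans sce; rewrite ltrD2l /r /c ltr_pdivlMr ?exprn_gt0//.
by rewrite mulVf ?ltr1n// expf_neq0.
Qed.

Let t := fix t (n : nat) (y : R) : R :=
  if n is m.+1 then t m y + (if t m y + c m <= y then c m else 0) else 0.

Let t_e n x : t n (e x) = s n x.
Proof.
elim: n => [|n IH]; first by rewrite /s big_ord0.
rewrite /= IH s_S indicE; case: ifPn => [/e_digit Ax|nAx].
  by rewrite mem_set// mulr1.
by rewrite memNset ?mulr0// => /e_digit; exact/negP.
Qed.

Let mt_le n : measurable_fun setT (t n) ->
  measurable_fun setT ((fun y => t n y + c n <= y) : measurableTypeR R -> bool).
Proof. by move=> mt; apply: measurable_fun_ler => //; exact: measurable_funD. Qed.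

Let mt n : measurable_fun setT (t n : measurableTypeR R -> R).
Proof.
elim: n => [|n IH] /=; first exact: measurable_cst.
by apply: measurable_funD => //; apply: measurable_fun_ifT => //; exact: mt_le.
Qed.

(** Ternary expansions with digits 0 and 2 code countably many events in one
    real number from which a Borel map can read each of them back. *)
Lemma ternary_code : exists e : Om -> R,
  [/\ measurable_fun setT e, forall x, 0 <= e x <= 1 &
      forall n, exists2 B : set (measurableTypeR R), measurable B &
        A n = e @^-1` B].
Proof.
exists e; split => [|x|n].
- have ms n : measurable_fun setT (s n).
    rewrite /s; apply: measurable_sum => k.
    by apply: measurable_funM => //; exact: measurable_indic.
  have -> : e = fun x => sups (s ^~ x) 0.
    apply/funext => x; rewrite /e /sups; congr sup.
    by apply/seteqP; split => [_ [n _ <-]|_ [n _ <-]]; exists n.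
  apply: measurable_fun_sups => // x _.
  by exists (s 0%N x + r 0%N) => _ [m _ <-]; exact: s_le.
- have := s_e 0 x; have := e_s 0 x.
  by rewrite /s big_ord0 /r expr0 invr1 add0r => h1 h2; apply/andP.
- exists [set y | t n y + c n <= y].
    by rewrite -[X in measurable X]setTI; exact: (mt_le (mt n) measurableT (Y := [set true])).
  apply/seteqP; split => x /=; rewrite t_e => h; exact/e_digit.
Qed.

End ternary_code.

Section factorization.
Context {R : realType} {Z : ptopologicalType} {Om : Type}.
Variables (e : Om -> R) (c : Om -> Z).
Hypothesis Zpol : polish R Z.
Hypothesis cE : forall U : set Z, open U ->
  exists2 B : set (measurableTypeR R), measurable B & c @^-1` U = e @^-1` B.

Let first (B : nat -> set R) (y : R) : nat :=
  if pselect (exists k, `[< B k y >]) is left h then ex_minn h else 0%N.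

Let firstP B y k : B k y -> B (first B y) y.
Proof.
move=> Bk; rewrite /first; case: pselect => [h|[]].
  by case: ex_minnP => m /asboolP.
by exists k; apply/asboolP.
Qed.

Let mfirst (B : nat -> set (measurableTypeR R)) :
  (forall k, measurable (B k)) -> forall N : set nat, measurable (first B @^-1` N).
Proof.
move=> mB N.
have -> : first B @^-1` N = \bigcup_(k in N) (first B @^-1` [set k]).
  by apply/seteqP; split => [y Ny|y [k Nk /= ->]]; [exists (first B y)|].
apply: bigcup_measurable => k _.
have -> : first B @^-1` [set k] = (seqDU B k) `|`
    (if k == 0%N then ~` \bigcup_k B k else set0).
  apply/seteqP; split => y /=; rewrite /first.
    case: pselect => [h|h].
      case: ex_minnP => m /asboolP Bm mmin mk; left; subst m; split => //.
      rewrite -bigcup_mkord => -[j /= jm Bj].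
      by have := mmin j (asboolT Bj); rewrite leqNgt jm.
    move=> k0; right; rewrite -k0 eqxx => -[j _ Bj]; apply: h.
    by exists j; apply/asboolP.
  case: pselect => [h|h] /=.
    case: ex_minnP => m /asboolP Bm mmin [[Bk nB]|].
      apply/eqP; rewrite eqn_leq mmin ?asboolT// leqNgt; apply/negP => mk.
      by apply: nB; rewrite -bigcup_mkord; exists m.
    by case: eqP => // _ []; exists m.
  case => [[Bk _]|]; last by case: eqP.
  by case: h; exists k; apply/asboolP.
apply: measurableU; first exact: seqDU_measurable.
by case: ifP => // _; apply: measurableC; apply: bigcup_measurable => j _; exact: mB.
Qed.

(** Doob-Dynkin: a map into a Polish space whose events are events of [e] is
    a Borel function of [e]. Round [c] to the first point of a dense sequence
    within 2^-n, which is a countably valued function of [e]; discarding the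
    roundings that jump too far makes the sequence Cauchy at every real number,
    also outside the range of [e], and the limit is the required function. *)
Lemma polish_factorization : exists phi : R -> Z,
  measurable_fun setT (phi : measurableTypeR R -> borel Z) /\
  forall x, phi (e x) = c x.
Proof.
have [C [oC bC]] := polish_countable_base Zpol.
case: Zpol => [[d [dm dz dc]] _].
have dC x y : d x y = d y x by case: dm.
have dT x y z : d x z <= d x y + d y z by case: dm.
pose z k := xget point (C k).
pose q (n : nat) : R := (2 ^+ n)^-1.
have q0 n : 0 < q n by rewrite invr_gt0 exprn_gt0.
have qS n : q n = q n.+1 + q n.+1.
  by rewrite /q exprS invfM; move: (_ ^+ n)^-1 => w; field.
have zdense n x : exists k, d (z k) x < q n.
  have /bC[k [Ck sk]] : nbhs x [set y | d x y < q n].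
    by apply/dz; exists (q n).
  by exists k; rewrite dC; apply: sk; apply: xgetPex; exists x.
have hB n k : exists B : set (measurableTypeR R), measurable B /\
    c @^-1` [set y | d (z k) y < q n] = e @^-1` B.
  by have [B mB BE] := cE (open_metric_ball dm dz (z k) (q n)); exists B.
pose B n k := sval (cid (hB n k)).
have mB n k : measurable (B n k) by rewrite /B; case: cid => /= ? [].
have BE n k x : B n k (e x) <-> d (z k) (c x) < q n.
  rewrite /B; case: cid => /= D [_ DE].
  have : (c @^-1` [set y | d (z k) y < q n]) x = (e @^-1` D) x by rewrite DE.
  by rewrite /preimage /= => <-.
(* [z (K n y)] rounds at scale [q n]; a rounding that is too far from the
   previous one is replaced by the previous one. *)
pose K := fix K (n : nat) (y : R) : nat := if n is m.+1 then
   (if d (z (K m y)) (z (first (B m.+1) y)) < q m + q m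
    then first (B m.+1) y else K m y) else first (B 0%N) y.
have mK n (N : set nat) : measurable (K n @^-1` N : set (measurableTypeR R)).
  elim: n N => [|n IH] N; first exact: mfirst.
  have -> : K n.+1 @^-1` N = \bigcup_(i in [set: nat]) \bigcup_(j in [set: nat])
      ((K n @^-1` [set i]) `&` (first (B n.+1) @^-1` [set j]) `&`
       [set y | N (if d (z i) (z j) < q n + q n then j else i)]).
    apply/seteqP; split => [y Ny|y [i _ [j _ [[/= <- <-]]]]//].
    by exists (K n y) => //; exists (first (B n.+1) y).
  apply: bigcup_measurable => i _; apply: bigcup_measurable => j _.
  apply: measurableI; first by apply: measurableI; [exact: IH|exact: mfirst].
  by have [h|h] := pselect (N (if d (z i) (z j) < q n + q n then j else i));
    [rewrite (_ : [set _ | _] = setT)|rewrite (_ : [set _ | _] = set0)] => //;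
    apply/seteqP; split.
have Kstep n y : d (z (K n y)) (z (K n.+1 y)) <= q n + q n.
  rewrite /=; case: ifPn => [/ltW//|_]; rewrite (metric_xx dm).
  by rewrite addr_ge0// ltW.
have Ktail n m y : d (z (K n y)) (z (K (n + m)%N y)) <=
    4 * q n - 4 * q (n + m)%N.
  elim: m => [|m IH]; first by rewrite addn0 subrr (metric_xx dm).
  rewrite addnS; apply: le_trans (dT _ (z (K (n + m)%N y)) _) _.
  apply: le_trans (lerD IH (Kstep _ _)) _.
  by rewrite (qS (n + m)%N); lra.
have small (eps : R) : 0 < eps -> exists N, forall n, (N <= n)%N -> 4 * q n < eps.
  move=> e0; have [N _ hN] : \forall n \near \oo, q n < eps / 4.
    have /cvgrPdist_lt/(_ (eps / 4)) : q n @[n --> \oo] --> (0 : R).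
      rewrite (_ : q = geometric 1 2^-1); last first.
        by apply/funext => n /=; rewrite mul1r exprVn.
      by apply: cvg_geometric; rewrite ger0_norm ?invr_ge0// invf_lt1 ?ltr1n.
    move=> /(_ (divr_gt0 e0 (ltr0n _ 4))); apply: filterS => n.
    by rewrite sub0r normrN gtr0_norm.
  exists N => n Nn; have := hN n Nn; rewrite /= ltr_pdivlMr//.
  by rewrite mulrC.
have Klim y : exists l, forall n, d (z (K n y)) l <= 4 * q n.
  have [|l hl] := dc (fun n => z (K n y)).
    move=> eps e0; have [N hN] := small _ e0; exists N.
    have wlg m n : (N <= m)%N -> (m <= n)%N -> d (z (K m y)) (z (K n y)) < eps.
      move=> Nm mn; rewrite -(subnKC mn); apply: le_lt_trans (Ktail _ _ _) _.
      apply: le_lt_trans (hN m Nm); rewrite gerBl.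
      by rewrite mulr_ge0// ltW.
    move=> m n Nm Nn; have [mn|/ltnW nm] := leqP m n; first exact: wlg.
    by rewrite dC; exact: wlg.
  exists l => n; apply/ler_addgt0Pr => eps e0; have [N hN] := hl _ e0.
  apply: le_trans (dT _ (z (K (n + N)%N y)) _) _.
  apply: lerD; last by apply/ltW/hN; rewrite leq_addl.
  by apply: le_trans (Ktail _ _ _) _; rewrite gerBl mulr_ge0// ltW.
have [phi phiP] := choice Klim.
have small8 (eps : R) : 0 < eps -> exists n, 4 * q n + 4 * q n < eps.
  move=> e0; have [N hN] := small (eps / 2) (divr_gt0 e0 (ltr0n _ 2)).
  by exists N; have := hN N (leqnn N); lra.
exists phi; split.
  apply: measurable_fun_generated => U oU.
  have -> : phi @^-1` U = \bigcup_n (K n @^-1`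
      [set k | [set x | d (z k) x <= 4 * q n] `<=` U]).
    apply/seteqP; split => [y Uy|y [n _ /= sU]]; last exact/sU/phiP.
    have /dz[eps e0 sU] : nbhs (phi y) U by apply: open_nbhs_nbhs.
    have [n hn] := small8 _ e0; exists n => // x /= hx; apply: sU => /=.
    apply: le_lt_trans (dT _ (z (K n y)) _) _; apply: le_lt_trans hn.
    by apply: lerD => //; rewrite dC; exact: phiP.
  by apply: bigcup_measurable => n _; exact: mK.
move=> x.
have near n : d (z (first (B n) (e x))) (c x) < q n.
  have [k hk] := zdense n (c x); apply/BE; apply: firstP; apply/BE; exact: hk.
have KE n : K n (e x) = first (B n) (e x).
  elim: n => [//|n IH] /=; rewrite IH ifT//.
  apply: le_lt_trans (dT _ (c x) _) _; rewrite ltrD//.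
  rewrite dC; apply: lt_le_trans (near n.+1) _.
  by rewrite (qS n) lerDl ltW.
have [d0 _ _] := dm; apply/d0/eqP; rewrite eq_le (metric_ge0 dm) andbT.
apply/ler_addgt0Pr => eps e0; rewrite add0r; have [n hn] := small8 _ e0.
apply: le_trans (dT _ (z (K n (e x))) _) _; apply: le_trans _ (ltW hn).
apply: lerD; first by rewrite dC; exact: phiP.
rewrite KE; apply: le_trans (ltW (near n)) _.
by rewrite ler_peMl ?ler1n// ltW.
Qed.

End factorization.

(** [ternary_code] turns the basic events of all coordinates into one real
    number, from which [polish_factorization] recovers each coordinate. *)
Lemma path_space_retract (R : realType) (T : nat) (X : 'I_T -> ptopologicalType) :
  (forall t, polish R (X t)) ->
  exists (e : path_space X -> R) (phi : R -> path_space X),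
  [/\ measurable_fun setT (e : borel (path_space X) -> R),
      measurable_fun setT (phi : measurableTypeR R -> borel (path_space X)),
      forall x, 0 <= e x <= 1 & forall x, phi (e x) = x].
Proof.
move=> Xpol.
have [B bB] := polish_bases Xpol.
pose A (n : nat) : set (borel (path_space X)) :=
  if unpickle n is Some (i, k) then (fun x : path_space X => x i) @^-1` B i k
  else set0.
have mA n : measurable (A n).
  rewrite /A; case: unpickle => [[i k]|]; last exact: measurable0.
  rewrite -[X in measurable X]setTI; apply: measurable_coord => //.
  by apply: borel_open; have [] := bB i.
have [e [me e01 eA]] := @ternary_code R _ _ A mA.
have hphi i : exists phi : R -> X i,
    measurable_fun setT (phi : measurableTypeR R -> borel (X i)) /\
    forall x, phi (e x) = x i.
  apply: polish_factorization (Xpol i) _ => U oU.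
  have hb (k : nat) : exists D : set (measurableTypeR R), measurable D /\
      (fun x : path_space X => x i) @^-1` B i k = e @^-1` D.
    have [D mD] := eA (pickle (i, k)).
    by rewrite /A pickleK => DE; exists D.
  have [D DP] := choice hb.
  exists (\bigcup_(k in [set k | B i k `<=` U]) D k).
    by apply: bigcup_measurable => k _; have [] := DP k.
  rewrite [in LHS](countable_base_open (bB i) oU) !preimage_bigcup.
  by apply: eq_bigcupr => k _; have [] := DP k.
pose phi y : path_space X := fun i => sval (cid (hphi i)) y.
exists e, phi; split => //.
  by apply: (measurable_fun_path bB) => i; have [] := svalP (cid (hphi i)).
move=> x; apply: functional_extensionality_dep => i.
by have [_] := svalP (cid (hphi i)); apply.
Qed.

(** * Conditional sampling *)

Lemma integral_one d (S : measurableType d) (R : realType)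
    (m : {measure set S -> \bar R}) (A : set S) :
  measurable A -> (\int[m]_(x in A) 1%:E = m A)%E.
Proof. by move=> mA; rewrite -[RHS]mul1e; exact: (integral_cst m mA 1%E). Qed.

Section integral_comparison.
Context d (S : measurableType d) (R : realType).
Variable m : {measure set S -> \bar R}.
Local Open Scope ereal_scope.

Lemma ae_le_of_integral (f g : S -> R) :
  measurable_fun setT f -> measurable_fun setT g ->
  (forall x, (0 <= f x)%R) -> (forall x, (0 <= g x)%R) ->
  \int[m]_x (g x)%:E < +oo ->
  (forall A, measurable A ->
     \int[m]_(x in A) (f x)%:E <= \int[m]_(x in A) (g x)%:E) ->
  {ae m, forall x, (f x <= g x)%R}.
Proof.
move=> mf mg f0 g0 gfin fg.
pose A := [set x | (g x < f x)%R].
have mA : measurable A.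
  rewrite -[A]setTI; exact: (measurable_fun_ltr mg mf measurableT (Y := [set true])).
have mgA : measurable_fun A (EFin \o g).
  by apply/measurable_EFinP; exact: measurable_funTS.
have mdA : measurable_fun A (fun x => (f x - g x)%:E).
  by apply/measurable_EFinP; apply: measurable_funTS; exact: measurable_funB.
have gA : \int[m]_(x in A) (g x)%:E < +oo.
  apply: le_lt_trans gfin; apply: ge0_subset_integral => //.
    exact/measurable_EFinP.
  by move=> x _; rewrite lee_fin.
have : \int[m]_(x in A) (f x - g x)%:E = 0.
  have : \int[m]_(x in A) (g x)%:E + \int[m]_(x in A) (f x - g x)%:E <=
         \int[m]_(x in A) (g x)%:E.
    rewrite -ge0_integralD//.
    - apply: le_trans (fg _ mA); rewrite le_eqVlt; apply/orP; left; apply/eqP.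
      by apply: eq_integral => x _; rewrite -EFinD addrC subrK.
    - by move=> x _; rewrite lee_fin.
    - by move=> x /= h; rewrite lee_fin subr_ge0 ltW.
  rewrite -leeBrDl; last by rewrite ge0_fin_numE//; apply: integral_ge0 => x _; rewrite lee_fin.
  rewrite subee; last by rewrite ge0_fin_numE//; apply: integral_ge0 => x _; rewrite lee_fin.
  move=> h; apply/eqP; rewrite eq_le h; apply: integral_ge0 => x /= hx.
  by rewrite lee_fin subr_ge0 ltW.
have -> : \int[m]_(x in A) (f x - g x)%:E = \int[m]_(x in A) `|(f x - g x)%:E|.
  apply: eq_integral => x; rewrite inE => /= hx.
  by rewrite ger0_norm// subr_ge0 ltW.
move/ae_eq_integral_abs => /(_ mA mdA); apply: filterS => x /= h.
rewrite leNgt; apply/negP => hx; have := h hx => -[/eqP].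
by rewrite subr_eq0 => /eqP e; move: hx; rewrite e ltxx.
Qed.

End integral_comparison.

Section conditional_probability.
Context d d' (S : measurableType d) (S' : measurableType d') (R : realType).
Variables (mu : probability S R) (p : {mfun S >-> S'}).

Let mpre A : measurable A -> measurable (p @^-1` A).
Proof. exact: measurable_preimage. Qed.

Section restricted_law.
Variables (B : set S) (mB : measurable B).

Definition restricted_law of measurable B := fun A => mu (p @^-1` A `&` B).
Local Notation nu := (restricted_law mB).

Let nu0 : nu set0 = 0%E.
Proof. by rewrite /restricted_law preimage_set0 set0I measure0. Qed.

Let nu_ge0 A : (0 <= nu A)%E. Proof. exact: measure_ge0. Qed.

Let nu_sigma_additive : semi_sigma_additive nu.
Proof.
move=> F mF tF mUF; rewrite /restricted_law preimage_bigcup setI_bigcupl.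
apply: measure_semi_sigma_additive.
- by move=> n; apply: measurableI => //; exact: mpre.
- apply/trivIsetP => /= i j _ _ ij; rewrite setIACA -preimage_setI.
  by move/trivIsetP : tF => /(_ _ _ _ _ ij) ->//; rewrite preimage_set0 set0I.
- by apply: bigcup_measurable => n _; apply: measurableI => //; exact: mpre.
Qed.

HB.instance Definition _ := isMeasure.Build _ _ _ nu nu0 nu_ge0 nu_sigma_additive.

Let nu_fin : fin_num_fun nu.
Proof.
move=> A mA; rewrite ge0_fin_numE//.
apply: (@le_lt_trans _ _ 1%E); last exact: ltry.
by apply: probability_le1; apply: measurableI => //; exact: mpre.
Qed.

HB.instance Definition _ := @Measure_isFinite.Build _ _ _ nu nu_fin.

End restricted_law.

(** The Radon-Nikodym derivative of the law of [p] restricted to [B] with respect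
    to the law of [p]. Cutting it at 1 changes it on a null set only. *)
Lemma conditional_probability (B : set S) : measurable B ->
  exists g : S' -> R, [/\ measurable_fun setT g, forall y, 0 <= g y <= 1 &
    forall A, measurable A ->
      (\int[mu]_(x in p @^-1` A) (g (p x))%:E = mu (p @^-1` A `&` B))%E].
Proof.
move=> mB; pose nu := restricted_law mB; pose la := distribution mu p.
have nula : nu `<< la.
  apply/null_content_dominatesP => A mA.
  rewrite /la /nu /distribution /pushforward /restricted_law /= => muA0.
  apply/eqP; rewrite eq_le measure_ge0 andbT -muA0.
  apply: le_measure; rewrite ?inE//; [|exact: mpre].
  by apply: measurableI => //; exact: mpre.
pose h := Radon_Nikodym_SigmaFinite.f nu la.
have h0 y : (0 <= h y)%E by exact: Radon_Nikodym_SigmaFinite.f_ge0.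
have hfin y : h y \is a fin_num by exact: Radon_Nikodym_SigmaFinite.f_fin_num.
have mh : measurable_fun setT h.
  exact: measurable_int (Radon_Nikodym_SigmaFinite.f_integrable nula).
have hE A : measurable A -> (\int[la]_(x in A) h x = nu A)%E.
  by move=> mA; rewrite -(Radon_Nikodym_SigmaFinite.f_integral nula).
pose k := fine \o h.
have mk : measurable_fun setT k by exact: measurableT_comp.
have k0 y : 0 <= k y by exact: fine_ge0.
have kE y : (k y)%:E = h y by rewrite fineK.
have k1 : {ae la, forall y, k y <= cst 1 y}.
  apply: ae_le_of_integral => //.
    rewrite integral_one//; apply: (@le_lt_trans _ _ 1%E); last exact: ltry.
    exact: probability_le1.
  move=> A mA; under eq_integral do rewrite kE.
  rewrite hE// integral_one// /nu /la /distribution /restricted_law /=.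
  by apply: le_measure; rewrite ?inE//; [apply: measurableI => //|]; exact: mpre.
exists (fun y => Num.min (k y) 1); split.
- exact: measurable_minr.
- by move=> y; rewrite le_min k0 ler01 ge_min lexx orbT.
- move=> A mA; transitivity (\int[la]_(y in A) (Num.min (k y) 1)%:E)%E.
    rewrite [RHS]ge0_integral_pushforward//.
      apply/measurable_EFinP; apply: measurable_funTS; exact: measurable_minr.
    by move=> y _; rewrite lee_fin le_min k0 ler01.
  rewrite (_ : mu _ = nu A)// -(hE A mA).
  apply: ge0_ae_eq_integral => //.
  - apply/measurable_EFinP; apply: measurable_funTS; exact: measurable_minr.
  - exact: measurable_funTS.
  - by move=> y _; rewrite lee_fin le_min k0 ler01.
  - by apply: filterS k1 => y /= ky _; rewrite min_l// kE.
Qed.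

End conditional_probability.

Definition image_measure d d' (S : measurableType d) (S' : measurableType d')
    (R : realType) (m : {measure set S -> \bar R}) (f : S -> S')
    (mf : measurable_fun setT f) : {measure set S' -> \bar R}.
Proof. refine (pushforward m f : {measure set S' -> \bar R}); exact: mf. Defined.

Section rays.
Context {R : realType} d (S : measurableType d).
Local Notation SR := (S * measurableTypeR R)%type.
Local Open Scope ereal_scope.

(** The sets [A `*` `]-oo, x[] form a pi-system which generates the product
    sigma-algebra. *)
Lemma measure_rays_unique (m1 m2 : {measure set SR -> \bar R}) :
  m1 setT < +oo ->
  (forall A (x : R), measurable A -> m1 (A `*` `]-oo, x[) = m2 (A `*` `]-oo, x[)) ->
  forall C, measurable C -> m1 C = m2 C.
Proof.
move=> m1T m12.
pose rect : set (set SR) :=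
  [set C | exists (A : set S) (x : R), measurable A /\ C = A `*` `]-oo, x[].
have mrect : rect `<=` measurable.
  by move=> _ [A [x [mA ->]]]; apply: measurableX.
apply: (measure_unique rect (fun n => setT `*` `]-oo, n%:R[)).
- apply/seteqP; split; last first.
    by apply: smallest_sub => //; exact: sigma_algebra_measurable.
  apply: smallest_sub; first exact: smallest_sigma_algebra.
  have sfst : preimage_set_system setT fst measurable `<=` <<s rect >>.
    move=> _ [A mA <-]; rewrite setTI.
    rewrite (_ : _ @^-1` _ = \bigcup_n (A `*` `]-oo, (n%:R : R)[)); last first.
      apply/seteqP; split => [[z u] /= Az|[z u] [n _ []]//].
      exists (Num.bound (Num.norm u)) => //; split => //=; rewrite in_itv/=.
      by apply: le_lt_trans (ler_norm u) (archi_boundP (normr_ge0 u)).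
    apply: sigma_algebra_bigcup => n; apply: sub_sigma_algebra.
    by exists A, n%:R.
  rewrite subUset; split => //.
  rewrite [X in preimage_set_system setT snd X](RGenInftyO.measurableE R).
  rewrite -g_sigma_preimageE.
  apply: smallest_sub; first exact: smallest_sigma_algebra.
  move=> _ [_ [x ->] <-]; rewrite setTI; apply: sub_sigma_algebra.
  exists setT, x; split => //; by apply/seteqP; split => -[z u] //= [].
- move=> _ _ [A [x [mA ->]]] [B [y [mB ->]]].
  exists (A `&` B), (Num.min x y); split; first exact: measurableI.
  rewrite -setXI; congr (_ `*` _); apply/seteqP; split => u /=; rewrite !in_itv/=.
    by rewrite lt_min => -[-> ->].
  by rewrite lt_min => /andP.
- by move=> n; exists setT, n%:R.
- apply/seteqP; split => // -[z u] _; exists (Num.bound (Num.norm u)) => //; split => //=.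
  by rewrite in_itv/=; apply: le_lt_trans (ler_norm u) (archi_boundP (normr_ge0 u)).
- by move=> _ [A [x [mA ->]]]; exact: m12.
- move=> n; apply: le_lt_trans m1T; apply: le_measure; rewrite ?inE//.
  exact: measurableX.
Qed.

End rays.

Section conditional_quantile.
Context {R : realType}.
Local Open Scope ereal_scope.

Definition unif : probability (measurableTypeR R) R := uniform_prob (@ltr01 R).

Lemma unif_lt (c : R) : (0 <= c <= 1)%R -> unif [set u | (u < c)%R] = c%:E.
Proof.
move=> /andP[c0 c1]; set A := [set u | _].
have -> : unif A = \int[lebesgue_measure]_(u in A) (uniform_pdf 0%R 1%R u)%:E by [].
rewrite integral_uniform_pdf {}/A.
have mlt : measurable ([set u | (u < c)%R] : set (measurableTypeR R)).
  by rewrite (_ : [set _ | _] = `]-oo, c[%classic)//; apply/seteqP; split => u;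
    rewrite /= in_itv.
rewrite (eq_integral (cst 1)); last first.
  move=> u; rewrite inE => -[_ /=]; rewrite in_itv/= /uniform_pdf => ->.
  by rewrite subr0 invr1.
rewrite integral_cst ?mul1e; last exact: measurableI.
rewrite (_ : _ `&` _ = `[0%R, c[%classic).
  by rewrite /= lebesgue_measure_itv/= lte_fin; case: ltP => [|c_0];
    rewrite ?sube0//; congr (_%:E); apply/eqP; rewrite eq_le c_0 c0.
apply/seteqP; split => u /=; rewrite !in_itv/=.
  by move=> [uc /andP[-> _]].
by move=> /andP[u0 uc]; rewrite uc u0 (le_trans (ltW uc)).
Qed.

Context d d' (S : measurableType d) (S' : measurableType d').
Variables (mu : probability S R) (p : {mfun S >-> S'}) (e : S -> R).
Hypotheses (me : measurable_fun setT e) (e01 : forall x, (0 <= e x <= 1)%R).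

Let mp A : measurable A -> measurable (p @^-1` A).
Proof. exact: measurable_preimage. Qed.

Let me_lt x : measurable [set s | (e s < x)%R].
Proof.
rewrite -[X in measurable X]setTI.
exact: (measurable_fun_ltr me (measurable_cst x) measurableT (Y := [set true])).
Qed.

(** Conditional distribution functions at rational points, made monotone by
    discarding a null set. *)
Lemma conditional_cdf : exists G : rat -> S' -> R,
  [/\ forall q, measurable_fun setT (G q),
      forall q y, (0 <= G q y <= 1)%R,
      forall q q' y, (q <= q')%R -> (G q y <= G q' y)%R &
      forall q A, measurable A ->
        \int[mu]_(x in p @^-1` A) (G q (p x))%:E =
        mu (p @^-1` A `&` [set s | (e s < ratr q)%R])].
Proof.
have hg q : exists g : S' -> R, [/\ measurable_fun setT g,
    forall y, (0 <= g y <= 1)%R & forall A, measurable A ->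
    \int[mu]_(x in p @^-1` A) (g (p x))%:E =
    mu (p @^-1` A `&` [set s | (e s < ratr q)%R])].
  exact: conditional_probability.
have [g gP] := choice hg.
have mg q : measurable_fun setT (g q) by have [] := gP q.
have g0 q y : (0 <= g q y)%R by have [_ /(_ y)/andP[]] := gP q.
have g1 q y : (g q y <= 1)%R by have [_ /(_ y)/andP[]] := gP q.
have gE q A : measurable A -> \int[distribution mu p]_(y in A) (g q y)%:E =
    mu (p @^-1` A `&` [set s | (e s < ratr q)%R]).
  move=> mA; rewrite ge0_integral_pushforward//; first by have [_ _ ->] := gP q.
  - by apply/measurable_EFinP; exact: measurable_funTS.
  - by move=> y _; rewrite lee_fin.
pose D q q' := [set y | (g q' y < g q y)%R].
have mD q q' : measurable (D q q').
  rewrite -[X in measurable X]setTI.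
  exact: (measurable_fun_ltr (mg q') (mg q) measurableT (Y := [set true])).
have D0 q q' : (q <= q')%R -> (distribution mu p).-negligible (D q q').
  move=> qq'.
  have : {ae distribution mu p, forall y, (g q y <= g q' y)%R}.
    apply: ae_le_of_integral => //.
      rewrite gE// preimage_setT setTI.
      by apply: (@le_lt_trans _ _ 1); [exact: probability_le1|exact: ltry].
    move=> A mA; rewrite !gE//; apply: le_measure; rewrite ?inE.
    - by apply: measurableI; [exact: mp|exact: me_lt].
    - by apply: measurableI; [exact: mp|exact: me_lt].
    - by apply: setIS => s /= /lt_le_trans; apply; rewrite ler_rat.
  by apply: negligibleS => y /=; rewrite /D /= ltNge => /negP.
pose F n := if unpickle n is Some (q, q') then
  (if (q <= q' :> rat)%R then D q q' else set0) else set0.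
pose N := \bigcup_n F n.
have mN : measurable N.
  apply: bigcupT_measurable => n; rewrite /F; case: unpickle => [[q q']|//].
  by case: ifP.
have N0 : (distribution mu p).-negligible N.
  apply: negligible_bigcup => n; rewrite /F; case: unpickle => [[q q']|].
    by case: ifP => [/D0//|_]; exact: negligible_set0.
  exact: negligible_set0.
have mG q : measurable_fun setT (fun y => if y \in N then 0%R else g q y).
  apply: measurable_fun_ifT => //; apply: (measurable_fun_bool true).
  by rewrite setTI (_ : _ @^-1` _ = N)//; apply/seteqP; split => y /=; [exact: set_mem|exact: mem_set].
exists (fun q y => if y \in N then 0%R else g q y); split => [//|q y|q q' y qq'|q A mA].
- by case: ifPn => _; rewrite ?lexx ?ler01// g0 g1.
- case: ifPn => // /negP yN; rewrite leNgt; apply/negP => h; apply: yN.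
  rewrite inE; exists (pickle (q, q')); first exact: I.
  by rewrite /F pickleK qq'.
- rewrite -gE//.
  transitivity (\int[distribution mu p]_(y in A)
      (if y \in N then 0%R else g q y)%:E).
    rewrite [RHS]ge0_integral_pushforward//.
      by apply/measurable_EFinP; exact: measurable_funTS.
    by move=> y _; case: ifP; rewrite lee_fin.
  apply: ge0_ae_eq_integral => //.
  + by apply/measurable_EFinP; exact: measurable_funTS.
  + by apply/measurable_EFinP; exact: measurable_funTS.
  + by move=> y _; case: ifP; rewrite lee_fin.
  + by move=> y _; rewrite lee_fin.
  + apply: (negligibleS _ N0) => y /=; apply: contra_notP => yN _.
    by rewrite memNset.
Qed.

(** The conditional quantile transform: [Q y] maps the uniform law to the
    conditional law of [e] given [p = y]. Quantiles are infima of rational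
    points, where the conditional distribution function is available, and of 1,
    which keeps the infimum meaningful for every [y] and [u]. *)
Lemma conditional_quantile : exists Q : S' -> R -> R,
  measurable_fun setT
    ((fun yu => Q yu.1 yu.2) : S' * measurableTypeR R -> measurableTypeR R) /\
  forall C : set (S' * measurableTypeR R), measurable C ->
    (mu \x unif) [set zu | C (p zu.1, Q (p zu.1) zu.2)] =
    mu [set x | C (p x, e x)].
Proof.
have [G [mG G01 Gnd GE]] := conditional_cdf.
pose V (y : S') (u : R) : set R := [set x | x = 1%R \/
  exists q : rat, [/\ x = ratr q, (0 <= ratr q :> R)%R & (u < G q y)%R]].
pose Q y u := inf (V y u).
have V0 y u : V y u !=set0 by exists 1%R; left.
have Vlb y u : has_lbound (V y u).
  by exists 0%R => x [->|[q [-> ? _]]]; rewrite ?ler01.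
have Qlt y u (x : R) : (x <= 1)%R -> (Q y u < x)%R <->
    exists q : rat, [/\ (ratr q < x)%R, (0 <= ratr q :> R)%R & (u < G q y)%R].
  move=> x1; split => [h|[q [qx q0 uG]]].
    have [t Vt tx] := inf_lt (V0 y u) h.
    case: Vt => [t1|[q [tq q0 uG]]]; last by exists q; split => //; rewrite -tq.
    by move: tx; rewrite t1 ltNge x1.
  by apply: le_lt_trans qx; apply: ge_inf; [exact: Vlb|right; exists q].
have Q1 y u : (Q y u <= 1)%R by apply: ge_inf; [exact: Vlb|left].
pose Eq (q : rat) : set (S' * measurableTypeR R) := [set yu | (yu.2 < G q yu.1)%R].
have mEq q : measurable (Eq q).
  rewrite -[X in measurable X]setTI.
  apply: (measurable_fun_ltr _ _ measurableT (Y := [set true])) => //.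
  exact: (measurableT_comp (mG q) measurable_fst).
have QltE (x : R) : (x <= 1)%R -> [set yu : S' * R | (Q yu.1 yu.2 < x)%R] =
    \bigcup_(q in [set q : rat | (ratr q < x)%R /\ (0 <= ratr q :> R)%R]) Eq q.
  move=> x1; apply/seteqP; split => [[y u] /= /(Qlt _ _ _ x1)[q [? ? ?]]|].
    by exists q.
  by move=> [y u] [q [? ?] ?]; apply/(Qlt _ _ _ x1); exists q.
have mQ : measurable_fun setT
    ((fun yu => Q yu.1 yu.2) : S' * measurableTypeR R -> measurableTypeR R).
  apply: (@measurability _ _ (S' * measurableTypeR R)%type (measurableTypeR R) setT
     _ (@RGenInftyO.G R) (@RGenInftyO.measurableE R)).
  move=> _ [_ [x ->] <-]; rewrite setTI.
  have [x1|x1] := leP x 1%R.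
    rewrite (_ : _ @^-1` _ = [set yu : S' * R | (Q yu.1 yu.2 < x)%R]).
      rewrite QltE// bigcup_mkcond; apply: bigcupT_measurable_rat => q.
      by case: ifP.
    by apply/seteqP; split => yu /=; rewrite in_itv.
  rewrite (_ : _ @^-1` _ = setT)//; apply/seteqP; split => // yu _ /=.
  by rewrite in_itv/= (le_lt_trans _ x1).
exists Q; split => // C mC.
pose phi1 (zu : S * measurableTypeR R) : S' * measurableTypeR R :=
  (p zu.1, Q (p zu.1) zu.2).
pose phi2 (x : S) : S' * measurableTypeR R := (p x, e x).
have mp' : measurable_fun setT p by exact: measurable_funP.
have mp1 : measurable_fun setT (fun zu : S * measurableTypeR R => p zu.1).
  exact: (measurableT_comp mp' measurable_fst).
have mphi1 : measurable_fun setT phi1.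
  apply: measurable_fun_pair => //.
  exact: (measurableT_comp mQ (measurable_fun_pair mp1 measurable_snd)).
have mphi2 : measurable_fun setT phi2 by exact: measurable_fun_pair.
apply: (measure_rays_unique (m1 := image_measure (mu \x unif) mphi1)
  (m2 := image_measure mu mphi2)) => //.
  rewrite -[X in X < _]/((mu \x unif) setT) -setXTT product_measure1E//.
  rewrite -[X in X < _]/(mu setT * unif setT).
  by rewrite (probability_setT mu) (probability_setT unif) mule1 ltry.
move=> A x mA.
rewrite -[LHS]/((mu \x unif) (phi1 @^-1` (A `*` `]-oo, x[))).
rewrite -[RHS]/(mu (phi2 @^-1` (A `*` `]-oo, x[))).
pose F1 (q : rat) := phi1 @^-1` (A `*` setT) `&` [set zu | (zu.2 < G q (p zu.1))%R].
pose F2 (q : rat) := (p @^-1` A `&` [set s | (e s < ratr q)%R]).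
have mF2 q : measurable (F2 q) by apply: measurableI; [exact: mp|exact: me_lt].
have mF1 q : measurable (F1 q).
  apply: measurableI; rewrite -[X in measurable X]setTI.
    by apply: mphi1 => //; exact: measurableX.
  apply: (measurable_fun_ltr _ _ measurableT (Y := [set true])) => //.
  exact: (measurableT_comp (mG q) mp1).
have F12 q : (mu \x unif) (F1 q) = mu (F2 q).
  rewrite -GE// [RHS]integral_mkcond; apply: eq_integral => z _ /=.
  rewrite patchE; case: ifPn => [|] zA.
    rewrite -unif_lt//; congr (unif _); apply/seteqP; split => u /=.
      by rewrite /xsection /= inE => -[_].
    by move=> h; rewrite /xsection /= inE; split => //; split => //=; exact: set_mem zA.
  rewrite (_ : xsection _ _ = set0) ?measure0//; apply/seteqP; split => // u /=.
  rewrite /xsection /= inE => -[[/= pzA _] _]; move/negP: zA; apply.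
  exact: mem_set.
have [x1|x1] := ltP 1%R x.
  rewrite (_ : phi1 @^-1` _ = (p @^-1` A) `*` setT); last first.
    apply/seteqP; split => [[z u] [/= ? _] //|[z u] [/= ? _]]; split => //=.
    by rewrite in_itv/= (le_lt_trans _ x1).
  rewrite (_ : phi2 @^-1` _ = p @^-1` A); last first.
    apply/seteqP; split => [z [/= ? _] //|z /= pz]; split => //=.
    by rewrite in_itv/= (le_lt_trans _ x1)//; have /andP[] := e01 z.
  rewrite product_measure1E//; last exact: mp.
  by rewrite -[LHS]/(mu (p @^-1` A) * unif setT) (probability_setT unif) mule1.
have P1E : phi1 @^-1` (A `*` `]-oo, x[) =
    \bigcup_(q in [set q : rat | (ratr q < x)%R /\ (0 <= ratr q :> R)%R]) F1 q.
  apply/seteqP; split => [[z u] [/= pz]|[z u] [q [/= qx q0]] [[/= pz _] /= h]].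
    rewrite in_itv/= => /(Qlt _ _ _ x1)[q [? ? ?]].
    by exists q => //; split.
  by split => //=; rewrite in_itv/=; apply/(Qlt _ _ _ x1); exists q.
have [x0|x0] := leP x 0%R.
  rewrite P1E bigcup0 ?measure0; last first.
    by move=> q [/= qx q0]; have := lt_le_trans qx x0; rewrite ltNge q0.
  rewrite (_ : phi2 @^-1` _ = set0) ?measure0//; apply/seteqP; split => // z [_ /=].
  rewrite in_itv/= => zx; have := lt_le_trans zx x0; rewrite ltNge.
  by have /andP[->] := e01 z.
(* [x] is approached from below by rationals, the only points where [F1] and
   [F2] are defined. *)
pose xn (n : nat) : R := (x - x * n.+1%:R^-1)%R.
have xnd n : (xn n < xn n.+1)%R.
  by rewrite /xn ltrD2l ltrN2 ltr_pM2l// ltf_pV2 ?posrE// ltr_nat.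
have xn_x n : (xn n < x)%R by rewrite /xn gtrBl mulr_gt0// invr_gt0.
have hq n : exists q : rat, (xn n < ratr q < xn n.+1)%R.
  by have [q] := rat_in_itvoo (xnd n); rewrite in_itv/= => h; exists q.
have [q qP] := choice hq.
have xn0 n : (0 <= xn n)%R.
  by rewrite /xn subr_ge0 ler_piMr ?(ltW x0)// invf_le1// ler1n.
have q0 n : (0 <= ratr (q n) :> R)%R.
  by have /andP[/ltW h _] := qP n; exact: le_trans h.
have qx n : (ratr (q n) < x)%R by have /andP[_ h] := qP n; exact: lt_trans h _.
have qnd n : (ratr (q n) <= ratr (q n.+1) :> R)%R.
  have /andP[_ /ltW h] := qP n; have /andP[/ltW h' _] := qP n.+1.
  exact: le_trans h h'.
have dense (y : R) : (y < x)%R -> exists n, (y <= ratr (q n))%R.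
  move=> yx.
  have [n _ hn] : \forall n \near \oo, (n.+1%:R^-1 < (x - y) / x)%R.
    have xy0 : (0 < (x - y) / x)%R by rewrite divr_gt0// subr_gt0.
    exact: (near_infty_natSinv_lt (PosNum xy0)).
  exists n; have /andP[/ltW h _] := qP n; apply: le_trans h.
  have := hn n (leqnn n); rewrite /= /xn ltr_pdivlMr// => h.
  by rewrite lerBrDr -lerBrDl mulrC ltW.
have ndF1 : nondecreasing_seq (F1 \o q).
  apply/nondecreasing_seqP => n; apply/subsetPset => -[z u] [h1 /= h2]; split => //=.
  by apply: lt_le_trans h2 _; apply: Gnd; rewrite -(ler_rat R).
have ndF2 : nondecreasing_seq (F2 \o q).
  apply/nondecreasing_seqP => n; apply/subsetPset => z [h1 /= h2]; split => //=.
  exact: lt_le_trans h2 _.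
have U1 : phi1 @^-1` (A `*` `]-oo, x[) = \bigcup_n (F1 \o q) n.
  rewrite P1E; apply/seteqP; split => [[z u] [r [/= rx r0]] [h1 /= h2]|].
    have [n hn] := dense _ rx; exists n => //; split => //=.
    by apply: lt_le_trans h2 _; apply: Gnd; rewrite -(ler_rat R).
  by move=> zu [n _ h]; exists (q n).
have U2 : phi2 @^-1` (A `*` `]-oo, x[) = \bigcup_n (F2 \o q) n.
  apply/seteqP; split => [z [/= pz]|z [n _ [/= pz h]]].
    rewrite in_itv/= => h.
    have [n hn] := dense ((e z + x) / 2)%R (midf_lt h).2.
    exists n => //; split => //=; apply: lt_le_trans hn; exact: (midf_lt h).1.
  by split => //=; rewrite in_itv/=; exact: lt_trans h (qx n).
rewrite U1 U2; apply: (@cvg_unique _ (@ereal_hausdorff R)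
    ((mu \x unif) \o (F1 \o q) @ \oo)).
- apply: nondecreasing_cvg_mu => //; first by move=> n; exact: mF1.
  by apply: bigcupT_measurable => n; exact: mF1.
- rewrite (_ : _ \o _ = mu \o (F2 \o q)); last first.
    by apply/funext => n /=; rewrite F12.
  apply: nondecreasing_cvg_mu => //; first by move=> n; exact: mF2.
  by apply: bigcupT_measurable => n; exact: mF2.
Qed.

End conditional_quantile.

Section path_sampling.
Context {R : realType} {T : nat} {X : 'I_T -> ptopologicalType}.
Local Notation S := (path_space X).
Hypothesis Xpol : forall t, polish R (X t).

Definition splice (t : nat) (x y : S) : S := fun i => if (i < t)%N then x i else y i.
Definition trunc (t : nat) (x : S) : S := splice t x point.

Lemma trunc_trunc s t x : trunc s (trunc t x) = trunc (minn s t) x.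
Proof.
apply: functional_extensionality_dep => i; rewrite /trunc /splice leq_min.
by case: ltnP => //=; case: ltnP.
Qed.

Lemma trunc_full x : trunc T x = x.
Proof. by apply: functional_extensionality_dep => i; rewrite /trunc /splice ltn_ord. Qed.

Lemma trunc_splice t x y : trunc t (splice t x y) = trunc t x.
Proof.
by apply: functional_extensionality_dep => i; rewrite /trunc /splice; case: ltnP.
Qed.

Lemma splice_trunc t x y : splice t (trunc t x) y = splice t x y.
Proof.
by apply: functional_extensionality_dep => i; rewrite /trunc /splice; case: ltnP.
Qed.

Lemma splice_id t x : splice t x x = x.
Proof. by apply: functional_extensionality_dep => i; rewrite /splice; case: ltnP. Qed.

Lemma measurable_splice t d (Om : measurableType d) (f g : Om -> borel S) :
  measurable_fun setT f -> measurable_fun setT g ->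
  measurable_fun setT (fun w => splice t (f w) (g w) : borel S).
Proof.
move=> mf mg.
have [B bB] := polish_bases Xpol.
apply: (measurable_fun_path bB) => i; rewrite /splice; case: ltnP => _.
  exact: (measurableT_comp (@measurable_coord _ _ i) mf).
exact: (measurableT_comp (@measurable_coord _ _ i) mg).
Qed.

Lemma measurable_trunc t : measurable_fun setT (trunc t : borel S -> borel S).
Proof. by apply: measurable_splice => //; exact: measurable_cst. Qed.

(** Conditional quantiles, carried from the real line to the path space by the
    retraction. That the resampled path keeps the first [t] coordinates is
    arranged by splicing, so that it holds everywhere and not just almost
    surely. *)
Lemma conditional_sampler (mu : probability (borel S) R) (t : nat) :
  exists Psi : S -> R -> S,
  [/\ measurable_fun setT
        ((fun zu => Psi zu.1 zu.2) : borel S * measurableTypeR R -> borel S),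
      forall z u, trunc t (Psi z u) = trunc t z,
      forall z u, Psi (trunc t z) u = Psi z u &
      forall B : set (borel S), measurable B ->
        (mu \x unif)%E [set zu | B (Psi zu.1 zu.2)] = mu B].
Proof.
have [e [phi [me mphi e01 phi_e]]] := path_space_retract Xpol.
pose p : {mfun borel S >-> borel S} := mfun_Sub (mem_set (measurable_trunc t)).
have [Q [mQ QE]] := conditional_quantile mu p me e01.
have msp : measurable_fun setT ((fun ay => splice t ay.1 (phi ay.2)) :
    borel S * measurableTypeR R -> borel S).
  apply: measurable_splice; first exact: measurable_fst.
  exact: (measurableT_comp mphi measurable_snd).
exists (fun z u => splice t z (phi (Q (trunc t z) u))); split.
- have mp1 : measurable_fun setT
      ((fun zu => trunc t zu.1) : borel S * measurableTypeR R -> borel S).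
    exact: (measurableT_comp (measurable_trunc t) measurable_fst).
  apply: measurable_splice; first exact: measurable_fst.
  apply: (measurableT_comp mphi).
  exact: (measurableT_comp mQ (measurable_fun_pair mp1 measurable_snd)).
- by move=> z u; rewrite trunc_splice.
- by move=> z u; rewrite splice_trunc trunc_trunc minnn.
- move=> B mB.
  have := QE _ (msp measurableT B mB); rewrite !setTI => h.
  transitivity (mu [set x | B (splice t (p x) (phi (e x)))]); last first.
    congr (mu _); apply/seteqP.
    by split=> x /=; rewrite phi_e splice_trunc splice_id.
  rewrite -[RHS]h; congr ((mu \x unif)%E _).
  by apply/seteqP; split => -[z u] /=; rewrite splice_trunc.
Qed.

End path_sampling.

(** * Sampling operators as pointwise conditional expectations *)

(** Integrals of such functions always make sense, so most identities below need
    no integrability hypothesis. *)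
Definition nnmf d (S : measurableType d) (R : realType) (f : S -> R) : Prop :=
  measurable_fun setT f /\ forall x, 0 <= f x.

Section nonnegative_measurable.
Context d (S : measurableType d) (R : realType).
Implicit Types f g : S -> R.

Lemma nnmf_inv f : nnmf f -> nnmf (fun x => (f x)^-1).
Proof.
move=> [mf f0]; split=> [|x]; last by rewrite invr_ge0.
rewrite (_ : (fun x => _) = (fun y => y `^ (-1)) \o f).
  by apply: measurableT_comp mf; exact: measurable_powR.
by apply/funext => x /=; rewrite powR_inv1.
Qed.

Lemma nnmf_mul f g : nnmf f -> nnmf g -> nnmf (fun x => f x * g x).
Proof.
by move=> [mf f0] [mg g0]; split=> [|x]; [exact: measurable_funM|exact: mulr_ge0].
Qed.

Lemma nnmf_div f g : nnmf f -> nnmf g -> nnmf (fun x => f x / g x).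
Proof. by move=> ? ?; apply: nnmf_mul => //; exact: nnmf_inv. Qed.

Lemma nnmf_add f g : nnmf f -> nnmf g -> nnmf (fun x => f x + g x).
Proof.
by move=> [mf f0] [mg g0]; split=> [|x]; [exact: measurable_funD|exact: addr_ge0].
Qed.

Lemma nnmf_min f g : nnmf f -> nnmf g -> nnmf (fun x => Num.min (f x) (g x)).
Proof.
by move=> [mf f0] [mg g0]; split=> [|x]; [exact: measurable_minr|rewrite le_min f0 g0].
Qed.

Lemma nnmf_posB f g : nnmf f -> nnmf g -> nnmf (fun x => Num.max (f x - g x) 0).
Proof.
move=> [mf f0] [mg g0]; split=> [|x]; last by rewrite le_max lexx orbT.
by apply: measurable_maxr => //; exact: measurable_funB.
Qed.

Lemma nnmf_cst (c : R) : 0 <= c -> nnmf (fun _ : S => c).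
Proof. by move=> c0; split=> //; exact: measurable_cst. Qed.

Lemma nnmf1 : nnmf (fun _ : S => 1 : R). Proof. exact: nnmf_cst. Qed.

Lemma nnmf_sum (I : Type) (s : seq I) (P : pred I) (h : I -> S -> R) :
  (forall i, P i -> nnmf (h i)) -> nnmf (fun x => \sum_(i <- s | P i) h i x).
Proof.
move=> nh; elim: s => [|i s IH].
  rewrite (_ : (fun x => _) = fun=> 0); first exact: nnmf_cst.
  by apply/funext => x; rewrite big_nil.
have [Pi|Pi] := boolP (P i).
  rewrite (_ : (fun x => _) = fun x => h i x + \sum_(j <- s | P j) h j x).
    by apply: nnmf_add => //; exact: nh.
  by apply/funext => x; rewrite big_cons Pi.
rewrite (_ : (fun x => _) = fun x => \sum_(j <- s | P j) h j x)//.
by apply/funext => x; rewrite big_cons (negbTE Pi).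
Qed.

Lemma nnmf_prod (I : Type) (s : seq I) (P : pred I) (h : I -> S -> R) :
  (forall i, P i -> nnmf (h i)) -> nnmf (fun x => \prod_(i <- s | P i) h i x).
Proof.
move=> nh; elim: s => [|i s IH].
  rewrite (_ : (fun x => _) = fun=> 1); first exact: nnmf_cst.
  by apply/funext => x; rewrite big_nil.
have [Pi|Pi] := boolP (P i).
  rewrite (_ : (fun x => _) = fun x => h i x * \prod_(j <- s | P j) h j x).
    by apply: nnmf_mul => //; exact: nh.
  by apply/funext => x; rewrite big_cons Pi.
rewrite (_ : (fun x => _) = fun x => \prod_(j <- s | P j) h j x)//.
by apply/funext => x; rewrite big_cons (negbTE Pi).
Qed.

Lemma nnmf_indic (A : set S) : measurable A -> nnmf (\1_A : S -> R).
Proof. by move=> mA; split=> [|x]; [exact: measurable_indic|]. Qed.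

Lemma nnmf_fine (h : S -> \bar R) : measurable_fun setT h ->
  (forall x, 0 <= h x)%E -> nnmf (fun x => fine (h x)).
Proof. by move=> mh h0; split=> [|x]; [exact: measurableT_comp|exact: fine_ge0]. Qed.

Lemma nnmf_EFin f : nnmf f -> measurable_fun setT (EFin \o f).
Proof. by move=> [mf _]; exact/measurable_EFinP. Qed.

Lemma nnmf_EFin_ge0 f x : nnmf f -> (0 <= (f x)%:E)%E.
Proof. by move=> [_ f0]; rewrite lee_fin. Qed.

Variable m : {measure set S -> \bar R}.
Local Open Scope ereal_scope.

Lemma integral_nnmfD f g : nnmf f -> nnmf g ->
  \int[m]_x (f x + g x)%:E = \int[m]_x (f x)%:E + \int[m]_x (g x)%:E.
Proof.
move=> nf ng; rewrite -ge0_integralD//.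
- by move=> x _; exact: nnmf_EFin_ge0 nf.
- exact: nnmf_EFin nf.
- by move=> x _; exact: nnmf_EFin_ge0 ng.
- exact: nnmf_EFin ng.
Qed.

Lemma integral_nnmfZ (c : R) f : (0 <= c)%R -> nnmf f ->
  \int[m]_x (c * f x)%:E = c%:E * \int[m]_x (f x)%:E.
Proof.
move=> c0 nf; rewrite -ge0_integralZl_EFin//.
- by move=> x _; exact: nnmf_EFin_ge0 nf.
- exact: nnmf_EFin nf.
Qed.

Lemma le_integral_nnmf f g : nnmf f -> nnmf g -> (forall x, f x <= g x)%R ->
  \int[m]_x (f x)%:E <= \int[m]_x (g x)%:E.
Proof.
move=> nf ng fg; apply: ge0_le_integral => //.
- by move=> x _; exact: nnmf_EFin_ge0 nf.
- exact: nnmf_EFin nf.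
- exact: nnmf_EFin ng.
- by move=> x _; rewrite lee_fin.
Qed.

Lemma ae_eq_integral_nnmf f g : nnmf f -> nnmf g ->
  {ae m, forall x, f x = g x} -> \int[m]_x (f x)%:E = \int[m]_x (g x)%:E.
Proof.
move=> nf ng fg; apply: ge0_ae_eq_integral => //.
- exact: nnmf_EFin nf.
- exact: nnmf_EFin ng.
- by move=> x _; exact: nnmf_EFin_ge0 nf.
- by move=> x _; exact: nnmf_EFin_ge0 ng.
- by apply: filterS fg => x ->.
Qed.

Lemma integral_nnmf_ge0 f : nnmf f -> 0 <= \int[m]_x (f x)%:E.
Proof. by move=> nf; apply: integral_ge0 => x _; exact: nnmf_EFin_ge0 nf. Qed.

End nonnegative_measurable.

Lemma nnmf_comp d d' (S : measurableType d) (S' : measurableType d') (R : realType)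
    (f : S' -> R) (h : S -> S') :
  nnmf f -> measurable_fun setT h -> nnmf (fun x => f (h x)).
Proof. by move=> [mf f0] mh; split=> [|x//]; exact: measurableT_comp. Qed.

(** [tr t] keeps the information of the first [t] coordinates, so the maps of
    the form [F \o tr t] are those measurable for the past at time [t], and
    [Psi t x u] resamples [x] conditionally on that past. *)
Record sampler d (S : measurableType d) (R : realType) (mu : probability S R)
    (T : nat) := Sampler {
  tr : nat -> S -> S;
  Psi : nat -> S -> R -> S;
  measurable_tr : forall t, measurable_fun setT (tr t);
  tr_tr : forall s t x, tr s (tr t x) = tr (minn s t) x;
  tr_full : forall x, tr T x = x;
  tr0 : forall x y, tr 0 x = tr 0 y;
  measurable_Psi : forall t, measurable_fun setT
    ((fun zu => Psi t zu.1 zu.2) : S * measurableTypeR R -> S);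
  tr_Psi : forall t z u, tr t (Psi t z u) = tr t z;
  Psi_tr : forall t z u, Psi t (tr t z) u = Psi t z u;
  Psi_law : forall t (B : set S), measurable B ->
    (mu \x unif)%E [set zu | B (Psi t zu.1 zu.2)] = mu B }.

Section sampling_operator.
Context d (S : measurableType d) (R : realType) (mu : probability S R) (T : nat).
Variable sam : sampler mu T.
Local Notation tr := (tr sam).
Local Notation Psi := (Psi sam).
Local Open Scope ereal_scope.

Definition adapted (V : Type) (t : nat) (F : S -> V) : Prop :=
  forall x, F (tr t x) = F x.

Lemma adaptedW V s t (F : S -> V) : (s <= t)%N -> adapted s F -> adapted t F.
Proof.
by move=> st aF x; rewrite -aF tr_tr (minn_idPl st) aF.
Qed.

Lemma adapted_full V (F : S -> V) : adapted T F.
Proof. by move=> x; rewrite tr_full. Qed.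

(** Conditional expectation given the past at time [t], with a value at every
    point: the average over the resampled future. *)
Definition cexp (t : nat) (G : S -> \bar R) (x : S) : \bar R :=
  \int[unif]_u G (Psi t x u).

Section cexp_facts.
Variables (t : nat) (G : S -> \bar R).
Hypotheses (mG : measurable_fun setT G) (G0 : forall x, 0 <= G x).

Lemma cexp_ge0 x : 0 <= cexp t G x.
Proof. exact: integral_ge0. Qed.

Lemma measurable_comp_Psi : measurable_fun setT
  ((fun zu => G (Psi t zu.1 zu.2)) : S * measurableTypeR R -> \bar R).
Proof. exact: (measurableT_comp mG (measurable_Psi sam t)). Qed.

Lemma measurable_Psi2 x :
  measurable_fun setT (fun u : measurableTypeR R => G (Psi t x u)).
Proof. exact: (measurableT_comp measurable_comp_Psi (pair1_measurable x)). Qed.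

Lemma measurable_cexp : measurable_fun setT (cexp t G).
Proof.
exact: (measurable_fun_fubini_tonelli_F (m2 := unif) _ measurable_comp_Psi).
Qed.

Lemma adapted_cexp : adapted t (cexp t G).
Proof. by move=> x; apply: eq_integral => u _; rewrite Psi_tr. Qed.

Lemma cexp_pull (F : S -> \bar R) : adapted t F -> (forall x, 0 <= F x) ->
  forall x, cexp t (fun y => F y * G y) x = F x * cexp t G x.
Proof.
move=> aF F0 x; rewrite /cexp -ge0_integralZl//; last exact: measurable_Psi2.
by apply: eq_integral => u _; rewrite -(aF (Psi t x u)) tr_Psi aF.
Qed.

Lemma integral_cexp : \int[mu]_x cexp t G x = \int[mu]_x G x.
Proof.
transitivity (\int[mu \x unif]_zu G (Psi t zu.1 zu.2)).
  apply/esym/(fubini_tonelli1 (m1 := mu) (m2 := unif)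
    ((fun zu => G (Psi t zu.1 zu.2)) : S * measurableTypeR R -> \bar R)) => //.
  exact: measurable_comp_Psi.
pose m' := image_measure (mu \x unif) (measurable_Psi sam t).
transitivity (\int[m']_x G x).
  by rewrite ge0_integral_pushforward// ?preimage_setT//; exact: measurable_Psi.
by apply: eq_measure_integral => A mA _; exact: Psi_law.
Qed.

End cexp_facts.

(** The tower property, after pulling out the known factor [F]. *)
Lemma integral_cexp_pull t (F G : S -> \bar R) :
  measurable_fun setT F -> (forall x, 0 <= F x) -> adapted t F ->
  measurable_fun setT G -> (forall x, 0 <= G x) ->
  \int[mu]_x (F x * cexp t G x) = \int[mu]_x (F x * G x).
Proof.
move=> mF F0 aF mG G0.
rewrite -(@integral_cexp t (fun x => F x * G x)).
- by apply: eq_integral => x _; rewrite cexp_pull.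
- exact: emeasurable_funM.
- by move=> x; exact: mule_ge0.
Qed.

Section cexp_nnmf.
Variables (t : nat) (g : S -> R).
Hypothesis ng : nnmf g.

Let mg : measurable_fun setT (EFin \o g). Proof. exact: nnmf_EFin. Qed.
Let g0 x : 0 <= (EFin \o g) x. Proof. exact: nnmf_EFin_ge0. Qed.

Lemma measurable_cexp_nnmf : measurable_fun setT (cexp t (EFin \o g)).
Proof. exact: measurable_cexp. Qed.

Lemma cexp_nnmf_ge0 x : 0 <= cexp t (EFin \o g) x.
Proof. exact: cexp_ge0. Qed.

Lemma nnmf_cexp : nnmf (fun x => fine (cexp t (EFin \o g) x)).
Proof. exact: nnmf_fine measurable_cexp_nnmf cexp_nnmf_ge0. Qed.

Lemma integral_cexp_nnmf : \int[mu]_x cexp t (EFin \o g) x = \int[mu]_x (g x)%:E.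
Proof. exact: integral_cexp. Qed.

Lemma cexp_pull_nnmf f x : nnmf f -> adapted t f ->
  cexp t (EFin \o (fun y => f y * g y)%R) x = (f x)%:E * cexp t (EFin \o g) x.
Proof.
move=> nf af; apply: (cexp_pull mg g0 (F := EFin \o f)) => y; first by rewrite /= af.
exact: nnmf_EFin_ge0 nf.
Qed.

Lemma integral_cexp_pull_nnmf f : nnmf f -> adapted t f ->
  \int[mu]_x ((f x)%:E * cexp t (EFin \o g) x) = \int[mu]_x (f x * g x)%:E.
Proof.
move=> nf af; apply: (integral_cexp_pull (F := EFin \o f)) => //.
- exact: nnmf_EFin nf.
- by move=> x; exact: nnmf_EFin_ge0 nf.
- by move=> x; rewrite /= af.
Qed.

End cexp_nnmf.

Lemma le_cexp t (G H : S -> \bar R) :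
  measurable_fun setT G -> (forall x, 0 <= G x) ->
  measurable_fun setT H -> (forall x, G x <= H x) ->
  forall x, cexp t G x <= cexp t H x.
Proof.
move=> mG G0 mH GH x; apply: ge0_le_integral => //.
- exact: measurable_Psi2.
- exact: measurable_Psi2.
Qed.

(** Two variables known at time [t] agree almost surely once they have the same
    integral against every test variable known at time [t]: any event can be
    replaced by its conditional probability. *)
Lemma adapted_ae_eq t (f g : S -> R) : nnmf f -> nnmf g ->
  adapted t f -> adapted t g -> \int[mu]_x (f x)%:E < +oo ->
  (forall G, nnmf G -> (forall x, G x <= 1)%R -> adapted t G ->
    \int[mu]_x (G x * f x)%:E = \int[mu]_x (G x * g x)%:E) ->
  {ae mu, forall x, f x = g x}.
Proof.
move=> nf ng af ag ffin fg.
have c1 (A : set S) x : measurable A -> cexp t (EFin \o (\1_A : S -> R)) x <= 1.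
  move=> mA; have nA := nnmf_indic R mA.
  rewrite (_ : 1 = cexp t (cst 1) x); last first.
    by rewrite /cexp integral_one// -[RHS]/(unif setT) (probability_setT unif).
  apply: le_cexp => [|y| |y]; [exact: nnmf_EFin nA|exact: nnmf_EFin_ge0 nA|by []|].
  by rewrite lee_fin indicE; case: (_ \in _).
have cfin (A : set S) x : measurable A ->
    cexp t (EFin \o (\1_A : S -> R)) x \is a fin_num.
  move=> mA; rewrite ge0_fin_numE; last exact: (cexp_nnmf_ge0 t (nnmf_indic R mA) x).
  exact: le_lt_trans (c1 A x mA) (ltry _).
have test (h : S -> R) A : nnmf h -> adapted t h -> measurable A ->
    \int[mu]_(x in A) (h x)%:E =
    \int[mu]_x (fine (cexp t (EFin \o \1_A) x) * h x)%:E.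
  move=> nh ah mA.
  transitivity (\int[mu]_x ((h x)%:E * cexp t (EFin \o \1_A) x)).
    rewrite (integral_cexp_pull_nnmf (nnmf_indic R mA) nh ah).
    rewrite integral_mkcond; apply: eq_integral => x _.
    by rewrite epatch_indic.
  by apply: eq_integral => x _; rewrite EFinM fineK ?cfin// muleC.
have eqA A : measurable A -> \int[mu]_(x in A) (f x)%:E = \int[mu]_(x in A) (g x)%:E.
  move=> mA; rewrite (test f A nf af mA) (test g A ng ag mA).
  apply: fg; [exact: nnmf_cexp (nnmf_indic R mA)| |by move=> x; rewrite adapted_cexp].
  by move=> x; rewrite -lee_fin fineK ?cfin//; exact: c1.
have [mf f0] := nf; have [mg g0] := ng.
have fleg : {ae mu, forall x, (f x <= g x)%R}.
  apply: ae_le_of_integral => //; last by move=> A mA; rewrite eqA.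
  by rewrite -eqA.
have glef : {ae mu, forall x, (g x <= f x)%R}.
  by apply: ae_le_of_integral => // A mA; rewrite eqA.
by apply: filterS2 fleg glef => x h1 h2; apply/eqP; rewrite eq_le h1 h2.
Qed.

End sampling_operator.

(** * Density processes and the bicausal splitting formula *)

Section density_processes.
Context d (S : measurableType d) (R : realType) (mu : probability S R) (T : nat).
Variable sam : sampler mu T.
Local Notation adapted := (adapted sam).
Local Notation cexp := (cexp sam).
Local Open Scope ereal_scope.

(** [f t] is the density, with respect to [mu], of the law of the first [t]
    coordinates under the probability of density [f T]. *)
Record density_process (f : nat -> S -> R) : Prop := DensityProcess {
  dp_nnmf : forall t, nnmf (f t);
  dp_adapted : forall t, (t <= T)%N -> adapted t (f t);
  dp_mart : forall t G, (t <= T)%N -> nnmf G -> adapted t G ->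
    \int[mu]_x (G x * f T x)%:E = \int[mu]_x (G x * f t x)%:E;
  dp_one : forall x, f 0%N x = 1%R }.

Lemma density_process_one : density_process (fun _ _ => 1%R).
Proof. by split => // t; exact: nnmf_cst. Qed.

Lemma ae_cexp_fin t (G : S -> R) : nnmf G -> \int[mu]_x (G x)%:E < +oo ->
  {ae mu, forall x, cexp t (EFin \o G) x \is a fin_num}.
Proof.
move=> nG Gfin.
have iK : mu.-integrable setT (cexp t (EFin \o G)).
  apply/integrableP; split; first exact: measurable_cexp_nnmf.
  under eq_integral => x _ do rewrite (gee0_abs (cexp_nnmf_ge0 sam t nG x)).
  by rewrite integral_cexp_nnmf.
by have := integrable_ae measurableT iK; apply: filterS => x /(_ I).
Qed.

Lemma integral_fine_cexp t f (G : S -> R) : nnmf G -> nnmf f -> adapted t f ->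
  \int[mu]_x (G x)%:E < +oo ->
  \int[mu]_x (f x * fine (cexp t (EFin \o G) x))%:E = \int[mu]_x (f x * G x)%:E.
Proof.
move=> nG nf af Gfin; rewrite -(integral_cexp_pull_nnmf nG nf af).
apply: ge0_ae_eq_integral => //.
- exact: nnmf_EFin (nnmf_mul nf (nnmf_cexp sam t nG)).
- by apply: emeasurable_funM; [exact: nnmf_EFin|exact: measurable_cexp_nnmf].
- by move=> x _; exact: nnmf_EFin_ge0 (nnmf_mul nf (nnmf_cexp sam t nG)).
- by move=> x _; apply: mule_ge0; [exact: nnmf_EFin_ge0|exact: cexp_nnmf_ge0].
- by apply: filterS (ae_cexp_fin t nG Gfin) => x h _; rewrite EFinM fineK.
Qed.

Section from_density.
Variable r : S -> R.
Hypotheses (nr : nnmf r) (r1 : \int[mu]_x (r x)%:E = 1).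

Let back := fix back (k : nat) : S -> R := if k is j.+1 then
  (fun x => fine (cexp (T - j.+1)%N (EFin \o back j) x)) else r.

(** Backward induction from the terminal density, using the versions of the
    conditional expectations given by [cexp]. *)
Definition density_martingale (t : nat) : S -> R := back (T - t)%N.
Local Notation g := density_martingale.

Lemma density_martingale_full : g T = r.
Proof. by rewrite /g subnn. Qed.

Lemma nnmf_density_martingale t : nnmf (g t).
Proof.
rewrite /g; elim: (T - t)%N => [//|k IH] /=; exact: nnmf_cexp.
Qed.

Lemma density_martingaleS t : (t < T)%N ->
  g t = fun x => fine (cexp t (EFin \o g t.+1) x).
Proof.
move=> tT; rewrite /g; have -> : (T - t = (T - t.+1).+1)%N by lia.
by rewrite /=; have -> : (T - (T - t.+1).+1 = t)%N by lia.
Qed.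

Lemma adapted_density_martingale t : (t <= T)%N -> adapted t (g t).
Proof.
rewrite leq_eqVlt => /orP[/eqP ->|tT]; first exact: adapted_full.
by rewrite density_martingaleS// => x; rewrite adapted_cexp.
Qed.

Let step t : (t < T)%N -> \int[mu]_x (g t.+1 x)%:E < +oo -> forall G,
  nnmf G -> adapted t G ->
  \int[mu]_x (G x * g t.+1 x)%:E = \int[mu]_x (G x * g t x)%:E.
Proof.
move=> tT fin G nG aG.
have ng := nnmf_density_martingale t.+1.
by rewrite (density_martingaleS tT) (integral_fine_cexp ng nG aG fin).
Qed.

Let total k : (k <= T)%N -> \int[mu]_x (g (T - k)%N x)%:E = 1.
Proof.
elim: k => [|k IH] kT; first by rewrite subn0 density_martingale_full.
have e : (T - k = (T - k.+1).+1)%N by lia.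
rewrite e in IH; have {}IH := IH (ltnW kT).
rewrite -[RHS]IH; have := @step (T - k.+1)%N.
have h1 : (T - k.+1 < T)%N by lia.
move=> /(_ h1); rewrite IH => /(_ (ltry _) (fun=> 1%R)).
have n1 := nnmf1 S R.
move=> /(_ n1 (fun=> erefl)) => h.
by under eq_integral do rewrite -[g _ _]mul1r; rewrite -h; under eq_integral do rewrite mul1r.
Qed.

Lemma integral_density_martingale t : (t <= T)%N -> \int[mu]_x (g t x)%:E = 1.
Proof. by move=> tT; have := total (leq_subr t T); rewrite subKn. Qed.

Lemma density_process_martingale : density_process g.
Proof.
split; [exact: nnmf_density_martingale|exact: adapted_density_martingale| |].
- move=> t G tT nG; rewrite -(subKn tT).
  elim: (T - t)%N (leq_subr t T) => [|k IH] kT aG; first by rewrite subn0.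
  have e : (T - k = (T - k.+1).+1)%N by lia.
  rewrite IH ?(ltnW kT)//; last by apply: adaptedW aG; rewrite e.
  rewrite e; apply: step => //; first by lia.
  by rewrite integral_density_martingale ?ltry//; lia.
- move=> x.
  have cst y : g 0%N y = g 0%N x.
    by rewrite -(adapted_density_martingale (leq0n T)) (tr0 sam y x)
      (adapted_density_martingale (leq0n T)).
  have : (g 0%N x)%:E * mu setT = 1.
    rewrite -[RHS](integral_density_martingale (leq0n T)).
    rewrite -(integral_cst mu measurableT).
    by apply: eq_integral => y _; rewrite cst.
  by rewrite probability_setT mule1 => -[].
Qed.

Lemma ae_cexp_density_martingale t : (t < T)%N ->
  {ae mu, forall x, cexp t (EFin \o g t.+1) x = (g t x)%:E}.
Proof.
move=> tT.
have fin : \int[mu]_x (g t.+1 x)%:E < +oo by rewrite integral_density_martingale ?ltry.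
apply: filterS (ae_cexp_fin t (nnmf_density_martingale _) fin) => x h.
by rewrite (density_martingaleS tT) fineK.
Qed.

End from_density.

End density_processes.

Lemma ae_eq0_of_integral d (S : measurableType d) (R : realType)
    (m : {measure set S -> \bar R}) (h : S -> R) :
  nnmf h -> (\int[m]_x (h x)%:E = 0)%E -> {ae m, forall x, h x = 0}.
Proof.
move=> nh h0; have mh := nnmf_EFin nh.
have : (\int[m]_x `|(h x)%:E| = 0)%E.
  by rewrite -h0; apply: eq_integral => x _; rewrite gee0_abs//; exact: nnmf_EFin_ge0.
move/(ae_eq_integral_abs m measurableT mh); apply: filterS => x /(_ I).
by case.
Qed.

Section splitting.
Context d (S : measurableType d) (R : realType) (mu : probability S R) (T : nat).
Variable sam : sampler mu T.
Local Notation adapted := (adapted sam).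
Local Notation cexp := (cexp sam).
Local Notation density_process := (density_process sam).
Local Open Scope ereal_scope.

Implicit Types f g : nat -> S -> R.

(** Conditional density of the step from [s] to [s.+1]. Division by 0 gives 0,
    so the ratio vanishes where the past has density 0. *)
Definition ratio f s x : R := f s.+1 x / f s x.

(** Density, with respect to [mu], of the common path on the event that the two
    paths still agree after [s] steps, when each step is coupled so as to agree
    as often as possible. *)
Definition agree f g s x : R :=
  (\prod_(i < s) Num.min (ratio f i x) (ratio g i x))%R.

(** Density of a path that follows [f] and leaves the common path at step [s],
    relative to the first [s] coordinates. *)
Definition excess f g s x : R :=
  (Num.max (ratio f s x - ratio g s x) 0 * (f T x / f s.+1 x))%R.

(** Conditional mass of the excess at step [s], by which it has to be
    normalised. *)
Definition gap f g s x : R := fine (cexp s (EFin \o excess f g s) x).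

Lemma agreeC f g s x : agree f g s x = agree g f s x.
Proof. by apply: eq_bigr => i _; rewrite minC. Qed.

Lemma agreeS f g s x : agree f g s.+1 x =
  (agree f g s x * Num.min (ratio f s x) (ratio g s x))%R.
Proof. by rewrite /agree big_ord_recr. Qed.

Section two_processes.
Variables f g : nat -> S -> R.
Hypotheses (df : density_process f) (dg : density_process g).

Lemma nnmf_ratio f' s : density_process f' -> nnmf (ratio f' s).
Proof. by move=> df'; apply: nnmf_div; exact: (dp_nnmf df'). Qed.

Lemma nnmf_agree s : nnmf (agree f g s).
Proof. by apply: nnmf_prod => i _; apply: nnmf_min; exact: nnmf_ratio. Qed.

Lemma nnmf_excess s : nnmf (excess f g s).
Proof.
apply: nnmf_mul; first by apply: nnmf_posB; exact: nnmf_ratio.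
by apply: nnmf_div; exact: (dp_nnmf df).
Qed.

Lemma adapted_ratio f' s : density_process f' -> (s < T)%N -> adapted s.+1 (ratio f' s).
Proof.
move=> df' sT x; rewrite /ratio (dp_adapted df' sT).
by rewrite (adaptedW (leqnSn s) (dp_adapted df' (ltnW sT))).
Qed.

Lemma adapted_agree s : (s <= T)%N -> adapted s (agree f g s).
Proof.
move=> sT x; apply: eq_bigr => i _.
have iT : (i < T)%N := leq_trans (ltn_ord i) sT.
by rewrite !(adaptedW (ltn_ord i) (adapted_ratio _ iT)).
Qed.

Lemma agree_neq0 s x : agree f g s x != 0%R -> f s x != 0%R.
Proof.
case: s => [_|s]; first by rewrite (dp_one df) oner_neq0.
rewrite agreeS mulf_eq0 negb_or => /andP[_]; apply: contraNN => /eqP fs.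
rewrite /ratio fs mul0r min_l//.
by have [_] := nnmf_ratio s dg; apply.
Qed.

Lemma agree_le s x : (agree f g s x <= f s x)%R.
Proof.
elim: s => [|s IH]; first by rewrite /agree big_ord0 (dp_one df).
have [_ u0] := nnmf_ratio s df; have [_ v0] := nnmf_ratio s dg.
have [_ m0] := nnmf_agree s; have [_ f0] := dp_nnmf df s.
have [_ f1] := dp_nnmf df s.+1.
rewrite agreeS; apply: (@le_trans _ _ (f s x * ratio f s x)%R).
  by apply: ler_pM => //; rewrite ?ge_min ?lexx// le_min u0 v0.
rewrite /ratio; have [->|fs] := eqVneq (f s x) 0%R; first by rewrite mul0r.
by rewrite mulrC divfK.
Qed.

Lemma dp_finite t : (t <= T)%N -> \int[mu]_x (f t x)%:E = 1.
Proof.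
move=> tT.
have n1 := nnmf1 S R.
have h s : (s <= T)%N -> \int[mu]_x (f s x)%:E = \int[mu]_x (f T x)%:E.
  move=> sT; have := dp_mart df sT n1 (fun=> erefl).
  by under eq_integral do rewrite mul1r; under [in RHS]eq_integral do rewrite mul1r.
rewrite h// -(h 0%N)//; under eq_integral do rewrite (dp_one df).
by rewrite integral_one//; exact: probability_setT.
Qed.

(** The terminal density vanishes wherever an earlier one does. *)
Lemma ae_dp_absorb s : (s <= T)%N ->
  {ae mu, forall x, f s x = 0%R -> f T x = 0%R}.
Proof.
move=> sT; have nZ : nnmf (fun x => \1_[set 0%R] (f s x) : R).
  by apply: nnmf_comp; [exact: nnmf_indic|case: (dp_nnmf df s)].
have aZ : adapted s (fun x => \1_[set 0%R] (f s x) : R).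
  by move=> x; rewrite (dp_adapted df sT).
have : \int[mu]_x (\1_[set 0%R] (f s x) * f T x)%:E = 0.
  rewrite (dp_mart df sT nZ aZ); apply: integral0_eq => x _.
  rewrite indicE; have [fsx|fsx] := boolP (f s x \in [set 0%R]).
    by rewrite (set_mem fsx) mulr0.
  by rewrite mul0r.
move=> /(ae_eq0_of_integral (nnmf_mul nZ (dp_nnmf df T))).
by apply: filterS => x /= + fsx; rewrite indicE fsx mem_set// mul1r.
Qed.

(** The factor [f T x / f s.+1 x] has conditional expectation 1 given the first
    [s.+1] coordinates, where its denominator does not vanish. *)
Lemma integral_agree_excess s (G : S -> R) : (s < T)%N -> nnmf G -> adapted s G ->
  \int[mu]_x (G x * (agree f g s x * excess f g s x))%:E =
  \int[mu]_x (G x * (agree f g s x * Num.max (ratio f s x - ratio g s x) 0))%:E.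
Proof.
move=> sT nG aG.
pose H x := (G x * (agree f g s x * Num.max (ratio f s x - ratio g s x) 0) / f s.+1 x)%R.
have nM := nnmf_agree s; have nu := nnmf_ratio s df; have nv := nnmf_ratio s dg.
have nH : nnmf H.
  apply: nnmf_div; last exact: (dp_nnmf df).
  by apply: nnmf_mul => //; apply: nnmf_mul => //; exact: nnmf_posB.
have aH : adapted s.+1 H.
  move=> x; rewrite /H (dp_adapted df sT) !(adapted_ratio _ sT)//.
  by rewrite (adaptedW (leqnSn s) aG) (adaptedW (leqnSn s) (adapted_agree (ltnW sT))).
transitivity (\int[mu]_x (H x * f T x)%:E).
  by apply: eq_integral => x _; congr EFin; rewrite /H /excess; ring.
rewrite (dp_mart df sT nH aH); apply: eq_integral => x _; congr EFin.
have [fs|fs] := eqVneq (f s.+1 x) 0%R; last by rewrite /H divfK.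
have [_ /(_ x) v0] := nv.
by rewrite fs mulr0 /ratio fs mul0r add0r max_r ?mulr0// oppr_le0.
Qed.

Lemma integral_agree_ratio s (G : S -> R) : (s < T)%N -> nnmf G -> adapted s G ->
  \int[mu]_x (G x * (agree f g s x * ratio f s x))%:E =
  \int[mu]_x (G x * agree f g s x)%:E.
Proof.
move=> sT nG aG; have nM := nnmf_agree s.
pose H x := (G x * agree f g s x / f s x)%R.
have nH : nnmf H by apply: nnmf_div; [exact: nnmf_mul|exact: (dp_nnmf df)].
have aH : adapted s H.
  by move=> x; rewrite /H (dp_adapted df (ltnW sT)) aG (adapted_agree (ltnW sT)).
transitivity (\int[mu]_x (H x * f s.+1 x)%:E).
  by apply: eq_integral => x _; congr EFin; rewrite /H /ratio; ring.
rewrite -(dp_mart df sT nH (adaptedW (leqnSn s) aH)) (dp_mart df (ltnW sT) nH aH).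
apply: eq_integral => x _; congr EFin; rewrite /H.
have [M0|/agree_neq0 fs] := eqVneq (agree f g s x) 0%R; last by rewrite divfK.
by rewrite M0 mulr0 !mul0r.
Qed.

Lemma agree_finite s (G : S -> R) : (s <= T)%N -> nnmf G -> (forall x, G x <= 1)%R ->
  \int[mu]_x (G x * agree f g s x)%:E < +oo.
Proof.
move=> sT nG G1; apply: (@le_lt_trans _ _ 1); last exact: ltry.
rewrite -(dp_finite sT); apply: le_integral_nnmf.
- exact: nnmf_mul nG (nnmf_agree s).
- exact: (dp_nnmf df).
- move=> x; apply: le_trans (agree_le s x).
  by have [_ M0] := nnmf_agree s; rewrite ler_piMl.
Qed.

End two_processes.

Lemma fine_mul_EFin (c : R) (y : \bar R) : (0 <= c)%R ->
  fine (c%:E * y) = (c * fine y)%R.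
Proof.
rewrite le_eqVlt => /orP[/eqP <-|c0]; first by rewrite mul0e mul0r.
case: y => [y//||]; first by rewrite gt0_muley ?lte_fin//= mulr0.
by rewrite gt0_muleNy ?lte_fin//= mulr0.
Qed.

Lemma agree_gapE f g s f' g' : density_process f -> density_process g ->
  density_process f' -> density_process g' -> (s <= T)%N -> forall x,
  (agree f g s x * gap f' g' s x)%R =
  fine (cexp s (EFin \o (fun y => agree f g s y * excess f' g' s y)%R) x).
Proof.
move=> df dg df' dg' sT x; rewrite /gap.
have [_ M0] := nnmf_agree df dg s.
rewrite -fine_mul_EFin//; congr fine; apply/esym.
by apply: cexp_pull_nnmf; [exact: nnmf_excess|exact: nnmf_agree|exact: adapted_agree].
Qed.

Lemma agree_excess_finite f g s : density_process f -> density_process g ->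
  (s < T)%N -> \int[mu]_x (agree f g s x * excess f g s x)%:E < +oo.
Proof.
move=> df dg sT; have n1 := nnmf1 S R.
have nM := nnmf_agree df dg s; have nu := nnmf_ratio s df; have nv := nnmf_ratio s dg.
have := integral_agree_excess df dg sT n1 (fun=> erefl).
under eq_integral do rewrite mul1r; move=> ->.
apply: le_lt_trans (agree_finite df dg (ltnW sT) n1 (fun=> lexx _)).
rewrite -(integral_agree_ratio df dg sT n1 (fun=> erefl)).
apply: le_integral_nnmf.
- exact: nnmf_mul n1 (nnmf_mul nM (nnmf_posB nu nv)).
- exact: nnmf_mul n1 (nnmf_mul nM nu).
- move=> x; rewrite !mul1r; have [_ M0] := nM; apply: ler_wpM2l => //.
  have [_ u0] := nu; have [_ v0] := nv.
  by rewrite ge_max u0 andbT lerBlDr lerDl.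
Qed.

Lemma integral_agree_gap f g s (G : S -> R) : density_process f ->
  density_process g -> (s < T)%N -> nnmf G -> adapted s G ->
  \int[mu]_x (G x * (agree f g s x * gap f g s x))%:E =
  \int[mu]_x (G x * (agree f g s x * excess f g s x))%:E.
Proof.
move=> df dg sT nG aG.
pose E y := (agree f g s y * excess f g s y)%R.
have nE : nnmf E by apply: nnmf_mul; [exact: nnmf_agree|exact: nnmf_excess].
transitivity (\int[mu]_x (G x * fine (cexp s (EFin \o E) x))%:E).
  by apply: eq_integral => x _; rewrite agree_gapE ?(ltnW sT).
exact: integral_fine_cexp nE nG aG (agree_excess_finite df dg sT).
Qed.

(** Where the paths may still agree, both conditional masses are 1 minus the
    conditional mass on which the step agrees. *)
Lemma ae_gapC f g s : density_process f -> density_process g -> (s < T)%N ->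
  {ae mu, forall x, agree f g s x * gap f g s x = agree f g s x * gap g f s x}%R.
Proof.
move=> df dg sT.
have n1 := nnmf1 S R.
have aM := adapted_agree df dg (ltnW sT).
have nM := nnmf_agree df dg s.
have nu := nnmf_ratio s df; have nv := nnmf_ratio s dg.
have nA f' g' : density_process f' -> density_process g' ->
    nnmf (fun x => agree f g s x * gap f' g' s x)%R.
  move=> df' dg'; apply: nnmf_mul => //; apply: nnmf_cexp; exact: nnmf_excess.
have aA f' g' : adapted s (fun x => agree f g s x * gap f' g' s x)%R.
  by move=> x; rewrite aM /gap adapted_cexp.
apply: (@adapted_ae_eq _ _ _ _ _ sam s); [exact: nA|exact: nA|exact: aA|exact: aA| |].
  have := integral_agree_gap df dg sT n1 (fun=> erefl).
  under eq_integral do rewrite mul1r; move=> ->.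
  under eq_integral do rewrite mul1r; exact: (agree_excess_finite df dg sT).
move=> G nG G1 aG; rewrite integral_agree_gap//.
have -> : \int[mu]_x (G x * (agree f g s x * gap g f s x))%:E =
    \int[mu]_x (G x * (agree g f s x * gap g f s x))%:E.
  by apply: eq_integral => x _; rewrite agreeC.
rewrite integral_agree_gap// !integral_agree_excess//.
have Gu : \int[mu]_x (G x * (agree f g s x * ratio f s x))%:E =
    \int[mu]_x (G x * (agree f g s x * ratio g s x))%:E.
  rewrite integral_agree_ratio//; under [RHS]eq_integral do rewrite agreeC.
  by rewrite integral_agree_ratio//; apply: eq_integral => x _; rewrite agreeC.
have Gfin : \int[mu]_x (G x * (agree f g s x * ratio f s x))%:E \is a fin_num.
  rewrite integral_agree_ratio// ge0_fin_numE; first exact: (agree_finite df dg (ltnW sT) nG G1).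
  by apply: integral_ge0 => x _; exact: nnmf_EFin_ge0 (nnmf_mul nG nM).
have nP f' g' : density_process f' -> density_process g' ->
    nnmf (fun x => G x * (agree f g s x * Num.max (ratio f' s x - ratio g' s x) 0))%R.
  move=> df' dg'; apply: nnmf_mul => //; apply: nnmf_mul => //.
  by apply: nnmf_posB; exact: nnmf_ratio.
have nr f' : density_process f' -> nnmf (fun x => G x * (agree f g s x * ratio f' s x))%R.
  by move=> df'; apply: nnmf_mul => //; apply: nnmf_mul => //; exact: nnmf_ratio.
rewrite -[LHS](addeK _ Gfin) -[RHS](addeK _ Gfin); congr (_ - _).
rewrite [in LHS]Gu -(integral_nnmfD mu (nP _ _ df dg) (nr _ dg)).
have nP' : nnmf (fun x => G x * (agree g f s x * Num.max (ratio g s x - ratio f s x) 0))%R.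
  by under eq_fun do rewrite agreeC; exact: nP dg df.
rewrite -(integral_nnmfD mu nP' (nr _ df)).
apply: eq_integral => x _; congr EFin.
rewrite (agreeC g f) -!mulrDr; congr (_ * (_ * _))%R.
by rewrite /Num.max; do 2 case: ifPn => //; rewrite -?leNgt; lra.
Qed.

End splitting.

Section splitting_formula.
Context d (S : measurableType d) (R : realType) (mu : probability S R) (T : nat).
Variable sam : sampler mu T.
Local Notation adapted := (adapted sam).
Local Notation cexp := (cexp sam).
Local Notation density_process := (density_process sam).
Local Notation excess := (excess T).
Local Notation gap := (gap sam).
Local Open Scope ereal_scope.

Implicit Types f g : nat -> S -> R.
Implicit Types F G : S -> R.

(** [tau s] is the common conditional mass of the two remainders at step [s],
    up to null sets and where the paths may still agree. Fixing one version of
    it for both orders of the pair makes the construction below symmetric. *)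
Definition common_gap f g (tau : nat -> S -> R) : Prop := forall s, (s < T)%N ->
  [/\ nnmf (tau s), adapted s (tau s),
      {ae mu, forall x, agree f g s x * gap f g s x = agree f g s x * tau s x}%R &
      {ae mu, forall x, agree f g s x * gap g f s x = agree f g s x * tau s x}%R].

Lemma common_gapC f g tau : common_gap f g tau -> common_gap g f tau.
Proof.
move=> h s sT; have [? ? h1 h2] := h s sT; split => //.
- by apply: filterS h2 => x; rewrite agreeC.
- by apply: filterS h1 => x; rewrite agreeC.
Qed.

Lemma common_gap_gap f g : density_process f -> density_process g ->
  common_gap f g (gap f g).
Proof.
move=> df dg s sT; split.
- exact: (nnmf_cexp sam s (nnmf_excess df dg s)).
- by move=> x; rewrite /gap adapted_cexp.
- by apply: aeW.
- by apply: filterS (ae_gapC df dg sT) => x ->.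
Qed.

(** Density of the first path on the event of separation at step [s], divided by
    the mass of the remainder of the second path. *)
Definition leave f g (tau : nat -> S -> R) s x : R :=
  (agree f g s x * excess f g s x / tau s x)%R.

(** Integral of [F x * G y] over the pairs that separate at step [s]: given the
    common past, the two remainders are independent. *)
Definition split_integral f g tau s F G : \bar R :=
  \int[mu]_x ((F x * leave f g tau s x)%:E *
              cexp s (fun y => (G y * excess g f s y)%:E) x).

(** Density of a path that follows [f], on the event that the paths agree for
    [s] steps at least. *)
Definition stay f g s x : R := (agree f g s x * (f T x / f s x))%R.

Section formula.
Variables (f g : nat -> S -> R) (tau : nat -> S -> R).
Hypotheses (df : density_process f) (dg : density_process g).
Hypothesis ctau : common_gap f g tau.

Let nM s : nnmf (agree f g s). Proof. exact: (nnmf_agree df dg). Qed.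
Let na s : nnmf (excess f g s). Proof. exact: (nnmf_excess df dg). Qed.
Let nb s : nnmf (excess g f s). Proof. exact: (nnmf_excess dg df). Qed.
Let ngap s : nnmf (gap f g s). Proof. exact: (nnmf_cexp sam s (na s)). Qed.
Let ntau s : (s < T)%N -> nnmf (tau s). Proof. by move/ctau => []. Qed.
Let nleave s : (s < T)%N -> nnmf (leave f g tau s).
Proof. by move=> sT; apply: nnmf_div; [exact: nnmf_mul|exact: ntau]. Qed.
Let nstay s : nnmf (stay f g s).
Proof. by apply: nnmf_mul => //; apply: nnmf_div; exact: dp_nnmf df _. Qed.

(** Both sides integrate, over the common past, the product of the conditional
    expectations of the two remainders. *)
Lemma split_integralC s F G : (s < T)%N -> nnmf F -> nnmf G ->
  split_integral f g tau s F G = split_integral g f tau s G F.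
Proof.
move=> sT nF nG; have [_ atau _ _] := ctau sT.
have aM := adapted_agree df dg (ltnW sT).
have nFa : nnmf (fun y => F y * excess f g s y)%R by exact: nnmf_mul.
have nGb : nnmf (fun y => G y * excess g f s y)%R by exact: nnmf_mul.
have nMt : nnmf (fun x => agree f g s x / tau s x)%R by apply: nnmf_div => //; exact: ntau.
pose N f' g' F' G' := \int[mu]_x ((agree f' g' s x / tau s x)%:E *
  (cexp s (fun y => (G' y * excess g' f' s y)%:E) x *
   cexp s (fun y => (F' y * excess f' g' s y)%:E) x)).
have core f' g' F' G' : nnmf (fun x => agree f' g' s x / tau s x)%R ->
    adapted s (agree f' g' s) ->
    nnmf (fun y => F' y * excess f' g' s y)%R ->
    nnmf (fun y => G' y * excess g' f' s y)%R ->
    split_integral f' g' tau s F' G' = N f' g' F' G'.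
  move=> nMt' aM' nFa' nGb'.
  pose H x := (agree f' g' s x / tau s x)%:E *
    cexp s (fun y => (G' y * excess g' f' s y)%:E) x.
  transitivity (\int[mu]_x (H x * (F' x * excess f' g' s x)%:E)).
    apply: eq_integral => x _; rewrite /H muleAC -EFinM; congr (_ %:E * _).
    by rewrite /leave; ring.
  rewrite -(@integral_cexp_pull _ _ _ _ _ sam s H (fun x => (F' x * excess f' g' s x)%:E)).
  - by apply: eq_integral => x _; rewrite /H muleA.
  - by apply: emeasurable_funM; [exact: nnmf_EFin nMt'|exact: (measurable_cexp_nnmf sam s nGb')].
  - move=> x; apply: mule_ge0; [exact: nnmf_EFin_ge0 nMt'|exact: (cexp_nnmf_ge0 sam s nGb' x)].
  - by move=> x; rewrite /H aM' atau adapted_cexp.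
  - exact: nnmf_EFin nFa'.
  - by move=> x; exact: nnmf_EFin_ge0 nFa'.
have eM : agree g f s = agree f g s by apply/funext => x; rewrite agreeC.
have nMt' := eq_ind_r (fun h : S -> R => nnmf (fun x => h x / tau s x)%R) nMt eM.
have aM' := eq_ind_r (adapted s) aM eM.
rewrite (core f g F G nMt aM nFa nGb) (core g f G F nMt' aM' nGb nFa).
by apply: eq_integral => x _; rewrite (agreeC g f); congr (_ * _); rewrite muleC.
Qed.

(** Where the paths may still agree, a vanishing common mass leaves no
    remainder. *)
Lemma ae_leave_gap s : (s < T)%N ->
  {ae mu, forall x, leave f g tau s x * tau s x = agree f g s x * excess f g s x}%R.
Proof.
move=> sT; have [nt at_ h1 _] := ctau sT.
pose Z x : R := \1_[set 0%R] (tau s x).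
have nZ : nnmf Z by apply: nnmf_comp; [exact: nnmf_indic|case: nt].
have aZ : adapted s Z by move=> x; rewrite /Z at_.
have nMa : nnmf (fun x => agree f g s x * excess f g s x)%R by exact: nnmf_mul.
have : \int[mu]_x (Z x * (agree f g s x * excess f g s x))%:E = 0.
  rewrite -(integral_agree_gap df dg sT nZ aZ).
  transitivity (\int[mu]_x (Z x * (agree f g s x * tau s x))%:E).
    apply: ae_eq_integral_nnmf.
    - exact: nnmf_mul nZ (nnmf_mul (nM s) (ngap s)).
    - exact: nnmf_mul nZ (nnmf_mul (nM s) nt).
    - by apply: filterS h1 => x ->.
  apply: integral0_eq => x _; rewrite /Z indicE.
  have [tx|tx] := boolP (tau s x \in [set 0%R]); last by rewrite mul0r.
  by rewrite (set_mem tx) !mulr0.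
move=> /(ae_eq0_of_integral (nnmf_mul nZ nMa)); apply: filterS => x.
rewrite /Z indicE /leave; have [t0|t0] := eqVneq (tau s x) 0%R.
  by rewrite t0 mem_set// mul1r => ->; rewrite !mul0r.
by rewrite divfK.
Qed.

(** What is known at the time of separation comes out of the conditional
    expectation of the second remainder, and the normalisation cancels its
    mass. *)
Lemma split_integral_late s F G : (s < T)%N -> nnmf F -> nnmf G -> adapted s G ->
  split_integral f g tau s F G =
  \int[mu]_x (F x * (G x * (agree f g s x * excess f g s x)))%:E.
Proof.
move=> sT nF nG aG; have [nt _ _ h2] := ctau sT.
have nFl : nnmf (fun x => F x * leave f g tau s x)%R.
  by apply: nnmf_mul => //; exact: nleave.
have nGb : nnmf (fun y => G y * excess g f s y)%R by exact: nnmf_mul.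
have nMb : nnmf (fun y => agree f g s y * excess g f s y)%R by exact: nnmf_mul.
have nMa : nnmf (fun y => agree f g s y * excess f g s y)%R by exact: nnmf_mul.
have Mbfin : \int[mu]_x (agree f g s x * excess g f s x)%:E < +oo.
  by under eq_integral do rewrite agreeC; exact: (agree_excess_finite dg df sT).
apply: ge0_ae_eq_integral => //.
- by apply: emeasurable_funM; [exact: nnmf_EFin nFl|exact: (measurable_cexp_nnmf sam s nGb)].
- by apply: nnmf_EFin; apply: nnmf_mul => //; exact: nnmf_mul.
- by move=> x _; apply: mule_ge0; [exact: nnmf_EFin_ge0 nFl|exact: (cexp_nnmf_ge0 sam s nGb x)].
- by move=> x _; exact: nnmf_EFin_ge0 (nnmf_mul nF (nnmf_mul nG nMa)).
have KM := ae_cexp_fin sam s nMb Mbfin.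
apply: filterS3 KM h2 (ae_leave_gap sT) => x Kfin Mgap lgap _.
have -> : cexp s (fun y => (G y * excess g f s y)%:E) x =
    (G x)%:E * cexp s (EFin \o excess g f s) x.
  exact: (cexp_pull_nnmf (nb s) x nG aG).
have KME : cexp s (EFin \o (fun y => agree f g s y * excess g f s y)%R) x =
    (agree f g s x)%:E * cexp s (EFin \o excess g f s) x.
  exact: (cexp_pull_nnmf (nb s) x (nM s) (adapted_agree df dg (ltnW sT))).
have [M0|M0] := eqVneq (agree f g s x) 0%R.
  by rewrite /leave M0 !(mul0r, mulr0) mul0e.
have Mpos : (0 < agree f g s x)%R by have [_ h] := nM s; rewrite lt0r M0 h.
have Kb : cexp s (EFin \o excess g f s) x = (tau s x)%:E.
  have Kbfin : cexp s (EFin \o excess g f s) x \is a fin_num.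
    move: Kfin; rewrite KME; have := cexp_nnmf_ge0 sam s (nb s) x.
    by case: (cexp _ _ _) => // _; rewrite gt0_muley ?lte_fin.
  by rewrite -(fineK Kbfin); congr EFin; apply: (mulfI M0); rewrite -Mgap.
by rewrite Kb -!EFinM -lgap; congr EFin; ring.
Qed.

Lemma ae_stayS s : (s < T)%N -> {ae mu, forall x,
  agree f g s x * excess f g s x + stay f g s.+1 x = stay f g s x}%R.
Proof.
move=> sT; apply: filterS (ae_dp_absorb df sT) => x absorb.
rewrite /stay agreeS /excess.
have -> : (Num.max (ratio f s x - ratio g s x) 0 =
    ratio f s x - Num.min (ratio f s x) (ratio g s x))%R.
  by rewrite /Num.max /Num.min; do 2 case: ifPn => //; rewrite -?leNgt; lra.
transitivity (agree f g s x * (ratio f s x * (f T x / f s.+1 x)))%R; first by ring.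
congr (_ * _)%R; rewrite /ratio; have [f0|f0] := eqVneq (f s.+1 x) 0%R.
  by rewrite absorb// !mul0r mulr0.
by move: (f s x)^-1%R => w; field.
Qed.

Lemma stay_full x : stay f g T x = agree f g T x.
Proof.
rewrite /stay; have [->|/(agree_neq0 df dg) f0] := eqVneq (agree f g T x) 0%R.
  by rewrite mul0r.
by rewrite divff// mulr1.
Qed.

Lemma sum_split_integral_late t F G : (t <= T)%N -> nnmf F -> nnmf G -> adapted t G ->
  \int[mu]_x (F x * (G x * agree f g T x))%:E +
    \sum_(t <= s < T) split_integral f g tau s F G =
  \int[mu]_x (F x * (G x * stay f g t x))%:E.
Proof.
move=> tT nF nG; rewrite -(subKn tT).
elim: (T - t)%N (leq_subr t T) => [|k IH] kT aG.
  rewrite subn0 big_geq// adde0; apply: eq_integral => x _.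
  by rewrite stay_full.
have e : (T - k = (T - k.+1).+1)%N by lia.
rewrite big_ltn; last by lia.
rewrite addeCA -e IH ?(ltnW kT)//; last by apply: adaptedW aG; lia.
rewrite split_integral_late//; last by lia.
have nMa : nnmf (fun y => agree f g (T - k.+1)%N y * excess f g (T - k.+1)%N y)%R.
  exact: nnmf_mul.
have nl := nnmf_mul nF (nnmf_mul nG nMa).
have nst s := nnmf_mul nF (nnmf_mul nG (nstay s)).
rewrite -(integral_nnmfD mu nl (nst _)).
have sT : (T - k.+1 < T)%N by lia.
apply: ae_eq_integral_nnmf; [exact: nnmf_add nl (nst _)|exact: nst|].
by apply: filterS (ae_stayS sT) => x h; rewrite -!mulrDr e h.
Qed.

(** Conditional expectation of [G] on the second path given the first one, over
    the pairs that separate at step [s]: it only involves the first [s.+1]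
    coordinates of the first path, because given the past the second path is
    drawn independently of the first. *)
Definition early_density (G : S -> R) s x : R :=
  (agree f g s x * Num.max (ratio f s x - ratio g s x) 0 / f s.+1 x / tau s x *
   fine (cexp s (EFin \o (fun y => G y * excess g f s y)) x))%R.

Let nearly s G : (s < T)%N -> nnmf G -> nnmf (early_density G s).
Proof.
move=> sT nG; apply: nnmf_mul; last by apply: nnmf_cexp; exact: nnmf_mul.
apply: nnmf_div; last exact: ntau.
apply: nnmf_div; last exact: dp_nnmf df _.
exact: (nnmf_mul (nM s) (nnmf_posB (nnmf_ratio s df) (nnmf_ratio s dg))).
Qed.

Let aearly s t G : (s < t)%N -> (t <= T)%N -> adapted t (early_density G s).
Proof.
move=> st tT; apply: (adaptedW st) => x; have sT := leq_trans st tT.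
have [_ atau _ _] := ctau sT.
rewrite /early_density !(adapted_ratio _ sT)// (dp_adapted df sT).
rewrite (adaptedW (leqnSn s) (adapted_agree df dg (ltnW sT))).
rewrite (adaptedW (leqnSn s) atau); congr (_ * fine _)%R.
exact: (adaptedW (leqnSn s) (@adapted_cexp _ _ _ _ _ sam s _)).
Qed.

Lemma split_integral_early s F G : (s < T)%N -> nnmf F -> nnmf G ->
  (forall x, G x <= 1)%R ->
  split_integral f g tau s F G = \int[mu]_x (F x * (early_density G s x * f T x))%:E.
Proof.
move=> sT nF nG G1; have [nt _ _ h2] := ctau sT.
have nFl : nnmf (fun x => F x * leave f g tau s x)%R.
  by apply: nnmf_mul => //; exact: nleave.
have nGb : nnmf (fun y => G y * excess g f s y)%R by exact: nnmf_mul.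
have nMb : nnmf (fun y => agree f g s y * (G y * excess g f s y))%R by exact: nnmf_mul.
have nMb' : nnmf (fun y => agree f g s y * excess g f s y)%R by exact: nnmf_mul.
have nE := nnmf_mul nF (nnmf_mul (nearly sT nG) (dp_nnmf df T)).
have Mbfin : \int[mu]_x (agree f g s x * (G x * excess g f s x))%:E < +oo.
  apply: (@le_lt_trans _ _ (\int[mu]_x (agree f g s x * excess g f s x)%:E)).
    apply: le_integral_nnmf => // x; have [_ M0] := nM s; have [_ b0] := nb s.
    by apply: ler_wpM2l => //; rewrite ler_piMl.
  by under eq_integral do rewrite agreeC; exact: (agree_excess_finite dg df sT).
apply: ge0_ae_eq_integral => //.
- by apply: emeasurable_funM; [exact: nnmf_EFin nFl|exact: (measurable_cexp_nnmf sam s nGb)].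
- exact: nnmf_EFin.
- by move=> x _; apply: mule_ge0; [exact: nnmf_EFin_ge0 nFl|exact: (cexp_nnmf_ge0 sam s nGb x)].
- by move=> x _; exact: nnmf_EFin_ge0 nE.
apply: filterS (ae_cexp_fin sam s nMb Mbfin) => x Kfin _.
have KME : cexp s (EFin \o (fun y => agree f g s y * (G y * excess g f s y))%R) x =
    (agree f g s x)%:E * cexp s (EFin \o (fun y => G y * excess g f s y)%R) x.
  exact: (cexp_pull_nnmf nGb x (nM s) (adapted_agree df dg (ltnW sT))).
rewrite /early_density /leave; have [M0|M0] := eqVneq (agree f g s x) 0%R.
  by rewrite M0 !(mul0r, mulr0) mul0e.
have Mpos : (0 < agree f g s x)%R by have [_ h] := nM s; rewrite lt0r M0 h.
have Kbfin : cexp s (EFin \o (fun y => G y * excess g f s y)%R) x \is a fin_num.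
  move: Kfin; rewrite KME; have := cexp_nnmf_ge0 sam s nGb x.
  by case: (cexp _ _ _) => // _; rewrite gt0_muley ?lte_fin.
rewrite -[X in _ * X](fineK Kbfin) -EFinM; congr EFin.
by rewrite /excess; ring.
Qed.

(** Integral of [F x * G y] under the splitting coupling. *)
Definition total_integral (F G : S -> R) : \bar R :=
  \int[mu]_x (F x * (G x * agree f g T x))%:E +
    \sum_(s < T) split_integral f g tau s F G.

Lemma total_integral1 F : nnmf F ->
  total_integral F (fun=> 1%R) = \int[mu]_x (F x * f T x)%:E.
Proof.
move=> nF; have n1 := nnmf1 S R.
rewrite /total_integral -(big_mkord xpredT
  (fun s => split_integral f g tau s F (fun=> 1%R))).
rewrite sum_split_integral_late//; apply: eq_integral => x _.
by rewrite /stay /agree big_ord0 (dp_one df) !mul1r divr1.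
Qed.

(** Causality: the conditional law of the past of the second path given the
    whole first path only depends on the past of the first path. The pairs that
    separate before [t] contribute [early_density]; for all others [G] takes the
    same value on both paths. *)
Lemma total_integral_causal t G : (t <= T)%N -> nnmf G -> (forall x, G x <= 1)%R ->
  adapted t G -> exists k : S -> R, [/\ nnmf k, adapted t k &
    forall F, nnmf F ->
      total_integral F G = \int[mu]_x (F x * (k x * f T x))%:E].
Proof.
move=> tT nG G1 aG.
have nl : nnmf (fun x => G x * (agree f g t x / f t x))%R.
  by apply: nnmf_mul => //; apply: nnmf_div => //; exact: dp_nnmf df _.
have ne s : (s < t)%N -> nnmf (early_density G s).
  by move=> st; apply: nearly => //; exact: leq_trans st tT.
have ns : nnmf (fun x => \sum_(s < t) early_density G s x)%R.
  by apply: nnmf_sum => s _; exact: ne.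
exists (fun x => G x * (agree f g t x / f t x) + \sum_(s < t) early_density G s x)%R.
split.
- exact: nnmf_add.
- move=> x; rewrite aG (adapted_agree df dg tT) (dp_adapted df tT); congr (_ + _)%R.
  by apply: eq_bigr => s _; exact: (aearly _ (ltn_ord s) tT).
move=> F nF.
rewrite /total_integral -(big_mkord xpredT (fun s => split_integral f g tau s F G)).
rewrite (@big_cat_nat _ _ _ t)//= addeCA sum_split_integral_late//.
transitivity (\int[mu]_x (F x * (G x * (agree f g t x / f t x) * f T x))%:E +
    \int[mu]_x (F x * ((\sum_(s < t) early_density G s x) * f T x))%:E); last first.
  have nfT := dp_nnmf df T.
  rewrite -(integral_nnmfD mu (nnmf_mul nF (nnmf_mul nl nfT)) (nnmf_mul nF (nnmf_mul ns nfT))).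
  by apply: eq_integral => x _; rewrite -mulrDr -mulrDl.
rewrite addeC; congr (_ + _).
  by apply: eq_integral => x _; congr EFin; rewrite /stay; ring.
transitivity (\sum_(s < t) \int[mu]_x (F x * (early_density G s x * f T x))%:E).
  rewrite big_mkord; apply: eq_bigr => s _; apply: split_integral_early => //.
  exact: leq_trans (ltn_ord s) tT.
rewrite -ge0_integral_sum//.
- apply: eq_integral => x _; rewrite sumEFin; congr EFin.
  by rewrite -mulr_sumr -mulr_suml.
- move=> s; exact: nnmf_EFin (nnmf_mul nF (nnmf_mul (ne _ (ltn_ord s)) (dp_nnmf df T))).
- move=> s x _.
  exact: nnmf_EFin_ge0 (nnmf_mul nF (nnmf_mul (ne _ (ltn_ord s)) (dp_nnmf df T))).
Qed.

End formula.

Lemma total_integralC f g tau : density_process f -> density_process g ->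
  common_gap f g tau -> forall F G, nnmf F -> nnmf G ->
  total_integral f g tau F G = total_integral g f tau G F.
Proof.
move=> df dg ctau F G nF nG; congr (_ + _).
  by apply: eq_integral => x _; rewrite agreeC; congr EFin; ring.
by apply: eq_bigr => s _; exact: split_integralC.
Qed.

End splitting_formula.

(** * The splitting coupling *)

Section density_measure.
Context d (S : measurableType d) (R : realType) (m : {measure set S -> \bar R}).
Variable w : S -> R.
Hypothesis nw : nnmf w.
Local Open Scope ereal_scope.

Definition density_measure of nnmf w : set S -> \bar R :=
  fun A => \int[m]_(x in A) (w x)%:E.
Local Notation mw := (density_measure nw).

Let mw0 : mw set0 = 0. Proof. exact: integral_set0. Qed.

Let mw_ge0 A : 0 <= mw A.
Proof. by apply: integral_ge0 => x _; exact: nnmf_EFin_ge0 nw. Qed.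

Let mw_sigma_additive : semi_sigma_additive mw.
Proof.
apply: semi_sigma_additive_nng_induced; first exact: nnmf_EFin nw.
by move=> x; exact: nnmf_EFin_ge0 nw.
Qed.

HB.instance Definition _ := isMeasure.Build _ _ _ mw mw0 mw_ge0 mw_sigma_additive.

Import HBNNSimple.

Lemma ge0_integral_density (H : S -> \bar R) :
  measurable_fun setT H -> (forall x, 0 <= H x) ->
  \int[mw]_x H x = \int[m]_x ((w x)%:E * H x).
Proof.
move=> mH H0; pose h := nnsfun_approx measurableT mH.
have hH x : EFin \o h ^~ x @ \oo --> H x.
  by apply: cvg_nnsfun_approx => // y _; exact: H0.
have h_nd x : nondecreasing_seq (h ^~ x).
  by move=> a b ab; exact/lefP/nd_nnsfun_approx.
have [_ w0] := nw.
have mh n : measurable_fun setT (EFin \o h n) by exact/measurable_EFinP.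
have wh n : \int[mw]_x (h n x)%:E = \int[m]_x ((w x)%:E * (h n x)%:E).
  rewrite integralT_nnsfun sintegralE.
  have mB y : measurable (h n @^-1` [set y]) by exact: measurable_sfunP.
  transitivity (\sum_(y \in range (h n))
      \int[m]_x ((w x)%:E * (y * \1_(h n @^-1` [set y]) x)%:E)); last first.
    rewrite -ge0_integral_fsum//.
    - apply: eq_integral => x _; rewrite [in RHS](fimfunE (h n)) -fsumEFin//.
      by rewrite ge0_mule_fsumr// => y; exact: nnfun_muleindic_ge0.
    - move=> y; apply: emeasurable_funM; first exact: nnmf_EFin nw.
      by apply/measurable_EFinP; apply: measurable_funM => //; exact: measurable_indic.
    - move=> y x _; apply: mule_ge0; first by rewrite lee_fin.
      exact: nnfun_muleindic_ge0.
  apply: eq_fsbigr => y; rewrite inE => -[z _ zy].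
  have y0 : (0 <= y)%R by rewrite -zy.
  transitivity (y%:E * \int[m]_(x in h n @^-1` [set y]) (w x)%:E) => //.
  rewrite integral_mkcond -ge0_integralZl_EFin//.
  - by apply: eq_integral => x _; rewrite epatch_indic -!EFinM; congr EFin; ring.
  - by move=> x _; rewrite epatch_indic -EFinM lee_fin mulr_ge0.
  - apply/(measurable_restrictT _ (mB y)); apply: measurable_funTS.
    exact: nnmf_EFin nw.
transitivity (limn (fun n => \int[mw]_x (h n x)%:E)).
  rewrite -monotone_convergence//.
  - by apply: eq_integral => x _; apply/esym/cvg_lim => //; exact: hH.
  - by move=> n x _; rewrite lee_fin.
  - by move=> x _ a b ab; rewrite lee_fin; exact: h_nd.
transitivity (limn (fun n => \int[m]_x ((w x)%:E * (h n x)%:E))).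
  by congr (limn _); apply/funext => n; exact: wh.
rewrite -monotone_convergence//.
- apply: eq_integral => x _; apply/cvg_lim => //.
  by apply: cvgeZl => //; exact: hH.
- by move=> n; apply: emeasurable_funM; [exact: nnmf_EFin nw|exact: mh].
- by move=> n x _; rewrite mule_ge0// lee_fin.
- by move=> x _ a b ab; rewrite lee_wpmul2l ?lee_fin//; exact: h_nd.
Qed.

End density_measure.

Section splitting_measure.
Context d (S : measurableType d) (R : realType) (mu : probability S R) (T : nat).
Variable sam : sampler mu T.
Local Notation cexp := (cexp sam).
Local Notation Psi := (Psi sam).
Local Notation density_process := (density_process sam).
Local Notation excess := (excess T).
Local Notation leave := (leave T).
Local Open Scope ereal_scope.

Lemma ge0_integral_image d1 d2 (S1 : measurableType d1) (S2 : measurableType d2)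
    (m : {measure set S1 -> \bar R}) (h : S1 -> S2) (mh : measurable_fun setT h)
    (H : S2 -> \bar R) : measurable_fun setT H -> (forall y, 0 <= H y) ->
  \int[image_measure m mh]_y H y = \int[m]_x H (h x).
Proof. by move=> mH H0; rewrite ge0_integral_pushforward// preimage_setT. Qed.

Lemma integral_law d1 d2 (S1 : measurableType d1) (S2 : measurableType d2)
    (m1 : {measure set S1 -> \bar R}) (m2 : {measure set S2 -> \bar R})
    (p : S1 -> S2) (F : S2 -> R) : measurable_fun setT p ->
  (forall A, measurable A -> m1 (p @^-1` A) = m2 A) -> nnmf F ->
  \int[m1]_x (F (p x))%:E = \int[m2]_y (F y)%:E.
Proof.
move=> mp m12 nF; have F0 x : 0 <= (EFin \o F) x by exact: nnmf_EFin_ge0 nF.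
rewrite -(ge0_integral_image m1 mp (nnmf_EFin nF) F0).
by apply: eq_measure_integral => A mA _; exact: m12.
Qed.

Variables (f g : nat -> S -> R) (tau : nat -> S -> R).
Hypotheses (df : density_process f) (dg : density_process g).
Hypothesis ntau : forall s, nnmf (tau s).

Let nM : nnmf (agree f g T). Proof. exact: (nnmf_agree df dg). Qed.

Let nleave s : nnmf (leave f g tau s).
Proof. exact: (nnmf_div (nnmf_mul (nnmf_agree df dg s) (nnmf_excess df dg s)) (ntau s)). Qed.

Let w s (xu : S * measurableTypeR R) : R :=
  (leave f g tau s xu.1 * excess g f s (Psi s xu.1 xu.2))%R.

Let nw s : nnmf (w s).
Proof.
apply: nnmf_mul; last first.
  exact: (nnmf_comp (nnmf_excess dg df s) (measurable_Psi sam s)).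
apply: (nnmf_comp _ measurable_fst).
exact: nleave.
Qed.

Let mdiag : measurable_fun setT (fun x : S => (x, x)).
Proof. exact: measurable_fun_pair. Qed.

Let mresample s : measurable_fun setT
  ((fun xu => (xu.1, Psi s xu.1 xu.2)) : S * measurableTypeR R -> S * S).
Proof. by apply: measurable_fun_pair => //; exact: measurable_Psi. Qed.

(** For each step, the pairs that separate there: the second path is resampled
    from the past of the first one. *)
Definition separation_measure : {measure set (S * S) -> \bar R} :=
  msum (fun s => image_measure (density_measure (mu \x unif) (nw s)) (mresample s)) T.

(** The paths that never separate sit on the diagonal. *)
Definition splitting_measure_of : {measure set (S * S) -> \bar R} :=
  measure_add (image_measure (density_measure mu nM) mdiag) separation_measure.

Lemma integral_splitting_measure (H : S * S -> R) : nnmf H ->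
  \int[splitting_measure_of]_z (H z)%:E =
  \int[mu]_x (agree f g T x * H (x, x))%:E + \int[separation_measure]_z (H z)%:E.
Proof.
move=> nH; have mH := nnmf_EFin nH.
have H0 z : 0 <= (EFin \o H) z by exact: nnmf_EFin_ge0.
rewrite ge0_integral_measure_add//; first last.
- by move=> x _; exact: H0.
congr (_ + _).
rewrite (ge0_integral_image _ mdiag mH H0).
have nHd := nnmf_comp nH mdiag.
rewrite (ge0_integral_density _ nM (nnmf_EFin nHd))// => x.
exact: nnmf_EFin_ge0 nHd.
Qed.

Let nnmf_rect (F G : S -> R) : nnmf F -> nnmf G ->
  nnmf (fun z : S * S => F z.1 * G z.2)%R.
Proof.
by move=> nF nG; apply: nnmf_mul; [exact: (nnmf_comp nF measurable_fst)
                                  |exact: (nnmf_comp nG measurable_snd)].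
Qed.

Lemma integral_separation_rect (F G : S -> R) : nnmf F -> nnmf G ->
  \int[separation_measure]_z (F z.1 * G z.2)%:E =
  \sum_(s < T) split_integral sam f g tau s F G.
Proof.
move=> nF nG; pose H z := (F z.1 * G z.2)%R.
have nH : nnmf (H : S * S -> R) := nnmf_rect nF nG.
have mH := nnmf_EFin nH; have H0 z : 0 <= (EFin \o H) z by exact: nnmf_EFin_ge0.
rewrite ge0_integral_measure_sum//; first last.
- by move=> x _; exact: H0.
apply: eq_bigr => s _.
rewrite (ge0_integral_image _ (mresample s) mH H0).
have nHr := nnmf_comp nH (mresample s); have nwH := nnmf_mul (nw s) nHr.
rewrite (ge0_integral_density _ (nw s) (nnmf_EFin nHr)); last first.
  by move=> x; exact: nnmf_EFin_ge0 nHr.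
rewrite (fubini_tonelli1 (m1 := mu) (m2 := unif) (fun xu : S * measurableTypeR R =>
    (w s xu)%:E * (H (xu.1, Psi s xu.1 xu.2))%:E))//; first last.
- by move=> x; exact: nnmf_EFin_ge0 nwH.
- exact: nnmf_EFin nwH.
apply: eq_integral => x _; have ne := nnmf_excess dg df s.
have [_ F0] := nF; have [_ l0] := nleave s.
have Fl0 : (0 <= F x * leave f g tau s x)%R by exact: mulr_ge0.
rewrite /cexp -ge0_integralZl_EFin//.
- by apply: eq_integral => u _; rewrite -EFinM; congr EFin; rewrite /w /H /=; ring.
- by move=> u _; exact: nnmf_EFin_ge0 (nnmf_mul nG ne).
- apply: (@measurable_Psi2 _ _ _ _ _ sam s (fun y => (G y * excess g f s y)%:E)).
  exact: nnmf_EFin (nnmf_mul nG ne).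
Qed.

Lemma integral_splitting_rect (F G : S -> R) : nnmf F -> nnmf G ->
  \int[splitting_measure_of]_z (F z.1 * G z.2)%:E = total_integral sam f g tau F G.
Proof.
move=> nF nG; rewrite /total_integral -(integral_separation_rect nF nG) integral_splitting_measure.
  by congr (_ + _); apply: eq_integral => x _; congr EFin => /=; ring.
exact: nnmf_rect.
Qed.

(** A cost vanishing on the diagonal is only paid after the paths separate. *)
Lemma splitting_cost (c : S * S -> R) (phi : S -> R) : nnmf c -> nnmf phi ->
  (forall x, c (x, x) = 0%R) -> (forall x y, (c (x, y) <= phi x + phi y)%R) ->
  \int[splitting_measure_of]_z (c z)%:E <=
  \sum_(s < T) split_integral sam f g tau s phi (fun=> 1%R) +
  \sum_(s < T) split_integral sam f g tau s (fun=> 1%R) phi.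
Proof.
move=> nc nphi cxx cphi; rewrite (integral_splitting_measure nc).
rewrite [X in X + _](_ : _ = 0) ?add0e; last first.
  by apply: integral0_eq => x _; rewrite cxx mulr0.
have n1 := nnmf1 S R.
rewrite -(integral_separation_rect nphi n1) -(integral_separation_rect n1 nphi).
rewrite -(integral_nnmfD _ (nnmf_rect nphi n1) (nnmf_rect n1 nphi)).
apply: le_integral_nnmf => //; first exact: nnmf_add (nnmf_rect nphi n1) (nnmf_rect n1 nphi).
by move=> [x y]; rewrite mulr1 mul1r; exact: cphi.
Qed.

End splitting_measure.

(** * Elementary inequalities for the entropy function *)

Section entropy_function.
Context {R : realType}.
Implicit Types r y a b : R.

(** The integrand of relative entropy, normalised to be nonnegative. *)
Definition hent r : R := r * ln r - r + 1.

Lemma hent0 : hent 0 = 1.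
Proof. by rewrite /hent mul0r subr0 add0r. Qed.

Lemma hent1 : hent 1 = 0.
Proof. by rewrite /hent ln1 mulr0 sub0r addNr. Qed.

(** Legendre duality between [hent] and the exponential. *)
Lemma young_entropy r y : 0 <= r -> r * y + 1 <= hent r + expR y.
Proof.
rewrite le_eqVlt => /orP[/eqP <-|r0].
  by rewrite hent0 mul0r add0r lerDl expR_ge0.
have := expR_ge1Dx (y - ln r); rewrite expRD expRN lnK// => h.
have := ler_wpM2l (ltW r0) h; rewrite mulrCA divff ?gt_eqF// mulr1 /hent; lra.
Qed.

Lemma hent_ge0 r : 0 <= r -> 0 <= hent r.
Proof. by move=> r0; have := young_entropy 0 r0; rewrite mulr0 add0r expR0; lra. Qed.

(** The defect of the tangent line of [hent] at [a] is again an entropy; this is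
    the chain rule for relative entropy before integration. *)
Lemma bregman_entropy a b : 0 < a -> 0 <= b ->
  hent b = hent a + a * hent (b / a) + ln a * (b - a).
Proof.
move=> a0; rewrite le_eqVlt => /orP[/eqP <-|b0].
  by rewrite mul0r hent0 /hent; ring.
have a0' : a != 0 by rewrite gt_eqF.
rewrite /hent ln_div ?posrE//.
have e : a * (b / a) = b by rewrite mulrC divfK.
rewrite mulrDr mulrBr mulrA e; ring.
Qed.

Lemma mvt_at_1 (F G : R -> R) : (forall x : R, 0 < x -> is_derive x (1 : R) F (G x)) ->
  forall r, 0 < r -> exists c, [/\ 0 < c, 0 <= (c - 1) * (r - 1) &
    F r = F 1 + G c * (r - 1)].
Proof.
move=> dF r r0.
have cont (p q : R) : 0 < p -> {within `[p, q], continuous F}.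
  move=> p0; apply: derivable_within_continuous => x; rewrite in_itv/= => /andP[px _].
  by apply: ex_derive; exact: dF (lt_le_trans p0 px).
have [r1|r1|->] := ltgtP r 1.
- have h (x : R) : x \in `]r, 1[ -> is_derive x (1 : R) F (G x).
    by rewrite in_itv/= => /andP[rx _]; apply: dF; exact: lt_trans rx.
  have [c] := MVT r1 h (cont _ _ r0).
  rewrite in_itv/= => /andP[rc c1] e; exists c; split; first exact: lt_trans rc.
    by apply: mulr_le0; rewrite subr_le0 ltW.
  by move: e; lra.
- have h (x : R) : x \in `]1, r[ -> is_derive x (1 : R) F (G x).
    by rewrite in_itv/= => /andP[rx _]; apply: dF; exact: lt_trans rx.
  have [c] := MVT r1 h (cont _ _ ltr01).
  rewrite in_itv/= => /andP[c1 cr] e; exists c; split; first exact: lt_trans c1.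
    by apply: mulr_ge0; rewrite subr_ge0 ltW.
  by move: e; lra.
- by exists 1; rewrite !subrr !mulr0 addr0.
Qed.

(** After division by [2 / 3 * (r + 2)], the difference of the two sides
    vanishes at 1 together with its derivative, and has second derivative
    [1 / r - 27 / (r + 2) ^ 3], which is nonnegative because
    [(r + 2) ^ 3 - 27 * r = (r - 1) ^ 2 * (r + 8)]. *)
Lemma pinsker_pointwise r : 0 <= r -> (r - 1) ^+ 2 <= 2 / 3 * (r + 2) * hent r.
Proof.
rewrite le_eqVlt => /orP[/eqP <-|r0].
  by rewrite hent0; lra.
pose F x : R := x * ln x - 5 / 2 * x + 7 - 27 / 2 * (x + 2)^-1.
pose G x : R := ln x - 3 / 2 + 27 / 2 * ((x + 2) ^+ 2)^-1.
pose G' x : R := x^-1 - 27 * ((x + 2) ^+ 3)^-1.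
have p2 (x : R) : 0 < x -> x + 2 != 0 by move=> x0; rewrite gt_eqF// addr_gt0.
have d2 (x : R) : is_derive x (1 : R) (fun x : R => x + 2) 1.
  have := is_deriveD (is_derive_id x (1 : R)) (is_derive_cst (2 : R) x (1 : R)).
  by rewrite addr0.
have dV (x : R) : 0 < x -> is_derive x (1 : R) (fun x : R => (x + 2)^-1) (- ((x + 2) ^+ 2)^-1).
  move=> x0; have h := @is_deriveV R (fun x : R => x + 2) x 1 1 (p2 x x0) (d2 x).
  by apply: (is_derive_eq h); rewrite /GRing.scale/= mulr1.
have dV2 (x : R) : 0 < x ->
    is_derive x (1 : R) (fun x : R => ((x + 2) ^+ 2)^-1) (- 2 * ((x + 2) ^+ 3)^-1).
  move=> x0; have := p2 x x0 => xn0.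
  have d22 := is_deriveX 2 (d2 x).
  have x20 : ((fun x : R => x + 2) ^+ 2) x != 0 by exact: (expf_neq0 2 xn0).
  have h := @is_deriveV R _ x _ _ x20 d22; apply: (is_derive_eq h).
  rewrite /GRing.scale/= expr1 -[X in - X ^- 2]/((x + 2) ^+ 2); field.
  exact: xn0.
have dF (x : R) : 0 < x -> is_derive x (1 : R) F (G x).
  move=> x0; have dln := is_derive1_ln x0.
  have d1 := is_deriveM (is_derive_id x (1 : R)) dln.
  have d3 := is_deriveZ (5 / 2) (is_derive_id x (1 : R)).
  have d4 := is_deriveZ (27 / 2) (dV x x0).
  have dall := is_deriveB (is_deriveD (is_deriveB d1 d3)
    (is_derive_cst (7 : R) x (1 : R))) d4.
  apply: (is_derive_eq dall); rewrite /GRing.scale/= /G.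
  by rewrite mulfV ?gt_eqF//; field; exact: p2.
have dG (x : R) : 0 < x -> is_derive x (1 : R) G (G' x).
  move=> x0; have dln := is_derive1_ln x0.
  have d4 := is_deriveZ (27 / 2) (dV2 x x0).
  have dall := is_deriveD (is_deriveB dln (is_derive_cst (3 / 2 : R) x (1 : R))) d4.
  by apply: (is_derive_eq dall); rewrite /GRing.scale/= /G'; field; rewrite p2 ?gt_eqF.
have G'0 (x : R) : 0 < x -> 0 <= G' x.
  move=> x0; have x2 : 0 < (x + 2) ^+ 3 by rewrite exprn_gt0// addr_gt0.
  rewrite /G' subr_ge0 ler_pdivrMr// mulrC ler_pdivlMr//.
  rewrite -subr_ge0 (_ : _ - _ = (x - 1) ^+ 2 * (x + 8)); last by ring.
  by rewrite mulr_ge0 ?sqr_ge0// addr_ge0// ltW.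
have G1 : G 1 = 0 by rewrite /G ln1; field.
have F1 : F 1 = 0 by rewrite /F ln1; field.
have Gs (x : R) : 0 < x -> 0 <= G x * (x - 1).
  move=> x0; have [c [c0 _ ->]] := mvt_at_1 dG x0.
  by rewrite G1 add0r -mulrA -expr2 mulr_ge0 ?sqr_ge0// G'0.
have F0 : 0 <= F r.
  have [c [c0 cr ->]] := mvt_at_1 dF r0; rewrite F1 add0r.
  have [c1|c1] := eqVneq c 1; first by rewrite c1 G1 mul0r.
  have h : 0 < (c - 1) ^+ 2 by rewrite exprn_even_gt0//= subr_eq0.
  rewrite -(pmulr_rge0 _ h); have := Gs c c0; move: (G c) => w wc.
  have -> : (c - 1) ^+ 2 * (w * (r - 1)) = w * (c - 1) * ((c - 1) * (r - 1)) by ring.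
  exact: mulr_ge0.
have r2 : 0 < r + 2 by rewrite addr_gt0.
have : 0 <= 2 / 3 * (r + 2) * F r by rewrite !mulr_ge0// ltW.
rewrite /F /hent.
have -> : 2 / 3 * (r + 2) * (r * ln r - 5 / 2 * r + 7 - 27 / 2 * (r + 2)^-1) =
  2 / 3 * (r + 2) * (r * ln r - r + 1) - (r - 1) ^+ 2 by field; exact: p2.
by rewrite subr_ge0.
Qed.

End entropy_function.

(** * Entropy bounds *)

Section entropy_bounds.
Context d (S : measurableType d) (R : realType) (mu : probability S R).
Local Open Scope ereal_scope.
Implicit Types f r phi : S -> R.

Lemma nnmf_hent f : nnmf f -> nnmf (hent \o f).
Proof.
move=> [mf f0]; split=> [|x]; last exact: hent_ge0.
apply: measurable_funD => //; apply: measurable_funB => //.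
by apply: measurable_funM => //; apply: measurableT_comp => //; exact: measurable_ln.
Qed.

Lemma nnmf_expR f : measurable_fun setT f -> nnmf (fun x => expR (f x)).
Proof. by move=> mf; split=> [|x]; [apply: measurableT_comp|exact: expR_ge0]. Qed.

Lemma nnmf_exp f n : nnmf f -> nnmf (fun x => f x ^+ n)%R.
Proof. by move=> [mf f0]; split=> [|x]; [exact: measurable_funX|exact: exprn_ge0]. Qed.

Lemma integral_prob1 : \int[mu]_x (1%R : R)%:E = 1.
Proof. by rewrite integral_cst// mul1e; exact: probability_setT. Qed.

(** The arithmetic-geometric mean inequality [2 f <= q / p * g + p / q * h], with
    [p] and [q] decreasing to the square roots of [A] and [B], which may vanish. *)
Lemma cauchy_schwarz f g h (A B : R) : nnmf f -> nnmf g -> nnmf h ->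
  (0 <= A)%R -> (0 <= B)%R -> (forall x, f x ^+ 2 <= g x * h x)%R ->
  \int[mu]_x (g x)%:E <= A%:E -> \int[mu]_x (h x)%:E <= B%:E ->
  \int[mu]_x (f x)%:E <= (Num.sqrt A * Num.sqrt B)%:E.
Proof.
move=> nf ng nh A0 B0 fgh gA hB.
have key (p q : R) : (0 < p)%R -> (0 < q)%R -> (Num.sqrt A <= p)%R ->
    (Num.sqrt B <= q)%R -> \int[mu]_x (f x)%:E <= (p * q)%:E.
  move=> p0 q0 Ap Bq; have [_ f0] := nf; have [_ g0] := ng; have [_ h0] := nh.
  have c1 : (0 <= q / p / 2)%R by rewrite !divr_ge0// ltW.
  have c2 : (0 <= p / q / 2)%R by rewrite !divr_ge0// ltW.
  apply: (@le_trans _ _ (\int[mu]_x (q / p / 2 * g x + p / q / 2 * h x)%:E)).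
    apply: le_integral_nnmf => //.
      by apply: nnmf_add; apply: nnmf_mul => //; exact: nnmf_cst.
    move=> x; rewrite -(@ler_pXn2r _ 2)// ?nnegrE//; last first.
      by rewrite addr_ge0// mulr_ge0.
    apply: le_trans (fgh x) _; rewrite -subr_ge0.
    have -> : ((q / p / 2 * g x + p / q / 2 * h x) ^+ 2 - g x * h x =
        (q / p / 2 * g x - p / q / 2 * h x) ^+ 2)%R.
      by field; rewrite !gt_eqF.
    exact: sqr_ge0.
  rewrite integral_nnmfD; [|by apply: nnmf_mul => //; exact: nnmf_cst..].
  rewrite !integral_nnmfZ//.
  apply: (@le_trans _ _ ((q / p / 2)%:E * A%:E + (p / q / 2)%:E * B%:E)).
    by apply: leeD; apply: lee_wpmul2l; rewrite ?lee_fin.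
  rewrite -!EFinM -EFinD lee_fin.
  have A2 : (A <= p ^+ 2)%R by rewrite -(sqr_sqrtr A0) ler_pXn2r// nnegrE ?sqrtr_ge0 ?ltW.
  have B2 : (B <= q ^+ 2)%R by rewrite -(sqr_sqrtr B0) ler_pXn2r// nnegrE ?sqrtr_ge0 ?ltW.
  apply: le_trans (lerD (ler_wpM2l c1 A2) (ler_wpM2l c2 B2)) _.
  by rewrite le_eqVlt; apply/orP; left; apply/eqP; field; rewrite !gt_eqF.
apply/lee_addgt0Pr => del del0.
have sA := sqrtr_ge0 A; have sB := sqrtr_ge0 B.
have D0 : (0 < Num.sqrt A + Num.sqrt B + 1)%R by rewrite ltr_wpDl// addr_ge0.
pose e := (Num.min 1 (del / (Num.sqrt A + Num.sqrt B + 1)))%R.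
have e0 : (0 < e)%R by rewrite lt_min ltr01 divr_gt0.
have e1 : (e <= 1)%R by rewrite ge_min lexx.
have e2 : (e * (Num.sqrt A + Num.sqrt B + 1) <= del)%R.
  by rewrite -ler_pdivlMr// ge_min lexx orbT.
apply: le_trans (key (Num.sqrt A + e) (Num.sqrt B + e) _ _ _ _)%R _.
- by rewrite ltr_wpDl.
- by rewrite ltr_wpDl.
- by rewrite lerDl ltW.
- by rewrite lerDl ltW.
rewrite -EFinD lee_fin; apply: le_trans _ (lerD (lexx _) e2).
have : (e * e <= e)%R by rewrite ler_piMr// ltW.
nra.
Qed.

Section weighted_pinsker.
Variables (phi : S -> R) (alpha E : R).
Hypotheses (nphi : nnmf phi) (alpha0 : (0 < alpha)%R).
Hypothesis phiE : \int[mu]_x (expR (alpha * phi x ^+ 2))%:E = E%:E.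
Local Notation L := (ln E).

Let nphi2 : nnmf (fun x => phi x ^+ 2)%R. Proof. exact: nnmf_exp. Qed.

Lemma exp_moment_ge1 : (1 <= E)%R.
Proof.
rewrite -lee_fin -phiE; apply: (@le_trans _ _ (\int[mu]_x 1%:E)).
  by rewrite integral_prob1.
have [mphi p0] := nphi; apply: le_integral_nnmf; first exact: nnmf_cst.
  by apply: nnmf_expR; apply: measurable_funM => //; case: nphi2.
move=> x; apply: le_trans _ (expR_ge1Dx _); rewrite lerDl mulr_ge0 ?exprn_ge0//.
exact: ltW.
Qed.

Let E0 : (0 < E)%R. Proof. exact: lt_le_trans ltr01 exp_moment_ge1. Qed.
Let L0 : (0 <= L)%R. Proof. by rewrite ln_ge0// exp_moment_ge1. Qed.

(** The Gibbs variational inequality: [young_entropy] integrated at the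
    exponent [alpha * phi ^ 2 - ln E], whose exponential has integral 1. *)
Lemma gibbs r (H : R) : nnmf r -> \int[mu]_x (r x)%:E = 1 ->
  \int[mu]_x (hent (r x))%:E = H%:E ->
  \int[mu]_x (phi x ^+ 2 * r x)%:E <= ((H + L) / alpha)%:E.
Proof.
move=> nr r1 rH; have [_ r0] := nr; have [mphi p0] := nphi.
have ne : nnmf (fun x => expR (alpha * phi x ^+ 2))%R.
  by apply: nnmf_expR; apply: measurable_funM => //; case: nphi2.
have npr : nnmf (fun x => phi x ^+ 2 * r x)%R by exact: nnmf_mul.
have nh := nnmf_hent nr.
have n1 := nnmf1 S R.
have np : nnmf (fun x => alpha * (phi x ^+ 2 * r x))%R.
  by apply: nnmf_mul => //; apply: nnmf_cst; exact: ltW.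
have nq : nnmf (fun x => E^-1 * expR (alpha * phi x ^+ 2))%R.
  by apply: nnmf_mul => //; apply: nnmf_cst; rewrite invr_ge0 ltW.
have nL : nnmf (fun x => L * r x)%R by apply: nnmf_mul => //; exact: nnmf_cst.
have : \int[mu]_x (alpha * (phi x ^+ 2 * r x) + 1)%:E <=
    \int[mu]_x (hent (r x) + E^-1 * expR (alpha * phi x ^+ 2) + L * r x)%:E.
  apply: le_integral_nnmf; [exact: nnmf_add|by apply: nnmf_add => //; exact: nnmf_add|].
  move=> x; have := young_entropy (alpha * phi x ^+ 2 - L) (r0 x).
  rewrite expRD expRN lnK ?posrE//.
  by move: (hent _) (expR _) (E^-1)%R => a b c; lra.
have -> : \int[mu]_x (alpha * (phi x ^+ 2 * r x) + 1)%:E =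
    alpha%:E * \int[mu]_x (phi x ^+ 2 * r x)%:E + 1.
  by rewrite -(integral_nnmfZ mu (ltW alpha0) npr) (integral_nnmfD mu np n1) integral_prob1.
have -> : \int[mu]_x (hent (r x) + E^-1 * expR (alpha * phi x ^+ 2) + L * r x)%:E =
    (H + 1 + L)%:E.
  rewrite (integral_nnmfD mu (nnmf_add nh nq) nL) (integral_nnmfD mu nh nq).
  have Ei : (0 <= E^-1)%R by rewrite invr_ge0 ltW.
  rewrite (integral_nnmfZ mu Ei ne) (integral_nnmfZ mu L0 nr) phiE r1 mule1.
  by rewrite -EFinM mulVf ?gt_eqF// [X in X + _ + _]rH.
have := integral_nnmf_ge0 mu npr; case: (\int[mu]_x _) => [y| |] //.
  move=> _; rewrite -!EFinM -!EFinD !lee_fin => h.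
  by rewrite ler_pdivlMr// mulrC; move: h; lra.
by rewrite gt0_muley ?lte_fin// addye.
Qed.

Lemma second_moment : \int[mu]_x (phi x ^+ 2)%:E <= (L / alpha)%:E.
Proof.
have n1 := nnmf1 S R.
have i1 := integral_prob1.
have h0 : \int[mu]_x (hent 1%R)%:E = 0%R%:E.
  by rewrite hent1; exact: integral0.
have := gibbs n1 i1 h0; rewrite add0r.
by under eq_integral do rewrite mulr1.
Qed.

Lemma first_moment : \int[mu]_x (phi x)%:E <= (Num.sqrt (L / alpha))%:E.
Proof.
rewrite -[X in _ <= X%:E]mulr1 -[in X in _ <= (_ * X)%:E]sqrtr1.
have n1 := nnmf1 S R.
apply: (cauchy_schwarz nphi nphi2 n1) => //.
- by rewrite divr_ge0// ltW.
- by move=> x; rewrite mulr1.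
- exact: second_moment.
- by rewrite integral_prob1.
Qed.

Variables (r : S -> R) (H : R).
Hypotheses (nr : nnmf r) (r1 : \int[mu]_x (r x)%:E = 1).
Hypothesis rH : \int[mu]_x (hent (r x))%:E = H%:E.

Lemma entropy_real_ge0 : (0 <= H)%R.
Proof. by rewrite -lee_fin -rH; exact: integral_nnmf_ge0 (nnmf_hent nr). Qed.

(** The weighted Csiszar-Kullback-Pinsker inequality. When [H] is small,
    [pinsker_pointwise] and the Gibbs inequality are sharp enough; when it is
    larger than 3 the triangle inequality already is. *)
Lemma weighted_pinsker : \int[mu]_x (phi x * `|r x - 1|)%:E <=
  (Num.sqrt ((1 + L) / alpha) * Num.sqrt (2 * H))%:E.
Proof.
have H0 := entropy_real_ge0; have [mphi p0] := nphi; have [mr r0] := nr.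
have n1 := nnmf1 S R.
have nab : nnmf (fun x => `|r x - 1|)%R.
  by split=> [|x//]; apply: measurableT_comp => //; exact: measurable_funB.
have nf : nnmf (fun x => phi x * `|r x - 1|)%R by exact: nnmf_mul.
have npr : nnmf (fun x => phi x ^+ 2 * r x)%R by exact: nnmf_mul.
have g1 := gibbs nr r1 rH; have g2 := second_moment.
have a0 : (0 <= alpha^-1)%R by rewrite invr_ge0 ltW.
rewrite -sqrtrM ?divr_ge0 ?addr_ge0 ?(ltW alpha0)//.
have [H3|H3] := leP H 3%R.
  have e : ((1 + L) / alpha * (2 * H) = (2 * (1 + L)) / alpha * H)%R by ring.
  rewrite e sqrtrM ?divr_ge0 ?mulr_ge0 ?addr_ge0 ?(ltW alpha0)//.
  apply: (@cauchy_schwarz _ (fun x => 2 / 3 * (phi x ^+ 2 * r x) + 4 / 3 * phi x ^+ 2)%R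
     (hent \o r)) => //.
  - by apply: nnmf_add; apply: nnmf_mul => //; exact: nnmf_cst.
  - exact: nnmf_hent.
  - by rewrite divr_ge0 ?mulr_ge0 ?addr_ge0 ?(ltW alpha0).
  - move=> x; rewrite exprMn real_normK ?num_real//.
    have h := ler_wpM2l (sqr_ge0 (phi x)) (pinsker_pointwise (r0 x)).
    apply: le_trans h _; rewrite le_eqVlt; apply/orP; left; apply/eqP => /=; ring.
  - have c2 : (0 <= 2 / 3 :> R)%R by rewrite divr_ge0.
    have c4 : (0 <= 4 / 3 :> R)%R by rewrite divr_ge0.
    have n2 := nnmf_mul (nnmf_cst _ c2) npr; have n4 := nnmf_mul (nnmf_cst _ c4) nphi2.
    rewrite (integral_nnmfD mu n2 n4) (integral_nnmfZ mu c2 npr) (integral_nnmfZ mu c4 nphi2).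
    apply: (@le_trans _ _ ((2 / 3)%:E * ((H + L) / alpha)%:E + (4 / 3)%:E * (L / alpha)%:E)).
      by apply: leeD; apply: lee_wpmul2l; rewrite ?lee_fin.
    rewrite -!EFinM -EFinD lee_fin.
    have -> : (2 / 3 * ((H + L) / alpha) + 4 / 3 * (L / alpha) =
      (2 / 3 * H + 2 * L) / alpha)%R by field; rewrite gt_eqF.
    by apply: ler_wpM2r => //; move: H3; lra.
  - by rewrite rH.
apply: (@le_trans _ _ (\int[mu]_x (phi x * r x + phi x)%:E)).
  apply: le_integral_nnmf => //; first by apply: nnmf_add => //; exact: nnmf_mul.
  move=> x; have -> : (phi x * r x + phi x = phi x * (r x + 1))%R by ring.
  apply: ler_wpM2l => //.
  by apply: le_trans (ler_normB _ _) _; rewrite normr1 ger0_norm.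
rewrite (integral_nnmfD mu (nnmf_mul nphi nr) nphi).
apply: (@le_trans _ _ ((Num.sqrt ((H + L) / alpha))%:E + (Num.sqrt (L / alpha))%:E)).
  apply: leeD; last exact: first_moment.
  rewrite -[X in _ <= X%:E]mulr1 -[in X in _ <= (_ * X)%:E]sqrtr1.
  apply: (@cauchy_schwarz _ (fun x => phi x ^+ 2 * r x)%R r) => //.
  - exact: nnmf_mul.
  - by rewrite divr_ge0 ?addr_ge0 ?(ltW alpha0).
  - by move=> x; rewrite le_eqVlt; apply/orP; left; apply/eqP; ring.
  - by rewrite r1.
rewrite -EFinD lee_fin.
have HL0 : (0 <= (H + L) / alpha)%R by rewrite divr_ge0 ?addr_ge0 ?(ltW alpha0).
have La0 : (0 <= L / alpha)%R by rewrite divr_ge0 ?(ltW alpha0).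
rewrite -(@ler_pXn2r _ 2)// ?nnegrE ?sqrtr_ge0 ?addr_ge0 ?sqrtr_ge0//.
rewrite sqr_sqrtr; last by rewrite mulr_ge0 ?divr_ge0 ?addr_ge0 ?mulr_ge0 ?(ltW alpha0).
set p := Num.sqrt _; set q := Num.sqrt _.
have p2 : (p ^+ 2 = (H + L) / alpha)%R by rewrite sqr_sqrtr.
have q2 : (q ^+ 2 = L / alpha)%R by rewrite sqr_sqrtr.
have h1 : ((p + q) ^+ 2 <= 2 * (p ^+ 2 + q ^+ 2))%R.
  by rewrite -subr_ge0 (_ : _ - _ = (p - q) ^+ 2)%R ?sqr_ge0//; ring.
apply: le_trans h1 _; rewrite p2 q2.
have -> : (2 * ((H + L) / alpha + L / alpha) = (2 * H + 4 * L) / alpha)%R by ring.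
have -> : ((1 + L) / alpha * (2 * H) = (2 * H + 2 * L * H) / alpha)%R by ring.
apply: ler_wpM2r => //; rewrite lerD2l.
have : (0 <= L * (H - 3))%R by rewrite mulr_ge0// subr_ge0 ltW.
by move: L0; lra.
Qed.

End weighted_pinsker.

End entropy_bounds.

(** * Entropy controls the mass that splits *)

(** Jensen's inequality for the entropy, with its defect term. Adding
    [|ln a| * (b + a)] to both sides of [bregman_entropy] makes every term
    nonnegative, so that [hent \o b] need not be integrable. *)
Lemma bregman_integral d (S : measurableType d) (R : realType)
    (P : probability S R) (b : S -> R) (a : R) : nnmf b -> 0 <= a ->
  (\int[P]_x (b x)%:E = a%:E ->
   (hent a)%:E + \int[P]_x (a * hent (b x / a))%:E <=
   \int[P]_x (hent (b x))%:E)%E.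
Proof.
move=> nb a0 ba; have [_ b0] := nb.
have nhb : nnmf (fun x => hent (b x)) := nnmf_hent nb.
move: a0; rewrite le_eqVlt => /orP[/eqP a0|a0].
  rewrite -a0 in ba *; rewrite hent0; under eq_integral do rewrite mul0r.
  rewrite integral0 adde0 -[leLHS](integral_prob1 P) le_eqVlt; apply/orP; left; apply/eqP.
  apply: ae_eq_integral_nnmf (nnmf_cst _ ler01) nhb _.
  by apply: filterS (ae_eq0_of_integral nb ba) => x /= ->; rewrite hent0.
have [l0 l1] : 0 <= `|ln a| + ln a /\ 0 <= `|ln a| - ln a.
  by have := ler_norm (ln a); have := ler_norm (- ln a); rewrite normrN; lra.
have nav : nnmf (fun x => a * hent (b x / a)).
  apply: nnmf_mul; first exact/nnmf_cst/ltW.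
  by apply: (@nnmf_hent _ _ _ (fun x => b x / a)); apply: nnmf_div => //; exact/nnmf_cst/ltW.
pose c : R := hent a + (`|ln a| - ln a) * a.
have c0 : 0 <= c by rewrite addr_ge0 ?hent_ge0 ?mulr_ge0 ?(ltW a0).
have nc : nnmf (fun _ : S => c) by exact: nnmf_cst.
have nl : nnmf (fun x => (`|ln a| + ln a) * b x).
  by apply: nnmf_mul => //; exact: nnmf_cst.
have nla : nnmf (fun x => `|ln a| * b x).
  by apply: nnmf_mul => //; exact: nnmf_cst.
have nd : nnmf (fun _ : S => `|ln a| * a).
  by apply: nnmf_cst; rewrite mulr_ge0 ?(ltW a0).
have cstE (e : R) : (\int[P]_x e%:E = e%:E)%E.
  by rewrite integral_cst// [X in (_ * X)%E]probability_setT mule1.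
have : (\int[P]_x (hent (b x) + `|ln a| * b x + `|ln a| * a)%:E =
        \int[P]_x (a * hent (b x / a) + (`|ln a| + ln a) * b x + c)%:E)%E.
  apply: eq_integral => x _; congr EFin; rewrite (bregman_entropy a0 (b0 x)) /c.
  by move: (hent _) (hent _) `|ln a| (ln a) => ? ? ? ?; ring.
rewrite (integral_nnmfD _ (nnmf_add nhb nla) nd) (integral_nnmfD _ nhb nla).
rewrite (integral_nnmfD _ (nnmf_add nav nl) nc) (integral_nnmfD _ nav nl).
rewrite (integral_nnmfZ _ l0 nb) (integral_nnmfZ _ (normr_ge0 _) nb) !cstE ba.
have := integral_nnmf_ge0 P nav; have := integral_nnmf_ge0 P nhb.
move: (integral P setT (fun x => (hent (b x))%:E)) => h.
move: (integral P setT (fun x => (a * hent (b x / a))%:E)) => y.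
case: h => [h| |]//; last by move=> *; rewrite leey.
case: y => [y| |]// _ _; rewrite -!EFinM -!EFinD lee_fin /c => -[].
by move: (hent a) `|ln a| (ln a) => p q l; nra.
Qed.

Section splitting_entropy.
Context d (S : measurableType d) (R : realType) (mu : probability S R) (T : nat).
Variable sam : sampler mu T.
Variable r : S -> R.
Hypotheses (nr : nnmf r) (r1 : (\int[mu]_x (r x)%:E = 1)%E).
Local Notation g := (density_martingale sam r).
Let dg := density_process_martingale sam nr r1.
Let d1 := density_process_one sam.
Local Open Scope ereal_scope.

Let nstep s : nnmf (fun x => g s x * hent (ratio g s x))%R.
Proof.
apply: nnmf_mul; first exact: (dp_nnmf dg s).
exact: nnmf_hent (nnmf_ratio s dg).
Qed.

Let nhg s : nnmf (fun x => hent (g s x)).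
Proof. exact: nnmf_hent (dp_nnmf dg s). Qed.

(** One step of the chain rule: conditionally on the past, this is
    [bregman_integral]. *)
Lemma entropy_step s : (s < T)%N ->
  \int[mu]_x (hent (g s x))%:E + \int[mu]_x (g s x * hent (ratio g s x))%:E <=
  \int[mu]_x (hent (g s.+1 x))%:E.
Proof.
move=> sT; have ng := dp_nnmf dg s; have ng' := dp_nnmf dg s.+1.
have mn h (nh : nnmf h) := measurable_cexp_nnmf sam s nh.
have ce0 h x (nh : nnmf h) := cexp_nnmf_ge0 sam s nh x.
have intc h (nh : nnmf h) := esym (integral_cexp_nnmf sam s nh).
rewrite (intc _ (nstep s)) (intc _ (nhg s.+1)) -ge0_integralD//; first last.
- exact: mn (nstep s).
- by move=> x _; exact: ce0 (nstep s).
- exact: nnmf_EFin (nhg s).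
- by move=> x _; exact: nnmf_EFin_ge0 (nhg s).
apply: ae_ge0_le_integral => //.
- move=> x _; apply: adde_ge0; [exact: nnmf_EFin_ge0 (nhg s)|exact: ce0 (nstep s)].
- apply: emeasurable_funD; [exact: nnmf_EFin (nhg s)|exact: mn (nstep s)].
- by move=> x _; exact: ce0 (nhg s.+1).
- exact: mn (nhg s.+1).
apply: filterS (ae_cexp_density_martingale sam nr r1 sT) => x gx _.
have ag u : g s (Psi sam s x u) = g s x.
  by rewrite -(dp_adapted dg (ltnW sT) (Psi sam s x u)) tr_Psi (dp_adapted dg (ltnW sT)).
have [_ /(_ x) gs0] := ng.
have nb : nnmf (fun u : measurableTypeR R => g s.+1 (Psi sam s x u)).
  split=> [|u]; last by case: ng'.
  apply/measurable_EFinP; exact: (measurable_Psi2 sam s (nnmf_EFin ng') x).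
have := bregman_integral nb gs0 gx.
rewrite /cexp; set i1 := (X in _ + X <= _ -> _); set i2 := (X in _ -> _ + X <= _).
have -> // : i1 = i2 by apply: eq_integral => u _ /=; rewrite /ratio ag.
Qed.

Lemma entropy_sum : \sum_(s < T) \int[mu]_x (g s x * hent (ratio g s x))%:E <=
  \int[mu]_x (hent (r x))%:E.
Proof.
have h n : (n <= T)%N -> \sum_(s < n) \int[mu]_x (g s x * hent (ratio g s x))%:E <=
    \int[mu]_x (hent (g n x))%:E.
  elim: n => [|n IH] nT.
    by rewrite big_ord0; exact: integral_nnmf_ge0 (nhg 0%N).
  rewrite big_ord_recr /=; apply: le_trans (entropy_step nT).
  by apply: leeD => //; apply: IH; exact: ltnW.
by have := h T (leqnn T); rewrite density_martingale_full.
Qed.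

Local Notation one := (fun (_ : nat) (_ : S) => 1%R).
Local Notation M := (agree one g).

Lemma agree_one_le1 s x : (M s x <= 1)%R.
Proof. exact: (agree_le d1 dg). Qed.

(** [1 - M T] is the sum of the masses [M s * (1 - min 1 (ratio g s))] lost at
    each step. Their squares are bounded by Pinsker's inequality at each step,
    since [M s ^ 2 <= g s]; the Cauchy-Schwarz inequality for the sum costs the
    factor [T]. *)
Lemma separation_sqr x : ((1 - M T x) ^+ 2 <=
  (2 * T%:R) * \sum_(s < T) g s x * hent (ratio g s x))%R.
Proof.
have tel n : (1 - M n x = \sum_(s < n) M s x * (1 - Num.min 1 (ratio g s x)))%R.
  elim: n => [|n IH]; first by rewrite big_ord0 /agree big_ord0 subrr.
  rewrite big_ord_recr /= -IH agreeS /ratio divr1; ring.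
have sqs n (a : nat -> R) : ((\sum_(s < n) a s) ^+ 2 <= n%:R * \sum_(s < n) a s ^+ 2)%R.
  elim: n => [|n IH]; first by rewrite !big_ord0 expr2 !mul0r.
  case: n IH => [_|n IH].
    by rewrite !big_ord_recr !big_ord0 /= !add0r mul1r.
  rewrite big_ord_recr [in leRHS]big_ord_recr /=; move: IH.
  set A := (\sum_(_ < _) a _)%R; set B := (\sum_(_ < _) _ ^+ 2)%R; set p := n.+1%:R.
  move=> IH; rewrite -natr1 -/p; have p0 : (0 < p :> R)%R by rewrite ltr0n.
  rewrite -subr_ge0 -(pmulr_rge0 _ p0).
  have := sqr_ge0 (A - p * a n.+1)%R; move: IH; move: (a n.+1) => b.
  nra.
rewrite tel; apply: le_trans (sqs _ (fun s => M s x * (1 - Num.min 1 (ratio g s x)))%R) _.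
rewrite [in leRHS]mulrAC [in leRHS]mulrC; apply: ler_wpM2l => //.
rewrite mulr_sumr; apply: ler_sum => s _.
have [_ /(_ x) M0] := nnmf_agree d1 dg s.
have Mg : (M s x <= g s x)%R by rewrite agreeC; exact: (agree_le dg d1).
have M1 := agree_one_le1 s x; have [_ /(_ x) v0] := nnmf_ratio s dg.
have M2 : (M s x ^+ 2 <= g s x)%R.
  by apply: le_trans Mg; rewrite expr2 ler_piMr.
have hv : ((1 - Num.min 1 (ratio g s x)) ^+ 2 <= 2 * hent (ratio g s x))%R.
  have h0 := hent_ge0 v0; have := pinsker_pointwise v0.
  case: (leP 1%R (ratio g s x)) => [_ _|v1].
    by rewrite subrr expr0n/= mulr_ge0.
  rewrite -sqrrN opprB => h; apply: le_trans h _; apply: ler_wpM2r => //; lra.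
rewrite exprMn [leRHS]mulrCA; apply: ler_pM; [exact: sqr_ge0|exact: sqr_ge0|exact: M2|exact: hv].
Qed.

Section separated_mass.
Variables (phi : S -> R) (alpha E H : R).
Hypotheses (nphi : nnmf phi) (alpha0 : (0 < alpha)%R).
Hypothesis phiE : \int[mu]_x (expR (alpha * phi x ^+ 2))%:E = E%:E.
Hypothesis rH : \int[mu]_x (hent (r x))%:E = H%:E.

(** Cauchy-Schwarz between [phi] and [1 - M T], whose square has an integral
    bounded by the entropy through [separation_sqr] and [entropy_sum]. *)
Lemma separated_mass : \int[mu]_x (phi x * (1 - M T x))%:E <=
  (Num.sqrt (ln E / alpha) * Num.sqrt (2 * T%:R * H))%:E.
Proof.
have H0 := entropy_real_ge0 nr rH; have E1 := exp_moment_ge1 nphi alpha0 phiE.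
have n1M : nnmf (fun x => 1 - M T x)%R.
  have [mM _] := nnmf_agree d1 dg T.
  by split=> [|x]; [exact: measurable_funB|rewrite subr_ge0 agree_one_le1].
apply: (@cauchy_schwarz _ _ _ mu _ (fun x => phi x ^+ 2)%R (fun x => (1 - M T x) ^+ 2)%R).
- exact: nnmf_mul.
- exact: nnmf_exp.
- exact: nnmf_exp.
- by rewrite divr_ge0 ?ln_ge0// ltW.
- by rewrite !mulr_ge0.
- by move=> x; rewrite exprMn.
- exact: second_moment phiE.
have nsum : nnmf (fun x => \sum_(s < T) g s x * hent (ratio g s x))%R.
  by apply: nnmf_sum => s _; exact: nstep.
have T0 : (0 <= 2 * T%:R :> R)%R by rewrite mulr_ge0.
apply: (@le_trans _ _ (\int[mu]_x (2 * T%:R * \sum_(s < T) g s x * hent (ratio g s x))%:E)).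
  apply: le_integral_nnmf; [exact: nnmf_exp|by apply: nnmf_mul => //; exact: nnmf_cst|].
  exact: separation_sqr.
rewrite (integral_nnmfZ _ T0 nsum) [leRHS]EFinM; apply: lee_wpmul2l; first by rewrite lee_fin.
rewrite -rH; apply: le_trans entropy_sum.
under eq_integral do rewrite -sumEFin.
rewrite ge0_integral_sum//.
- by move=> s; exact: nnmf_EFin (nstep s).
- by move=> s x _; exact: nnmf_EFin_ge0 (nstep s).
Qed.

End separated_mass.

End splitting_entropy.

Section splitting_bound.
Context d (S : measurableType d) (R : realType) (mu : probability S R) (T : nat).
Variable sam : sampler mu T.
Variable r : S -> R.
Hypotheses (nr : nnmf r) (r1 : (\int[mu]_x (r x)%:E = 1)%E).
Local Notation g := (density_martingale sam r).
Let dg := density_process_martingale sam nr r1.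
Let d1 := density_process_one sam.
Local Notation one := (fun (_ : nat) (_ : S) => 1%R).
Local Notation M := (agree one g).
Local Notation tau := (gap sam one g).
Local Open Scope ereal_scope.

Lemma nnmf_splitting_gap s : nnmf (tau s).
Proof. exact: (nnmf_cexp sam s (nnmf_excess d1 dg s)). Qed.

Definition splitting_measure : {measure set (S * S) -> \bar R} :=
  splitting_measure_of d1 dg nnmf_splitting_gap.

Let ctau : common_gap sam one g tau := common_gap_gap d1 dg.

Lemma integral_splittingC F G : nnmf F -> nnmf G ->
  \int[splitting_measure]_z (F z.1 * G z.2)%:E = total_integral sam g one tau G F.
Proof.
move=> nF nG; rewrite (integral_splitting_rect d1 dg nnmf_splitting_gap nF nG).
exact: (total_integralC d1 dg ctau nF nG).
Qed.

Lemma integral_splitting_fst F : nnmf F ->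
  \int[splitting_measure]_z (F z.1)%:E = \int[mu]_x (F x)%:E.
Proof.
move=> nF; have n1 := nnmf1 S R.
under eq_integral do rewrite -[F _]mulr1.
rewrite (integral_splitting_rect d1 dg nnmf_splitting_gap nF n1).
rewrite (total_integral1 d1 dg ctau nF).
by under eq_integral do rewrite mulr1.
Qed.

Lemma integral_splitting_snd F : nnmf F ->
  \int[splitting_measure]_z (F z.2)%:E = \int[mu]_x (F x * r x)%:E.
Proof.
move=> nF; have n1 := nnmf1 S R.
under eq_integral do rewrite -[F _]mul1r.
rewrite (integral_splittingC n1 nF) (total_integral1 dg d1 (common_gapC ctau) nF).
by rewrite density_martingale_full.
Qed.

Section cost.
Variables (phi : S -> R) (alpha E H : R) (c : S * S -> R).
Hypotheses (nphi : nnmf phi) (alpha0 : (0 < alpha)%R).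
Hypothesis phiE : \int[mu]_x (expR (alpha * phi x ^+ 2))%:E = E%:E.
Hypothesis rH : \int[mu]_x (hent (r x))%:E = H%:E.
Hypotheses (nc : nnmf c) (cxx : forall x, c (x, x) = 0%R).
Hypothesis c_le : forall x y, (c (x, y) <= phi x + phi y)%R.

(** The paths that separate have, for the second marginal, the mass
    [r - M T <= |r - 1| + (1 - M T)], so the cost is at most
    [|r - 1| + 2 * (1 - M T)] integrated against [phi]. *)
Lemma splitting_cost_bound : \int[splitting_measure]_z (c z)%:E <=
  ((2 * Num.sqrt T%:R + 1) / Num.sqrt alpha * Num.sqrt (1 + ln E) *
   Num.sqrt (2 * H))%:E.
Proof.
have n1 := nnmf1 S R.
have nM := nnmf_agree d1 dg T; have [_ M0] := nM; have [mphi p0] := nphi.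
have H0 := entropy_real_ge0 nr rH; have E1 := exp_moment_ge1 nphi alpha0 phiE.
have n1M : nnmf (fun x => 1 - M T x)%R.
  have [mM _] := nM.
  by split=> [|x]; [exact: measurable_funB|rewrite subr_ge0 (agree_one_le1 sam nr r1)].
have npM : nnmf (fun x => phi x * M T x)%R by exact: nnmf_mul.
have np1M : nnmf (fun x => phi x * (1 - M T x))%R by exact: nnmf_mul.
have nab : nnmf (fun x => phi x * `|r x - 1|)%R.
  apply: nnmf_mul => //; have [mr _] := nr.
  by split=> [|x//]; apply: measurableT_comp => //; exact: measurable_funB.
pose X := \sum_(s < T) split_integral sam one g tau s phi (fun=> 1%R).
pose Y := \sum_(s < T) split_integral sam one g tau s (fun=> 1%R) phi.
apply: (@le_trans _ _ (X + Y)).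
  exact: (splitting_cost d1 dg nnmf_splitting_gap nc nphi cxx c_le).
pose A := \int[mu]_x (phi x * M T x)%:E.
have Afin : A \is a fin_num.
  rewrite ge0_fin_numE; last exact: integral_nnmf_ge0.
  apply: (@le_lt_trans _ _ (\int[mu]_x (phi x)%:E)).
    apply: le_integral_nnmf => // x; rewrite ler_piMr// (agree_one_le1 sam nr r1)//.
  exact: le_lt_trans (first_moment nphi alpha0 phiE) (ltry _).
have AX : A + X = \int[mu]_x (phi x)%:E.
  have := total_integral1 d1 dg ctau nphi; rewrite /total_integral.
  under eq_integral do rewrite mul1r.
  by under [in RHS]eq_integral do rewrite mulr1.
have X1 : X = \int[mu]_x (phi x * (1 - M T x))%:E.
  rewrite -(addeK X Afin) -(addeK (\int[mu]_x (phi x * (1 - M T x))%:E) Afin).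
  congr (_ - _); rewrite addeC AX -(integral_nnmfD _ np1M npM).
  by apply: eq_integral => x _; congr EFin; ring.
have AY : A + Y = \int[mu]_x (phi x * r x)%:E.
  rewrite -(integral_splitting_snd nphi).
  under [RHS]eq_integral do rewrite -[phi _]mul1r.
  rewrite (integral_splitting_rect d1 dg nnmf_splitting_gap n1 nphi).
  rewrite /total_integral; congr (_ + _).
  by apply: eq_integral => x _; rewrite mul1r.
have YX : Y <= \int[mu]_x (phi x * `|r x - 1|)%:E + X.
  rewrite -(leeD2lE _ _ Afin) AY addeCA AX -(integral_nnmfD _ nab nphi).
  apply: le_integral_nnmf; [exact: nnmf_mul|exact: nnmf_add|move=> x].
  have -> : (phi x * `|r x - 1| + phi x = phi x * (`|r x - 1| + 1))%R by ring.
  by apply: ler_wpM2l => //; have := ler_norm (r x - 1); lra.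
have P1 := weighted_pinsker nphi alpha0 phiE nr r1 rH.
have X2 := separated_mass sam nr r1 nphi alpha0 phiE rH.
rewrite -X1 in X2.
apply: (@le_trans _ _ (X + (\int[mu]_x (phi x * `|r x - 1|)%:E + X))).
  exact: leeD.
apply: le_trans (leeD X2 (leeD P1 X2)) _.
rewrite -!EFinD lee_fin.
set a := Num.sqrt (2 * H); set L := ln E.
have L0 : (0 <= L)%R by exact: ln_ge0.
have -> : (Num.sqrt (2 * T%:R * H) = Num.sqrt T%:R * a)%R.
  by rewrite -sqrtrM// mulrCA mulrA.
have -> : (Num.sqrt ((1 + L) / alpha) = Num.sqrt (1 + L) / Num.sqrt alpha)%R.
  by rewrite sqrtrM ?addr_ge0// sqrtrV// (ltW alpha0).
have h : (Num.sqrt (L / alpha) <= Num.sqrt (1 + L) / Num.sqrt alpha)%R.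
  rewrite sqrtrM// sqrtrV ?(ltW alpha0)//; apply: ler_wpM2r; first by rewrite invr_ge0.
  by rewrite ler_sqrt ?lerDr// addr_ge0.
have Ta : (0 <= Num.sqrt T%:R * a)%R by apply: mulr_ge0; exact: sqrtr_ge0.
have := ler_wpM2r Ta h.
move: (Num.sqrt (L / _)) (Num.sqrt (1 + L)) (Num.sqrt T%:R) ((Num.sqrt alpha)^-1)%R.
by move=> p q t v; lra.
Qed.

End cost.

End splitting_bound.

(** * Bicausal couplings from causal kernels *)

Lemma integral_indic_nnmf d (S : measurableType d) (R : realType)
    (m : {measure set S -> \bar R}) (B : set S) (f : S -> R) : measurable B ->
  (\int[m]_(x in B) (f x)%:E = \int[m]_x (\1_B x * f x)%:E)%E.
Proof.
move=> mB; rewrite integral_mkcond; apply: eq_integral => x _.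
by rewrite epatch_indic EFinM muleC.
Qed.

Lemma integral_absolutely_continuous d (S : measurableType d) (R : realType)
    (mu nu : {measure set S -> \bar R}) (r : S -> R) : nnmf r ->
  (forall A, measurable A -> nu A = \int[mu]_(x in A) (r x)%:E)%E ->
  forall h : S -> R, nnmf h ->
  (\int[nu]_x (h x)%:E = \int[mu]_x (h x * r x)%:E)%E.
Proof.
move=> nr nuE h nh; transitivity (\int[density_measure mu nr]_x (h x)%:E)%E.
  by apply: eq_measure_integral => A mA _; exact: nuE.
have h0 x : (0 <= (EFin \o h) x)%E by exact: (nnmf_EFin_ge0 x nh).
rewrite (ge0_integral_density _ nr (nnmf_EFin nh) h0).
by apply: eq_integral => x _; rewrite -EFinM mulrC.
Qed.

(** The defining property of a conditional probability, extended from events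
    to nonnegative test variables. *)
Lemma conditional_probability_test d d' (S : measurableType d)
    (S' : measurableType d') (R : realType) (m : probability S R)
    (p : S -> S') (B : set S) : measurable_fun setT p -> measurable B ->
  exists l : S' -> R, nnmf l /\ forall G : S' -> R, nnmf G ->
    (\int[m]_x (G (p x) * l (p x))%:E = \int[m]_(x in B) (G (p x))%:E)%E.
Proof.
move=> mp mB; pose pm : {mfun S >-> S'} := mfun_Sub (mem_set mp).
have [l [ml l01 lE]] := conditional_probability m pm mB.
have nl : nnmf l by split => // y; have /andP[] := l01 y.
have nB : nnmf (\1_B : S -> R) by exact: nnmf_indic.
exists l; split => // G nG.
pose m1 := image_measure (density_measure m nB) mp.
pose m2 := density_measure (image_measure m mp) nl.
have mG : measurable_fun setT (EFin \o G) := nnmf_EFin nG.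
have G0 y : (0 <= (EFin \o G) y)%E by exact: nnmf_EFin_ge0 nG.
transitivity (\int[m2]_y (G y)%:E)%E.
  rewrite (ge0_integral_density _ nl mG G0) ge0_integral_image.
  - by apply: eq_integral => x _; rewrite -EFinM mulrC.
  - by exact: nnmf_EFin (nnmf_mul nl nG).
  - by move=> y; exact: nnmf_EFin_ge0 (nnmf_mul nl nG).
transitivity (\int[m1]_y (G y)%:E)%E; last first.
  rewrite (ge0_integral_image _ mp mG G0) (integral_indic_nnmf m _ mB).
  have mGp : measurable_fun setT (fun x => (G (p x))%:E).
    exact: nnmf_EFin (nnmf_comp nG mp).
  by rewrite (ge0_integral_density _ nB mGp (fun x => G0 (p x))).
apply: eq_measure_integral => A mA _.
rewrite /m2 /m1 /= /density_measure /image_measure /pushforward /=.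
have mpA := measurable_preimage mp mA.
rewrite ge0_integral_pushforward//.
- by rewrite integral_indic// setIC; exact: (lE A mA).
- by apply: measurable_funTS; exact: nnmf_EFin nl.
- by move=> y _; exact: (nnmf_EFin_ge0 y nl).
Qed.

Section past_sigma_algebra.
Context {R : realType} {T : nat} {X : 'I_T -> ptopologicalType}.
Local Notation S := (path_space X).
Hypothesis Xpol : forall t, polish R (X t).
Context d (Om : measurableType d).
Variable Z : Om -> borel S.
Local Notation past t := [set i : 'I_T | (i < t)%N].

Lemma coord_sigma_preimage (J : set 'I_T) (p : S -> S) E :
  (forall i x, J i -> p x i = x i) -> coord_sigma Z J E ->
  exists2 B : set (borel S), measurable B & E = (fun w => p (Z w)) @^-1` B.
Proof.
move=> pJ; pose q w : borel S := p (Z w).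
suff h : coord_sigma Z J `<=` preimage_set_system setT q measurable.
  by move=> /h[B mB <-]; exists B => //; rewrite setTI.
apply: smallest_sub.
  apply: sigma_algebra_preimage; exact: sigma_algebra_measurable.
move=> _ [i Ji [B mB <-]]; exists ((fun x : borel S => x i) @^-1` B).
  exact: (measurable_preimage (@measurable_coord _ _ i) mB).
by rewrite !setTI; apply/seteqP; split=> w; rewrite /q /= pJ.
Qed.

Lemma coord_sigma_past t E : coord_sigma Z (past t) E ->
  exists2 B : set (borel S), measurable B & E = (fun w => trunc t (Z w)) @^-1` B.
Proof.
by apply: coord_sigma_preimage => i x /= it; rewrite /trunc /splice it.
Qed.

Lemma coord_sigma_full E : coord_sigma Z setT E ->
  exists2 B : set (borel S), measurable B & E = Z @^-1` B.
Proof. exact: (coord_sigma_preimage (p := id)). Qed.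

Lemma past_coord_sigma t (B : set (borel S)) : measurable B ->
  coord_sigma Z (past t) ((fun w => trunc t (Z w)) @^-1` B).
Proof.
move=> mB.
have [C bC] := polish_bases Xpol.
pose G : set (set Om) := \bigcup_(i in past t)
  preimage_set_system setT (fun w => (Z w i : borel (X i))) measurable.
have mp : measurable_fun setT
    ((fun w => trunc t (Z w)) : g_sigma_algebraType G -> borel S).
  apply: (measurable_fun_path bC) => i; rewrite /trunc /splice.
  case: ltnP => it; last exact: measurable_cst.
  move=> _ D mD; apply: sub_sigma_algebra; exists i => //; exists D => //.
by have := mp measurableT B mB; rewrite setTI.
Qed.

End past_sigma_algebra.

Section causality.
Context {R : realType} {T : nat} {X : 'I_T -> ptopologicalType}.
Local Notation S := (path_space X).
Hypothesis Xpol : forall t, polish R (X t).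
Context d (Om : measurableType d) (pi : probability Om R).
Variables (Z : Om -> borel S) (m : probability (borel S) R).
Hypotheses (mZ : measurable_fun setT Z).
Hypothesis lawZ : forall B, measurable B -> pi (Z @^-1` B) = m B.
Local Notation past t := [set i : 'I_T | (i < t)%N].
Local Open Scope ereal_scope.

Let integral_law_on (h : borel S -> R) A : nnmf h -> measurable A ->
  \int[pi]_(w in Z @^-1` A) (h (Z w))%:E = \int[m]_(x in A) (h x)%:E.
Proof.
move=> nh mA.
have mZA := measurable_preimage mZ mA.
have nA : nnmf (\1_A : borel S -> R) by exact: nnmf_indic.
rewrite (integral_indic_nnmf pi _ mZA) (integral_indic_nnmf m _ mA).
pose k x := (\1_A x * h x)%R; have nk : nnmf k by exact: nnmf_mul.
exact: (integral_law mZ lawZ nk).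
Qed.

(** An event whose conditional probability given the whole path [Z] is a
    function of the past of [Z] is conditionally independent of [Z] given that
    past. *)
Lemma cond_indep_past t (F : set (set Om)) :
  (forall E, F E -> measurable E /\ exists k : S -> R,
    [/\ nnmf (k : borel S -> R), forall x, k (trunc t x) = k x &
        forall B : set (borel S), measurable B ->
          pi (Z @^-1` B `&` E) = \int[m]_(x in B) (k x)%:E]) ->
  cond_indep pi F (coord_sigma Z setT) (coord_sigma Z (past t)).
Proof.
move=> hF E D FE /coord_sigma_full[B mB ->].
have [mE [k [nk kt kE]]] := hF E FE.
have mt := measurable_trunc Xpol t.
have [l [nl lE]] := conditional_probability_test m mt mB.
pose lt x := l (trunc t x).
have nlt : nnmf (lt : borel S -> R) := nnmf_comp nl mt.
have n1 := nnmf1 (borel S) R.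
have ltE (k' : S -> R) (A : set (borel S)) : nnmf (k' : borel S -> R) -> (forall x : S, k' (trunc t x) = k' x) ->
    measurable A -> (forall x, A (trunc t x) = A x) ->
    \int[m]_(x in A) (k' x * lt x)%:E = \int[m]_(x in B `&` A) (k' x)%:E.
  move=> nk' kt' mA At; have nA : nnmf (\1_A : borel S -> R) by exact: nnmf_indic.
  have Akt x : (\1_A (trunc t x) * k' (trunc t x) = \1_A x * k' x :> R)%R.
    by rewrite kt' !indicE; congr ((_ : bool)%:R * _)%R; apply/idP/idP;
      rewrite !inE At.
  rewrite (integral_indic_nnmf m _ mA).
  rewrite (integral_indic_nnmf m _ (measurableI _ _ mB mA)).
  transitivity (\int[m]_(x in B) (\1_A (trunc t x) * k' (trunc t x))%:E).
    rewrite -(lE _ (nnmf_mul nA nk')); apply: eq_integral => x _; congr EFin.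
    by rewrite /= Akt mulrA.
  rewrite (integral_indic_nnmf m _ mB); apply: eq_integral => x _; congr EFin.
  by rewrite Akt mulrA !indicE in_setI -mulnb natrM.
have mZi A (mA : measurable A) := measurable_preimage mZ mA.
have version (D' : set Om) (h : S -> R) : measurable D' -> nnmf (h : borel S -> R) ->
    (forall x, h (trunc t x) = h x) ->
    (forall A : set (borel S), measurable A -> (forall x, A (trunc t x) = A x) ->
       pi (Z @^-1` A `&` D') = \int[m]_(x in A) (h x)%:E) ->
    is_cond_exp pi (coord_sigma Z (past t)) \1_D' (h \o Z).
  move=> mD nh ht hE; split.
  - move=> A mA; have -> : (h \o Z) @^-1` A =
        (fun w => trunc t (Z w)) @^-1` (h @^-1` A).
      by apply/seteqP; split=> w; rewrite /preimage /= ht.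
    apply: past_coord_sigma => //; have [mh _] := nh.
    exact: (measurable_preimage mh mA).
  - have nhZ : nnmf (h \o Z) := nnmf_comp nh mZ.
    apply/integrableP; split; first exact: nnmf_EFin nhZ.
    rewrite (eq_integral (fun w => (h (Z w))%:E)); last first.
      by move=> w _; rewrite gee0_abs//; exact: (nnmf_EFin_ge0 w nhZ).
    rewrite -(preimage_setT Z) (integral_law_on nh measurableT) -(hE _ measurableT)//.
    apply: le_lt_trans (ltry 1); apply: probability_le1.
    by apply: measurableI => //; exact: mZi.
  - move=> _ /coord_sigma_past[A mA ->].
    have -> : (fun w => trunc t (Z w)) @^-1` A = Z @^-1` (trunc t @^-1` A) by [].
    have mtA := measurable_preimage mt mA.
    rewrite (integral_law_on nh mtA) -hE//; last first.
      by move=> x; rewrite /preimage /= trunc_trunc minnn.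
    by rewrite (integral_indic _ (mZi _ mtA) mD) setIC.
exists (k \o Z), (lt \o Z); split.
- by apply: version => // A mA _; exact: kE.
- apply: version; [exact: mZi|exact: nlt|by move=> x; rewrite /lt trunc_trunc minnn|].
  move=> A mA At; rewrite -preimage_setI lawZ; last exact: measurableI.
  rewrite setIC; under eq_integral do rewrite -[lt _]mul1r.
  by rewrite (ltE _ A n1)// integral_one//; exact: measurableI.
- apply: (version (E `&` Z @^-1` B) (fun x => k x * lt x)%R).
  + by apply: measurableI => //; exact: mZi.
  + exact: nnmf_mul.
  + by move=> x; rewrite kt /lt trunc_trunc minnn.
  + move=> A mA At; rewrite (ltE k A)// -kE; last exact: measurableI.
    by congr (pi _); apply/seteqP; split=> [w [Aw [Ew Bw]]|w [[Bw Aw] Ew]].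
Qed.

End causality.

Section unit_mass.
Context d (S : measurableType d) (R : realType) (m : {measure set S -> \bar R}).

Definition unit_mass_measure of m setT = 1%E : set S -> \bar R := m.
Variable m1 : m setT = 1%E.
Local Notation p := (unit_mass_measure m1).
Let p0 : p set0 = 0%E. Proof. exact: measure0. Qed.
Let p_ge0 A : (0 <= p A)%E. Proof. exact: measure_ge0. Qed.
Let p_additive : semi_sigma_additive p. Proof. exact: measure_semi_sigma_additive. Qed.
HB.instance Definition _ := isMeasure.Build _ _ _ p p0 p_ge0 p_additive.
HB.instance Definition _ := Measure_isProbability.Build _ _ _ p m1.

Definition unit_mass_probability : probability S R := p.

End unit_mass.

Section splitting_coupling.
Context {R : realType} {T : nat} {X : 'I_T -> ptopologicalType}.
Local Notation S := (path_space X).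
Hypothesis Xpol : forall t, polish R (X t).
Variables mu nu : probability (borel S) R.
Variable r : borel S -> R.
Hypotheses (nr : nnmf r).
Hypothesis nuE : forall A : set (borel S), measurable A ->
  nu A = (\int[mu]_(x in A) (r x)%:E)%E.
Local Open Scope ereal_scope.

Lemma path_sampler : exists sam : sampler mu T, forall t x, tr sam t x = trunc t x.
Proof.
have h t := conditional_sampler Xpol mu t.
have [Psi hPsi] := choice h.
have m1 t := measurable_trunc Xpol t.
have m2 s t (x : borel S) := trunc_trunc s t x.
have m3 (x : borel S) := trunc_full x.
have m4 (x y : borel S) : trunc 0 x = trunc 0 y.
  by apply: functional_extensionality_dep => i.
have h1 t := let: And4 a _ _ _ := hPsi t in a.
have h2 t := let: And4 _ a _ _ := hPsi t in a.
have h3 t := let: And4 _ _ a _ := hPsi t in a.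
have h4 t := let: And4 _ _ _ a := hPsi t in a.
by exists (@Sampler _ (borel S) R mu T (fun t => trunc t) Psi m1 m2 m3 m4 h1 h2 h3 h4).
Qed.

Variable sam : sampler mu T.
Hypothesis trE : forall t x, tr sam t x = trunc t x.

Lemma integral_density1 : \int[mu]_x (r x)%:E = 1.
Proof. by rewrite -nuE//; exact: probability_setT. Qed.
Local Notation r1 := integral_density1.
Local Notation g := (density_martingale sam r).
Local Notation one := (fun (_ : nat) (_ : borel S) => 1%R).
Let dg := density_process_martingale sam nr r1.
Let d1 := density_process_one sam.
Let ctau := common_gap_gap d1 dg.
Local Notation m := (splitting_measure sam nr r1).

Lemma measurable_identity_pair : measurable_fun setT
  ((fun z => (z.1, z.2)) : borel S * borel S -> borel (S * S)%type).
Proof.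
have [C bC] := polish_bases Xpol.
have [D [bD _]] := countable_base_path bC.
exact: (measurable_fun_borel_pair bD bD measurable_fst measurable_snd).
Qed.

(** The splitting measure lives on the product sigma-algebra, couplings on the
    Borel sets of the topological product. *)
Local Notation topological_splitting := (image_measure m measurable_identity_pair).

Let total1 : topological_splitting setT = 1.
Proof.
have n1 := nnmf1 (borel S) R.
rewrite -(integral_one topological_splitting measurableT).
rewrite ge0_integral_image//.
by rewrite (integral_splitting_fst sam nr r1 n1) integral_prob1.
Qed.

Definition splitting_coupling : probability (borel (S * S)%type) R :=
  unit_mass_probability total1.

Lemma integral_splitting_coupling (H : S * S -> R) :
  nnmf (H : borel (S * S)%type -> R) ->
  \int[splitting_coupling]_z (H z)%:E = \int[m]_z (H z)%:E.
Proof.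
move=> nH; rewrite ge0_integral_image.
- by apply: eq_integral => -[x y].
- exact: measurable_identity_pair.
- exact: nnmf_EFin nH.
- by move=> y; exact: nnmf_EFin_ge0 nH.
Qed.

Lemma splitting_coupling_rect (A B : set (borel S)) : measurable A -> measurable B ->
  splitting_coupling (fst @^-1` A `&` snd @^-1` B) =
  total_integral sam one g (gap sam one g) \1_A \1_B.
Proof.
move=> mA mB.
have nA : nnmf (\1_A : borel S -> R) by exact: nnmf_indic.
have nB : nnmf (\1_B : borel S -> R) by exact: nnmf_indic.
rewrite -(integral_splitting_rect d1 dg (nnmf_splitting_gap sam nr r1) nA nB).
have mf := measurable_preimage (@measurable_borel_fst S S) mA.
have ms := measurable_preimage (@measurable_borel_snd S S) mB.
rewrite -(integral_one splitting_coupling (measurableI _ _ mf ms)).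
rewrite (integral_indic_nnmf _ _ (measurableI _ _ mf ms)).
rewrite (integral_splitting_coupling (H := fun z => (\1_(fst @^-1` A `&` snd @^-1` B) z * 1)%R)).
  apply: eq_integral => -[x y] _; congr EFin.
  by rewrite mulr1 !indicE in_setI -mulnb natrM.
by apply: nnmf_mul; [apply: nnmf_indic; exact: measurableI|exact: nnmf_cst].
Qed.

End splitting_coupling.

Section bicausality.
Context {R : realType} {T : nat} {X : 'I_T -> ptopologicalType}.
Local Notation S := (path_space X).
Hypothesis Xpol : forall t, polish R (X t).
Variables mu nu : probability (borel S) R.
Variable r : borel S -> R.
Hypotheses (nr : nnmf r).
Hypothesis nuE : forall A : set (borel S), measurable A ->
  nu A = (\int[mu]_(x in A) (r x)%:E)%E.
Variable sam : sampler mu T.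
Hypothesis trE : forall t x, tr sam t x = trunc t x.
Local Open Scope ereal_scope.

Let r1 := integral_density1 nuE.
Local Notation g := (density_martingale sam r).
Local Notation one := (fun (_ : nat) (_ : borel S) => 1%R).
Let dg := density_process_martingale sam nr r1.
Let d1 := density_process_one sam.
Let ctau := common_gap_gap d1 dg.
Local Notation pi := (splitting_coupling Xpol nr nuE sam).
Local Notation tau := (gap sam one g).

Let nI (A : set (borel S)) : measurable A -> nnmf (\1_A : borel S -> R).
Proof. exact: nnmf_indic. Qed.

Let setTE : (\1_[set: borel S] : borel S -> R) = fun=> 1%R.
Proof. by apply/funext => x; rewrite indicE in_setT. Qed.

Lemma splitting_coupling_coupling : coupling mu nu pi.
Proof.
move=> A mA; rewrite /pushforward; split.
- rewrite -[_ @^-1` A]setIT -[X in _ `&` X](preimage_setT snd).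
  rewrite (splitting_coupling_rect Xpol nr nuE sam mA measurableT) setTE.
  rewrite (total_integral1 d1 dg ctau (nI mA)) -(integral_one mu mA).
  by rewrite (integral_indic_nnmf mu _ mA).
- rewrite -[_ @^-1` A]setTI -[X in X `&` _](preimage_setT fst).
  rewrite (splitting_coupling_rect Xpol nr nuE sam measurableT mA) setTE.
  rewrite (total_integralC d1 dg ctau (nnmf_cst _ ler01) (nI mA)).
  rewrite (total_integral1 dg d1 (common_gapC ctau) (nI mA)).
  by rewrite density_martingale_full (nuE mA) (integral_indic_nnmf mu _ mA).
Qed.

(** Each direction is the causality of [total_integral], the second one after
    exchanging the two paths. *)
Lemma splitting_coupling_bicausal : bicausal mu nu pi.
Proof.
split; first exact: splitting_coupling_coupling.
move=> t /andP[_ tT] past.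
have mfst A (mA : measurable A) := measurable_preimage (@measurable_borel_fst S S) mA.
have msnd A (mA : measurable A) := measurable_preimage (@measurable_borel_snd S S) mA.
have mt A (mA : measurable A) := measurable_preimage (measurable_trunc Xpol t) mA.
have aI (A : set (borel S)) :
    adapted sam t (\1_(trunc t @^-1` A) : borel S -> R).
  by move=> x; rewrite trE !indicE; congr (nat_of_bool _)%:R;
    apply/idP/idP; rewrite !inE /preimage /= trunc_trunc minnn.
have I1 (A : set (borel S)) x : (\1_A x <= 1 :> R)%R.
  by rewrite indicE; case: (_ \in _).
split.
- apply: (cond_indep_past Xpol (m := mu)); first exact: measurable_borel_fst.
    by move=> A mA; have [] := splitting_coupling_coupling mA.
  move=> E Epast; have [A mA ->] := @coord_sigma_past _ _ _ (borel (S * S)%type) snd t E Epast.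
  split; first exact: (msnd _ (mt _ mA)).
  have [k [nk ak kE]] := total_integral_causal d1 dg ctau (ltnW tT)
    (nI (mt _ mA)) (I1 _) (aI A).
  exists k; split => // [x|B mB]; first by rewrite -trE ak.
  rewrite [LHS](splitting_coupling_rect Xpol nr nuE sam mB (mt _ mA)).
  rewrite (kE _ (nI mB)) (integral_indic_nnmf mu _ mB).
  by apply: eq_integral => x _; rewrite mulr1.
- apply: (cond_indep_past Xpol (m := nu)); first exact: measurable_borel_snd.
    by move=> A mA; have [] := splitting_coupling_coupling mA.
  move=> E Epast; have [A mA ->] := @coord_sigma_past _ _ _ (borel (S * S)%type) fst t E Epast.
  split; first exact: (mfst _ (mt _ mA)).
  have [k [nk ak kE]] := total_integral_causal dg d1 (common_gapC ctau) (ltnW tT)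
    (nI (mt _ mA)) (I1 _) (aI A).
  exists k; split => // [x|B mB]; first by rewrite -trE ak.
  rewrite setIC [LHS](splitting_coupling_rect Xpol nr nuE sam (mt _ mA) mB).
  rewrite (total_integralC d1 dg ctau (nI (mt _ mA)) (nI mB)) (kE _ (nI mB)).
  rewrite (integral_indic_nnmf nu _ mB).
  rewrite (integral_absolutely_continuous nr nuE (nnmf_mul (nI mB) nk)).
  by rewrite density_martingale_full; apply: eq_integral => x _; rewrite mulrA.
Qed.

End bicausality.

(** * The adapted transport bound for absolutely continuous perturbations *)

Section metric_measurability.
Context {R : realType} {S : ptopologicalType} (d : S -> S -> R).
Hypotheses (dm : is_metric d) (dz : metrizes d).

Let ball_nbhs x e : 0 < e -> nbhs x [set y | d x y < e].
Proof. by move=> e0; apply/dz; exists e. Qed.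

Let quadrangle x y x' y' : `|d x y - d x' y'| <= d x x' + d y y'.
Proof.
case: dm => _ dC dT.
have h1 := dT x x' y; have h2 := dT x' y' y; have h3 := dT x' x y'; have h4 := dT x y y'.
by rewrite ler_norml (dC y' y) in h2 *; rewrite (dC x' x) in h3; apply/andP; split; lra.
Qed.

Lemma measurable_metric :
  measurable_fun setT ((fun z => d z.1 z.2) : borel (S * S)%type -> R).
Proof.
apply: measurable_fun_to_real; apply/continuousP => -[x y].
apply/cvgrPdist_lt => e e0 /=.
have e20 : 0 < e / 2 by rewrite divr_gt0.
exists ([set z | d x z < e / 2], [set z | d y z < e / 2]).
  by split => /=; exact: ball_nbhs.
move=> -[x' y'] [/= hx hy]; apply: le_lt_trans (quadrangle x y x' y') _.
by rewrite (splitr e) ltrD.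
Qed.

Lemma measurable_metric_to x0 : measurable_fun setT ((fun x => d x x0) : borel S -> R).
Proof.
apply: measurable_fun_to_real; apply/continuousP => x; apply/cvgrPdist_lt => e e0 /=.
apply: filterS (ball_nbhs x e0) => x' /= hx.
by apply: le_lt_trans (quadrangle x x0 x' x0) _; rewrite (metric_xx dm) addr0.
Qed.

Lemma nnmf_metric_to x0 : nnmf ((fun x => d x x0) : borel S -> R).
Proof. by split=> [|x]; [exact: measurable_metric_to|exact: metric_ge0 dm _ _]. Qed.

End metric_measurability.

Section adapted_bound.
Context {R : realType} {T : nat} {X : 'I_T -> ptopologicalType}.
Local Notation S := (path_space X).
Hypothesis Xpol : forall t, polish R (X t).
Variable d : S -> S -> R.
Hypotheses (dm : is_metric d) (dz : metrizes d).
Variables mu nu : probability (borel S) R.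
Local Open Scope ereal_scope.

Lemma AW1_density_bound (r : borel S -> R) (x0 : S) (alpha E H : R) :
  nnmf r -> (forall A : set (borel S), measurable A -> nu A = \int[mu]_(x in A) (r x)%:E) ->
  (0 < alpha)%R -> \int[mu]_x (expR (alpha * d x x0 ^+ 2))%:E = E%:E ->
  \int[mu]_x (hent (r x))%:E = H%:E ->
  AW1 d mu nu <= ((2 * Num.sqrt T%:R + 1) / Num.sqrt alpha *
    Num.sqrt (1 + ln E) * Num.sqrt (2 * H))%:E.
Proof.
move=> nr nuE alpha0 phiE rH; have [sam trE] := path_sampler Xpol mu.
pose r1 := integral_density1 nuE.
pose pi := splitting_coupling Xpol nr nuE sam.
have nc : nnmf ((fun z => d z.1 z.2) : borel (S * S)%type -> R).
  by split=> [|z]; [exact: measurable_metric|exact: metric_ge0].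
have nc2 : nnmf ((fun z => d z.1 z.2) : borel S * borel S -> R).
  exact: (nnmf_comp nc (measurable_identity_pair Xpol)).
apply: (@le_trans _ _ (transport_cost d pi)).
  by apply: ereal_inf_lbound; exists pi => //; exact: splitting_coupling_bicausal.
rewrite /transport_cost /pi (integral_splitting_coupling Xpol nr nuE sam nc).
have cxx (x : borel S) : (d (x, x).1 (x, x).2 = 0)%R by rewrite metric_xx.
have c_le (x y : borel S) : (d (x, y).1 (x, y).2 <= d x x0 + d y x0)%R.
  by case: dm => _ dC dT; rewrite /= (dC y x0); exact: dT.
exact: (splitting_cost_bound sam nr r1 (nnmf_metric_to dm dz x0) alpha0 phiE rH
  nc2 cxx c_le).
Qed.

End adapted_bound.

(** * Relative entropy as the integral of [hent] *)

Section relative_entropy.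
Context d (S : measurableType d) (R : realType) (mu nu : probability S R).
Local Open Scope charge_scope.
Local Open Scope ereal_scope.

Section from_density.
Variable r : S -> R.
Hypothesis nr : nnmf r.
Hypothesis nuE : forall A, measurable A -> nu A = \int[mu]_(x in A) (r x)%:E.

Lemma density_dominates : nu `<< mu.
Proof.
apply/null_content_dominatesP => A mA muA; rewrite nuE//.
apply: null_set_integral => //; exact: measurable_funTS (nnmf_EFin nr).
Qed.

Let dd := 'd (charge_of_finite_measure nu) '/d mu.

Let dd_r : {ae mu, forall x, dd x = (r x)%:E}.
Proof.
have nm := density_dominates.
have r_int : mu.-integrable setT (EFin \o r).
  apply/integrableP; split; first exact: nnmf_EFin.
  rewrite (eq_integral (fun x => (r x)%:E)); last first.
    by move=> x _; rewrite gee0_abs//; exact: nnmf_EFin_ge0 nr.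
  rewrite -nuE//; apply: le_lt_trans (ltry 1); exact: probability_le1.
have : ae_eq mu setT dd (EFin \o r).
  apply: integral_ae_eq => //.
  - exact: Radon_Nikodym_integrable.
  - exact: nnmf_EFin.
  - move=> A _ mA; rewrite -nuE// -[RHS]/(charge_of_finite_measure nu A).
    by rewrite (Radon_Nikodym_integral (nu := charge_of_finite_measure nu) nm mA).
by apply: filterS => x /(_ I).
Qed.

(** The negative part of [r * ln r] is bounded by 1, so subtracting it is
    legitimate; [- r + 1] integrates to 0. *)
Lemma rel_entropy_density : rel_entropy nu mu = \int[mu]_x (hent (r x))%:E.
Proof.
have nm := density_dominates; have [mr r0] := nr.
rewrite /rel_entropy; case: asboolP => // _.
have mdd : measurable_fun setT dd by apply: measurable_int; exact: Radon_Nikodym_integrable.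
have ddfin x : dd x \is a fin_num by exact: Radon_Nikodym_fin_num.
pose p x := Num.max (ln (r x)) 0%R; pose q x := Num.max (- ln (r x))%R 0%R.
have mln : measurable_fun setT (fun x => ln (r x)).
  exact: (measurableT_comp (@measurable_ln R) mr).
have np : nnmf p.
  by split=> [|x]; [apply: measurable_maxr|rewrite le_max lexx orbT].
have nq : nnmf q.
  split=> [|x]; last by rewrite le_max lexx orbT.
  by apply: measurable_maxr => //; apply: measurableT_comp.
have pos_r : {ae nu, forall x, (0 < r x)%R}.
  have mr0 : measurable [set x | r x = 0%R].
    exact: (measurable_preimage mr (measurable_set1 0%R)).
  exists [set x | r x = 0%R]; split => //.
    rewrite nuE//; apply: integral0_eq => x /= rx; by rewrite rx.
  by move=> x /= /negP; rewrite lt_neqAle r0 andbT negbK => /eqP.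
have dd_r_nu : {ae nu, forall x, dd x = (r x)%:E}.
  have : ae_eq nu setT dd (EFin \o r).
    by apply: (null_dominates_ae_eq measurableT nm); apply: filterS dd_r => x ->.
  by apply: filterS => x /(_ I).
transitivity (\int[nu]_x (ln (r x))%:E).
  apply: ae_eq_integral => //.
  - rewrite (_ : (fun x => lne (dd x)) =
      fun x => if (fine (dd x) <= 0)%R then -oo else (ln (fine (dd x)))%:E).
      apply: measurable_fun_ifT => //.
        apply: measurable_fun_ler => //; exact: measurableT_comp.
      apply/measurable_EFinP; apply: (measurableT_comp (@measurable_ln R)).
      exact: measurableT_comp.
    by apply/funext => x; rewrite -[in LHS](fineK (ddfin x)).
  - exact/measurable_EFinP.
  - by apply: filterS2 pos_r dd_r_nu => x rx e _ /=; rewrite [X in lne X]e lne_EFin.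
rewrite integralE.
transitivity (\int[nu]_x (p x)%:E - \int[nu]_x (q x)%:E).
  congr (_ - _); apply: eq_integral => x _.
    by rewrite funeposE -EFin_max.
  by rewrite funenegE -EFinN -EFin_max.
rewrite !(integral_absolutely_continuous nr nuE)//.
have npr := nnmf_mul np nr; have nqr := nnmf_mul nq nr; have nh := nnmf_hent nr.
have n1 := nnmf1 S R.
have q1 x : (q x * r x <= 1)%R.
  have := hent_ge0 (r0 x); have := r0 x; rewrite /hent /q.
  by case: (leP (- ln (r x))%R 0%R) => h; rewrite ?mul0r; nra.
have qfin : \int[mu]_x (q x * r x)%:E \is a fin_num.
  rewrite ge0_fin_numE; last exact: integral_nnmf_ge0 nqr.
  apply: le_lt_trans (ltry 1); rewrite -(integral_prob1 mu).
  exact: le_integral_nnmf nqr n1 q1.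
have r1 : \int[mu]_x (r x)%:E = 1 by rewrite -nuE//; exact: probability_setT.
have : \int[mu]_x (hent (r x) + q x * r x + r x)%:E =
    \int[mu]_x (p x * r x + 1)%:E.
  apply: eq_integral => x _; congr EFin.
  have e : (ln (r x) = p x - q x)%R.
    rewrite /p /q.
    by case: (leP (- ln (r x))%R 0%R) => h1; case: (leP (ln (r x)) 0%R) => h2; lra.
  by rewrite /hent e; ring.
rewrite (integral_nnmfD mu (nnmf_add nh nqr) nr) (integral_nnmfD mu nh nqr).
rewrite (integral_nnmfD mu npr n1) r1 integral_prob1 => /(congr1 (fun y => y - 1)).
by rewrite !addeK// => <-; rewrite addeK.
Qed.

End from_density.

Lemma density_exists : nu `<< mu -> exists r : S -> R, nnmf r /\
  forall A, measurable A -> nu A = \int[mu]_(x in A) (r x)%:E.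
Proof.
move=> nm; pose f := Radon_Nikodym_SigmaFinite.f nu mu.
have f0 x : 0 <= f x by exact: Radon_Nikodym_SigmaFinite.f_ge0.
have mf : measurable_fun setT f.
  exact: measurable_int (Radon_Nikodym_SigmaFinite.f_integrable nm).
exists (fine \o f); split; first exact: nnmf_fine.
move=> A mA; rewrite (Radon_Nikodym_SigmaFinite.f_integral nm mA).
apply: eq_integral => x _; rewrite /= fineK//.
exact: Radon_Nikodym_SigmaFinite.f_fin_num.
Qed.

End relative_entropy.

(** * Exponential integrability from the transport inequality *)

Section conditioning.
Context d (S : measurableType d) (R : realType) (mu : probability S R).
Variables (A : set S) (p : R).
Hypotheses (mA : measurable A) (p0 : 0 < p) (muA : mu A = p%:E).
Local Open Scope ereal_scope.

Definition conditional_density x : R := (\1_A x * p^-1)%R.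

Lemma nnmf_conditional_density : nnmf conditional_density.
Proof.
apply: nnmf_mul; first exact: nnmf_indic.
by apply: nnmf_cst; rewrite invr_ge0 ltW.
Qed.

Let nI : nnmf (\1_A : S -> R). Proof. exact: nnmf_indic. Qed.

Let int_indic (B : set S) : measurable B -> \int[mu]_x (\1_B x)%:E = mu B.
Proof. by move=> mB; rewrite integral_indic// setIT. Qed.

Let mass1 : density_measure mu nnmf_conditional_density setT = 1.
Proof.
rewrite /density_measure /conditional_density.
under eq_integral do rewrite mulrC.
have pV0 : (0 <= p^-1)%R by rewrite invr_ge0 ltW.
by rewrite (integral_nnmfZ _ pV0 nI) int_indic// muA -EFinM mulVf// gt_eqF.
Qed.

Definition conditional_law : probability S R := unit_mass_probability mass1.

Lemma conditional_lawE B : measurable B ->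
  conditional_law B = \int[mu]_(x in B) (conditional_density x)%:E.
Proof. by []. Qed.

Lemma rel_entropy_conditional : rel_entropy conditional_law mu = (- ln p)%:E.
Proof.
rewrite (rel_entropy_density nnmf_conditional_density conditional_lawE).
have c0 : (0 <= hent p^-1)%R by rewrite hent_ge0// invr_ge0 ltW.
have nIC : nnmf (\1_(~` A) : S -> R) by apply: nnmf_indic; exact: measurableC.
have ncI : nnmf (fun x => hent p^-1 * \1_A x)%R.
  by apply: nnmf_mul => //; exact: nnmf_cst.
transitivity (\int[mu]_x (hent p^-1 * \1_A x + \1_(~` A) x)%:E).
  apply: eq_integral => x _; congr EFin; rewrite /conditional_density !indicE in_setC.
  by case: (x \in A); rewrite /= ?mul1r ?mul0r ?mulr1 ?mulr0 ?addr0 ?add0r ?hent0.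
rewrite (integral_nnmfD _ ncI nIC) (integral_nnmfZ _ c0 nI).
rewrite !int_indic//; last exact: measurableC.
rewrite [mu (~` A)]probability_setC// muA -EFinM -EFinB -EFinD; congr EFin.
rewrite /hent lnV ?posrE//; field; by rewrite gt_eqF.
Qed.

End conditioning.

Lemma measurable_level d (S : measurableType d) (R : realType) (phi : S -> R)
    (s : R) : nnmf phi -> measurable [set x | s <= phi x].
Proof.
move=> [mphi _]; rewrite (_ : mkset _ = phi @^-1` `[s, +oo[%classic).
  exact: measurable_preimage.
by apply/seteqP; split=> x /=; rewrite in_itv/= andbT.
Qed.

Section marton.
Context {R : realType} {S : ptopologicalType} (d : S -> S -> R).
Hypotheses (dm : is_metric d) (dz : metrizes d).
Variable mu : probability (borel S) R.
Local Open Scope ereal_scope.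

Lemma first_moment_fin x0 : finite_first_moment d mu ->
  \int[mu]_x (d x x0)%:E < +oo.
Proof.
move=> [x1 h]; case: (dm) => _ _ dT.
have n1 := nnmf_metric_to dm dz x1; have d0 := metric_ge0 dm x1 x0.
apply: (@le_lt_trans _ _ (\int[mu]_x (d x x1 + d x1 x0)%:E)).
  apply: le_integral_nnmf; first exact: nnmf_metric_to.
    by apply: nnmf_add => //; exact: nnmf_cst.
  by move=> x; exact: dT.
rewrite (integral_nnmfD _ n1 (nnmf_cst _ d0)).
rewrite integral_cst// [X in _ + _ * X]probability_setT mule1.
by apply: lte_add_pinfty => //; exact: ltry.
Qed.

Let integral_fst nu pi (F : borel S -> R) : coupling mu nu pi -> nnmf F ->
  \int[pi]_z (F z.1)%:E = \int[mu]_x (F x)%:E.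
Proof.
move=> cp nF; apply: (integral_law (@measurable_borel_fst S S)) nF => A mA.
by have [] := cp A mA.
Qed.

Let integral_snd nu pi (F : borel S -> R) : coupling mu nu pi -> nnmf F ->
  \int[pi]_z (F z.2)%:E = \int[nu]_x (F x)%:E.
Proof.
move=> cp nF; apply: (integral_law (@measurable_borel_snd S S)) nF => A mA.
by have [] := cp A mA.
Qed.

(** The distance to [x0] is 1-Lipschitz. *)
Lemma W1_ge_moment_diff (nu : probability (borel S) R) x0 (m s : R) :
  \int[mu]_x (d x x0)%:E = m%:E ->
  s%:E <= \int[nu]_x (d x x0)%:E -> (s - m)%:E <= W1 d mu nu.
Proof.
move=> mE sE; apply: le_ereal_inf_tmp => _ [pi cp <-].
have nphi := nnmf_metric_to dm dz x0.
have nc : nnmf ((fun z => d z.1 z.2) : borel (S * S)%type -> R).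
  by split=> [|z]; [exact: measurable_metric|exact: metric_ge0].
have n1 : nnmf ((fun z => d z.1 x0) : borel (S * S)%type -> R).
  exact: (nnmf_comp nphi (@measurable_borel_fst S S)).
have n2 : nnmf ((fun z => d z.2 x0) : borel (S * S)%type -> R).
  exact: (nnmf_comp nphi (@measurable_borel_snd S S)).
rewrite EFinB leeBlDr// -mE -(integral_fst cp nphi).
apply: (le_trans sE); rewrite -(integral_snd cp nphi).
rewrite /transport_cost -(integral_nnmfD _ nc n1).
apply: le_integral_nnmf => //; first exact: nnmf_add.
by move=> z; case: dm => _ dC dT; rewrite (dC z.1 z.2); exact: dT.
Qed.

(** Marton's argument: a law conditioned on being far from [x0] is far from
    [mu] in transport distance, hence has large entropy, so the conditioning
    event is unlikely. *)
Lemma gaussian_tail (C : R) x0 (m s : R) : (0 < C)%R ->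
  (forall nu, W1 d mu nu <= C%:E * sqrte (2%:E * rel_entropy nu mu)) ->
  \int[mu]_x (d x x0)%:E = m%:E -> (m <= s)%R ->
  mu [set x | (s <= d x x0)%R] <= (expR (- ((s - m) ^+ 2 / (2 * C ^+ 2))))%:E.
Proof.
move=> C0 T1 mE ms; set A : set (borel S) := [set x | _].
have nphi := nnmf_metric_to dm dz x0.
have mA : measurable A.
  exact: measurable_level nphi.
pose p := fine (mu A).
have pE : mu A = p%:E by rewrite fineK// fin_num_measure.
have [p0|p0] := leP p 0%R; first by rewrite pE lee_fin (le_trans p0)// expR_ge0.
pose nu := conditional_law mA p0 pE.
have nr := nnmf_conditional_density mA p0.
have sE : s%:E <= \int[nu]_x (d x x0)%:E.
  rewrite (integral_absolutely_continuous nr (conditional_lawE mA p0 pE) nphi).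
  have m0 : (0 <= m)%R by rewrite -lee_fin -mE integral_nnmf_ge0.
  have s0 : (0 <= s)%R := le_trans m0 ms.
  have e : \int[mu]_x (s * conditional_density A p x)%:E = s%:E.
    rewrite (integral_nnmfZ _ s0 nr) -(conditional_lawE mA p0 pE)//.
    by rewrite probability_setT mule1.
  rewrite -[leLHS]e; apply: le_integral_nnmf.
  - by apply: nnmf_mul => //; exact: nnmf_cst.
  - exact: nnmf_mul.
  - move=> x; rewrite /conditional_density indicE.
    have [xA|xA] := boolP (x \in A); last by rewrite mul0r !mulr0.
    rewrite mul1r; apply: ler_wpM2r; first by rewrite invr_ge0 ltW.
    by move: xA; rewrite inE.
have := le_trans (W1_ge_moment_diff mE sE) (T1 nu).
rewrite rel_entropy_conditional -EFinM /= lee_fin => h.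
rewrite pE lee_fin -[leLHS](lnK p0) ler_expR.
have p1 : (p <= 1)%R by rewrite -lee_fin -pE probability_le1.
have l0 : (0 <= 2 * - ln p)%R by rewrite mulr_ge0// oppr_ge0 ln_le0.
have : ((s - m) ^+ 2 <= (C * Num.sqrt (2 * - ln p)) ^+ 2)%R.
  by rewrite ler_pXn2r// ?nnegrE ?subr_ge0// mulr_ge0 ?sqrtr_ge0// ltW.
rewrite exprMn sqr_sqrtr// => h2.
rewrite lerNr ler_pdivrMr; last by rewrite mulr_gt0// exprn_gt0.
by move: h2; lra.
Qed.

End marton.

(** Sum the tails over integer levels: for [n >= m] the exponent is a quadratic
    polynomial in [n] with leading coefficient [alpha - c < 0], hence at most
    [K - n] for some constant [K]. *)
Lemma exp_moment_of_tail d (S : measurableType d) (R : realType)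
    (mu : probability S R) (phi : S -> R) (alpha c m : R) :
  nnmf phi -> 0 <= m -> 0 < alpha < c ->
  (forall s : R, m <= s ->
    (mu [set x | (s <= phi x)%R] <= (expR (- (c * (s - m) ^+ 2)))%:E)%E) ->
  (\int[mu]_x (expR (alpha * phi x ^+ 2))%:E < +oo)%E.
Proof.
move=> nphi m0 /andP[a0 ac] tail; have [mphi phi0] := nphi.
pose A n : set S := [set x | n%:R <= phi x].
have mA n : measurable (A n) := measurable_level n%:R nphi.
pose w n : R := expR (alpha * n.+1%:R ^+ 2).
pose u n x := ((w n * \1_(A n) x)%:E)%E.
have nu n : nnmf (fun x => w n * \1_(A n) x).
  apply: nnmf_mul; first by apply: nnmf_cst; exact: expR_ge0.
  exact: nnmf_indic.
(* The first two terms of [K] bound the exponent plus [n] for [n <= m], the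
   last two, by completing the square, for [m <= n]. *)
pose b := 2 * alpha + 2 * c * m + 1.
pose K := alpha * (m + 1) ^+ 2 + m + b ^+ 2 / (4 * (c - alpha)) + alpha.
have D0 : 0 < c - alpha by rewrite subr_gt0.
have q0 : 0 <= b ^+ 2 / (4 * (c - alpha)) by rewrite divr_ge0 ?sqr_ge0// mulr_ge0// ltW.
have pow2 n : expR (K - n%:R) <= expR K * (2 ^+ n)^-1.
  rewrite expRD expRN; apply: ler_wpM2l; first exact: expR_ge0.
  rewrite lef_pV2 ?posrE ?expR_gt0 ?exprn_gt0//.
  elim: n => [|n IH]; first by rewrite expR0 expr0.
  rewrite exprSr -(natr1 n) expRD; apply: ler_pM => //.
  by have := expR_ge1Dx (1 : R); lra.
have near n : n%:R <= m -> alpha * n.+1%:R ^+ 2 <= K - n%:R.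
  have n0 : 0 <= n%:R :> R by [].
  rewrite -(natr1 n); move: (n%:R : R) n0 => x x0 xm.
  have : (x + 1) ^+ 2 <= (m + 1) ^+ 2 by rewrite ler_pXn2r ?nnegrE ?addr_ge0// lerD2r.
  move=> /(ler_wpM2l (ltW a0)); rewrite /K; move: q0; lra.
have far n : m <= n%:R ->
    alpha * n.+1%:R ^+ 2 - c * (n%:R - m) ^+ 2 <= K - n%:R.
  rewrite -(natr1 n); move: (n%:R : R) => x xm.
  have q1 : 0 <= (b - 2 * (c - alpha) * x) ^+ 2 / (4 * (c - alpha)).
    by rewrite divr_ge0 ?sqr_ge0// mulr_ge0// ltW.
  have e : (b - 2 * (c - alpha) * x) ^+ 2 / (4 * (c - alpha)) =
      b ^+ 2 / (4 * (c - alpha)) - b * x + (c - alpha) * x ^+ 2.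
    by field; rewrite gt_eqF.
  rewrite e in q1; have cm0 : 0 <= c * m ^+ 2 by rewrite mulr_ge0 ?sqr_ge0// ltW// (lt_trans a0).
  have am0 : 0 <= alpha * (m + 1) ^+ 2 by rewrite mulr_ge0 ?sqr_ge0// ltW.
  move: q1; rewrite /K; set q := b ^+ 2 / _; rewrite /b; lra.
have term n : (\int[mu]_x u n x <= (expR K * (2 ^+ n)^-1)%:E)%E.
  rewrite /u (integral_nnmfZ mu (expR_ge0 _) (nnmf_indic R (mA n))).
  rewrite integral_indic// setIT.
  have [nm|mn] := leP n%:R m.
    apply: (@le_trans _ _ ((w n)%:E * 1)%E).
      by apply: lee_wpmul2l; [rewrite lee_fin expR_ge0|exact: probability_le1].
    by rewrite mule1 lee_fin; apply: le_trans (pow2 n); rewrite ler_expR near.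
  apply: (le_trans (lee_wpmul2l _ (tail _ (ltW mn)))); first by rewrite lee_fin expR_ge0.
  rewrite -EFinM lee_fin -expRD; apply: le_trans (pow2 n); rewrite ler_expR.
  exact: far (ltW mn).
have u0 n x : (0 <= u n x)%E by exact: (nnmf_EFin_ge0 x (nu n)).
have mu_ n : measurable_fun setT (u n) by exact: nnmf_EFin (nu n).
have nexp : nnmf (fun x => expR (alpha * phi x ^+ 2)).
  by apply: nnmf_expR; apply: measurable_funM => //; exact: measurable_funX.
apply: (@le_lt_trans _ _ (\int[mu]_x (\sum_(n <oo) u n x))%E).
  apply: ge0_le_integral => //.
  - exact: nnmf_EFin nexp.
  - by apply: ge0_emeasurable_sum => n.
  - move=> x _; have /andP[h1 h2] := truncn_itv (phi0 x).
    pose n := Num.truncn (phi x).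
    apply: (@le_trans _ _ (u n x)).
      rewrite /u indicE mem_set// mulr1 lee_fin ler_expR.
      by apply: ler_wpM2l; [exact: ltW|rewrite ler_pXn2r// ?nnegrE// ltW].
    have := @nneseries_lim_ge R (u^~ x) xpredT 0 n.+1 (fun i _ _ => u0 i x).
    apply: le_trans; rewrite big_nat_recr//= leeDr// sume_ge0// => i _; exact: u0.
rewrite integral_nneseries//.
apply: (@le_lt_trans _ _ (2 * expR K)%:E); last exact: ltry.
apply: lime_le.
  by apply: is_cvg_nneseries => n _ _; exact: integral_ge0.
apply: nearW => n.
apply: (@le_trans _ _ (\sum_(0 <= i < n) (expR K * (2 ^+ i)^-1)%:E)%E).
  by apply: lee_sum => i _.
rewrite sumEFin lee_fin -mulr_sumr mulrC; apply: ler_wpM2r; first exact: expR_ge0.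
suff -> : \sum_(0 <= i < n) (2 ^+ i)^-1 = 2 - 2 * (2 ^+ n)^-1 :> R.
  by rewrite lerBlDr lerDl mulr_ge0// invr_ge0 exprn_ge0.
elim: n => [|n IH]; first by rewrite big_nil expr0 invr1 mulr1 subrr.
by rewrite big_nat_recr//= IH exprSr invfM; move: (_ ^- n) => z; field.
Qed.

(** * The chain of inequalities *)

Lemma rel_entropy_ge0 d (S : measurableType d) (R : realType)
    (mu nu : probability S R) : (0 <= rel_entropy nu mu)%E.
Proof.
have [nm|nm] := pselect (nu `<< mu); last first.
  by rewrite /rel_entropy; case: asboolP => // _; rewrite leey.
have [r [nr nuE]] := density_exists nm.
by rewrite (rel_entropy_density nr nuE); exact: integral_nnmf_ge0 (nnmf_hent nr).
Qed.

Section chain.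
Context {R : realType} {T : nat} {X : 'I_T -> ptopologicalType}.
Local Notation S := (path_space X).
Hypothesis Xpol : forall t, polish R (X t).
Variable d : S -> S -> R.
Hypotheses (dm : is_metric d) (dz : metrizes d).
Variable mu : probability (borel S) R.

Lemma W1_le_AW1 nu : (W1 d mu nu <= AW1 d mu nu)%E.
Proof.
by apply: ereal_inf_le_tmp => _ [pi [cp _] <-]; exists pi.
Qed.

Lemma adapted_T1_of_exp_moment (x0 : S) (alpha : R) : 0 < alpha ->
  (\int[mu]_x (expR (alpha * d x x0 ^+ 2))%:E < +oo)%E ->
  adapted_T1_inequality d mu
    ((2 * Num.sqrt T%:R + 1) / Num.sqrt alpha *
     Num.sqrt (1 + ln (\int[mu]_x expR (alpha * d x x0 ^+ 2)))).
Proof.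
move=> a0 Efin nu; set E : R := \int[mu]_x _; set C' : R := _ * _.
have nphi := nnmf_metric_to dm dz x0.
have nexp : nnmf ((fun x => expR (alpha * d x x0 ^+ 2)) : borel S -> R).
  by apply: nnmf_expR; have [mphi _] := nphi; apply: measurable_funM => //;
    exact: measurable_funX.
have EE : (\int[mu]_x (expR (alpha * d x x0 ^+ 2))%:E = E%:E)%E.
  rewrite /E /Rintegral fineK// ge0_fin_numE//; exact: integral_nnmf_ge0 nexp.
have E1 : 1 <= E := exp_moment_ge1 nphi a0 EE.
have C'0 : 0 < C'.
  have h1 : 0 < 2 * Num.sqrt T%:R + 1 :> R by rewrite ltr_wpDl// mulr_ge0 ?sqrtr_ge0.
  have h2 : 0 < 1 + ln E by rewrite ltr_pwDl// ln_ge0.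
  by rewrite mulr_gt0 ?divr_gt0 ?sqrtr_gt0.
have infE : (C'%:E * sqrte (2%:E * +oo) = +oo)%E.
  by rewrite gt0_muley ?lte_fin//= gt0_muley ?lte_fin.
have [nm|nm] := pselect (nu `<< mu); last first.
  rewrite /rel_entropy; case: asboolP => // _.
  by rewrite infE leey.
have [r [nr nuE]] := density_exists nm.
have := rel_entropy_ge0 mu nu; rewrite (rel_entropy_density nr nuE).
case rH : (integral _ _ _) => [H||]// _; last by rewrite infE leey.
have := AW1_density_bound Xpol dm dz nr nuE a0 EE rH.
by rewrite -EFinM.
Qed.

Lemma T1_exp_moment (C : R) (x0 : S) (alpha : R) : 0 < C ->
  finite_first_moment d mu -> T1_inequality d mu C ->
  0 < alpha < 1 / (2 * C ^+ 2) ->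
  (\int[mu]_x (expR (alpha * d x x0 ^+ 2))%:E < +oo)%E.
Proof.
move=> C0 mu1 T1 aC; have nphi := nnmf_metric_to dm dz x0.
have mfin := first_moment_fin dm dz x0 mu1.
pose m := fine (\int[mu]_x (d x x0)%:E)%E.
have mE : (\int[mu]_x (d x x0)%:E = m%:E)%E.
  by rewrite fineK// ge0_fin_numE//; exact: integral_nnmf_ge0 nphi.
have m0 : 0 <= m by rewrite -lee_fin -mE; exact: integral_nnmf_ge0 nphi.
apply: (exp_moment_of_tail nphi m0 aC) => s ms.
by rewrite div1r mulrC; exact: (gaussian_tail dm dz C0 T1 mE ms).
Qed.

End chain.

Theorem corollary8 (R : realType) (T : nat) (T_ge1 : (1 <= T)%N)
    (X : 'I_T -> ptopologicalType) (X_polish : forall t, polish R (X t))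
    (d : path_space X -> path_space X -> R)
    (d_metric : is_metric d) (d_metrizes : metrizes d)
    (mu : probability (borel (path_space X)) R)
    (mu_P1 : finite_first_moment d mu)
    (C : R) (C_gt0 : 0 < C) :
  (adapted_T1_inequality d mu C -> T1_inequality d mu C) /\
  (T1_inequality d mu C ->
     forall (x0 : path_space X) (alpha : R),
       0 < alpha < 1 / (2 * C ^+ 2) ->
       (\int[mu]_x (expR (alpha * d x x0 ^+ 2))%:E < +oo)%E /\
       adapted_T1_inequality d mu
         ((2 * Num.sqrt T%:R + 1) / Num.sqrt alpha *
          Num.sqrt (1 + ln (\int[mu]_x expR (alpha * d x x0 ^+ 2))))).
Proof.
split=> [aT1 nu|T1 x0 alpha aC]; first exact: le_trans (W1_le_AW1 d mu nu) (aT1 nu).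
have Efin := T1_exp_moment d_metric d_metrizes x0 C_gt0 mu_P1 T1 aC.
split=> //; have /andP[a0 _] := aC.
exact: (adapted_T1_of_exp_moment X_polish d_metric d_metrizes a0 Efin).
Qed.
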